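(* Let $\mathcal{G}$ be a Hausdorff ample groupoid, and let $\mathfrak{A}(\mathcal{G})$ denote either $L^I(\mathcal{G})$, $F_\lambda^{p,\ast}(\mathcal{G})$, or $F_\lambda^p(\mathcal{G})$, with $p\in[1,\infty)\setminus\{2\}$. Then the sequence of groups $$1\to\mathbf{Z^1}(\mathcal{G},\mathbb{T})\xrightarrow{\ \Gamma\ }\mathbf{Aut}(\mathfrak{A}(\mathcal{G}))\xrightarrow{\ \Omega\ }\mathbf{Aut}(\mathcal{G})\to1$$ is split exact. If, in addition, $\mathcal{G}$ is effective and has compact unit space, then $\Gamma$ and $\Omega$ induce split exact sequences $$1\to\mathbf{B^1}(\mathcal{G},\mathbb{T})\xrightarrow{\ \Gamma\ }\mathbf{Inn}(\mathfrak{A}(\mathcal{G}))\xrightarrow{\ \Omega\ }\mathsf{F}(\mathcal{G})\to1$$ and $$1\to\mathbf{H^1}(\mathcal{G},\mathbb{T})\xrightarrow{\ \overline{\Gamma}\ }\mathbf{Out}(\mathfrak{A}(\mathcal{G}))\xrightarrow{\ \overline{\Omega}\ }\mathbf{Aut}(\mathcal{G})/\mathsf{F}(\mathcal{G})\to1.$$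
   Context: Groupoids are locally compact topological groupoids. $\mathcal{G}^{(0)}$ is the unit space, $\mathsf{r},\mathsf{s}$ are the range and source maps; $\mathcal{G}$ is étale if $\mathsf{r},\mathsf{s}$ are local homeomorphisms. A bisection is a subset on which $\mathsf{r}$ and $\mathsf{s}$ are injective. $\mathcal{G}$ is ample if it is étale and its topology has a basis of compact open bisections. $\mathcal{G}$ is effective if the interior of $\mathrm{Iso}(\mathcal{G})=\{x:\mathsf{r}(x)=\mathsf{s}(x)\}$ equals $\mathcal{G}^{(0)}$. $\mathbf{Aut}(\mathcal{G})$ is the group of topological groupoid automorphisms. For $u\in\mathcal{G}^{(0)}$ put $\mathcal{G}_u=\mathsf{s}^{-1}(u)$, $\mathcal{G}^u=\mathsf{r}^{-1}(u)$. $C_c(\mathcal{G})$ carries the convolution $(f\ast g)(x)=\sum_{yz=x}f(y)g(z)$ and involution $f^*(x)=\overline{f(x^{-1})}$. - $L^I(\mathcal{G})$ is the completion of $C_c(\mathcal{G})$ in $\|f\|_I=\max\{\sup_u\sum_{x\in\mathcal{G}_u}|f(x)|,\ \sup_u\sum_{x\in\mathcal{G}^u}|f(x)|\}$. - $F_\lambda^p(\mathcal{G})$ is the completion of $C_c(\mathcal{G})$ in $\|f\|_{F^p_\lambda}=\sup_u\|\lambda_u(f)\|_{\mathcal{B}(\ell^p(\mathcal{G}_u))}$, where $(\lambda_u(f)\xi)(x)=\sum_{y\in\mathcal{G}_u}f(xy^{-1})\xi(y)$. - $F_\lambda^{p,\ast}(\mathcal{G})$ is the completion of $C_c(\mathcal{G})$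 in $\max\{\|f\|_{F^p_\lambda},\|f^*\|_{F^p_\lambda}\}$. In each case the inclusion $C_c(\mathcal{G})\subseteq C_0(\mathcal{G})$ extends to an injective contractive linear map $\mathfrak{A}(\mathcal{G})\to C_0(\mathcal{G})$, by which elements of $\mathfrak{A}(\mathcal{G})$ are regarded as functions on $\mathcal{G}$; $\operatorname{supp}(\mathfrak{a})=\{x:\mathfrak{a}(x)\ne0\}$. Functions on $\mathcal{G}^{(0)}$ are extended by zero, so $C_0(\mathcal{G}^{(0)})\subseteq\mathfrak{A}(\mathcal{G})$. If $\mathcal{G}^{(0)}$ is compact, $\mathfrak{A}(\mathcal{G})$ is unital with unit $\mathbbm{1}_{\mathcal{G}^{(0)}}$. For a Banach algebra $\mathfrak{A}$, $\mathbf{Aut}(\mathfrak{A})$ is the group of isometric algebra automorphisms. If $\mathfrak{A}$ is unital, $\mathbf{U}(\mathfrak{A})$ is the group of invertible $\mathfrak{u}$ with $\|\mathfrak{u}\|=\|\mathfrak{u}^{-1}\|=1$, $\mathbf{Inn}(\mathfrak{A})$ is the normal subgroup of all automorphisms $\mathfrak{a}\mapsto\mathfrak{u}\mathfrak{a}\mathfrak{u}^{-1}$ with $\mathfrak{u}\in\mathbf{U}(\mathfrak{A})$, and $\mathbf{Out}(\mathfrak{A})=\mathbf{Aut}(\mathfrak{A})/\mathbf{Inn}(\mathfrak{A})$. $\mathbf{Z^1}(\mathcal{G},\mathbb{T})$ is the group (pointwise product) of 1-cocycles, i.e. continuous groupoid homomorphisms $\mathcal{G}\to\mathbb{T}$.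 $\mathbf{B^1}(\mathcal{G},\mathbb{T})$ is its subgroup of 1-coboundaries, i.e. maps of the form $\widehat f(x)=\overline{f(\mathsf{r}(x))}f(\mathsf{s}(x))$ with $f\in C(\mathcal{G}^{(0)},\mathbb{T})$. $\mathbf{H^1}(\mathcal{G},\mathbb{T})=\mathbf{Z^1}(\mathcal{G},\mathbb{T})/\mathbf{B^1}(\mathcal{G},\mathbb{T})$. If $\mathcal{G}^{(0)}$ is compact, the topological full group $\mathsf{F}(\mathcal{G})$ is the group of open bisections $B$ with $\mathsf{r}(B)=\mathsf{s}(B)=\mathcal{G}^{(0)}$ under set multiplication $AB=\{ab:a\in A,b\in B,\mathsf{s}(a)=\mathsf{r}(b)\}$ and inversion. When $\mathcal{G}$ is effective, $\mathsf{F}(\mathcal{G})$ is regarded as a subgroup of $\mathbf{Aut}(\mathcal{G})$ by identifying $B$ with the automorphism $x\mapsto BxB^{-1}$. The map $\Gamma$: for $\xi\in\mathbf{Z^1}(\mathcal{G},\mathbb{T})$, $\Gamma(\xi)$ is the automorphism of $\mathfrak{A}(\mathcal{G})$ extending $C_c(\mathcal{G})\ni f\mapsto\xi f$ (pointwise product). The map $\Omega$: let $\mathcal{B}^{\mathrm{o}}_{\mathrm{c}}(\mathcal{G})$ be the inverse semigroup of compact open bisections. It is known that for $\alpha\in\mathbf{Aut}(\mathfrak{A}(\mathcal{G}))$ and $B\in\mathcal{B}^{\mathrm{o}}_{\mathrm{c}}(\mathcal{G})$, the set $\Phi_\alpha(B):=\operatorname{supp}(\alpha(\mathbbm{1}_B))$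 is in $\mathcal{B}^{\mathrm{o}}_{\mathrm{c}}(\mathcal{G})$ and $\alpha(\mathbbm{1}_B)$ is $\mathbb{T}$-valued on it, and that $\alpha\mapsto\Phi_\alpha$ is a group homomorphism into the automorphism group of the inverse semigroup $\mathcal{B}^{\mathrm{o}}_{\mathrm{c}}(\mathcal{G})$. It is also known that $\alpha$ restricts to an automorphism of $C_0(\mathcal{G}^{(0)})$, giving a homeomorphism $\Upsilon_\alpha$ of $\mathcal{G}^{(0)}$ with $\alpha(f)(u)=f(\Upsilon_\alpha^{-1}(u))$ for $f\in C_0(\mathcal{G}^{(0)})$. For $x\in\mathcal{G}$, $\Omega_\alpha(x)$ is the unique element of $\Phi_\alpha(B)$ with source $\Upsilon_\alpha(\mathsf{s}(x))$ (equivalently, with range $\Upsilon_\alpha(\mathsf{r}(x))$), for any $B\in\mathcal{B}^{\mathrm{o}}_{\mathrm{c}}(\mathcal{G})$ containing $x$; this is independent of $B$, and $\Omega\colon\alpha\mapsto\Omega_\alpha$ is a group homomorphism $\mathbf{Aut}(\mathfrak{A}(\mathcal{G}))\to\mathbf{Aut}(\mathcal{G})$. In the second sequence $\Gamma,\Omega$ denote the restrictions (that these map into the indicated groups is part of the claim), and $\overline\Gamma,\overline\Omega$ are the maps induced on quotients. *)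

(* Defs.v *)
From HB Require Import structures.
From mathcomp Require Import all_boot all_order all_algebra.
From mathcomp Require Import all_classical all_reals all_analysis.
From mathcomp Require Import generic_quotient complex.

Set Implicit Arguments.
Unset Strict Implicit.
Unset Printing Implicit Defensive.

Import Order.TTheory GRing.Theory Num.Theory.
Import numFieldNormedType.Exports.

Local Open Scope classical_set_scope.
Local Open Scope ring_scope.
Local Open Scope quotient_scope.

Record subgroup (gT : groupType) := Subgroup {
  sg_set :> set gT;
  sg1 : sg_set 1%g;
  sgM : forall x y, sg_set x -> sg_set y -> sg_set (x * y)%g;
  sgV : forall x, sg_set x -> sg_set (x^-1)%g }.

Record normal_subgroup (gT : groupType) := NormalSubgroup {
  nsg_sub :> subgroup gT;
  nsgJ : forall x y : gT,
    sg_set nsg_sub x -> sg_set nsg_sub (y * x * y^-1)%g }.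

Section SubgroupType.
Variables (gT : groupType) (H : subgroup gT).

Record subg := Subg { subg_val : gT; subg_mem : sg_set H subg_val }.

Lemma subg_inj (x y : subg) : subg_val x = subg_val y -> x = y.
Proof.
case: x y => [x Hx] [y Hy] /= exy; rewrite exy in Hx *.
by congr Subg; exact: Prop_irrelevance.
Qed.

HB.instance Definition _ := gen_eqMixin subg.
HB.instance Definition _ := gen_choiceMixin subg.

Definition subg_one := Subg (sg1 H).
Definition subg_mul (x y : subg) := Subg (sgM (subg_mem x) (subg_mem y)).
Definition subg_inv (x : subg) := Subg (sgV (subg_mem x)).

Fact subg_mulA : associative subg_mul.
Proof. by move=> x y z; apply: subg_inj; rewrite /= mulgA. Qed.
Fact subg_mul1 : left_id subg_one subg_mul.
Proof. by move=> x; apply: subg_inj; rewrite /= mul1g. Qed.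
Fact subg_mulr1 : right_id subg_one subg_mul.
Proof. by move=> x; apply: subg_inj; rewrite /= mulg1. Qed.
Fact subg_mulV : left_inverse subg_one subg_inv subg_mul.
Proof. by move=> x; apply: subg_inj; rewrite /= mulVg. Qed.
Fact subg_mulrV : right_inverse subg_one subg_inv subg_mul.
Proof. by move=> x; apply: subg_inj; rewrite /= mulgV. Qed.

HB.instance Definition _ := isGroup.Build subg
  subg_mulA subg_mul1 subg_mulr1 subg_mulV subg_mulrV.

End SubgroupType.

Section Quotient.
Variables (gT : groupType) (N : normal_subgroup gT).

Definition coset_eq (x y : gT) : bool := `[< sg_set N (x^-1 * y)%g >].

Fact coset_eq_refl : reflexive coset_eq.
Proof. by move=> x; apply/asboolP; rewrite mulVg; exact: sg1. Qed.
Fact coset_eq_sym : symmetric coset_eq.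
Proof.
move=> x y; apply/asboolP/asboolP => /(@sgV _ N).
  by rewrite invgM invgK.
by rewrite invgM invgK.
Qed.
Fact coset_eq_trans : transitive coset_eq.
Proof.
move=> y x z /asboolP xy /asboolP yz; apply/asboolP.
by have := sgM xy yz; rewrite -mulgA mulVKg.
Qed.

Canonical coset_equiv :=
  EquivRel coset_eq coset_eq_refl coset_eq_sym coset_eq_trans.

Definition quot : Type := {eq_quot coset_equiv}.
HB.instance Definition _ := Choice.on quot.

Definition qpi (x : gT) : quot := \pi_{eq_quot coset_equiv} x.
Definition qrepr (q : quot) : gT := repr (q : {eq_quot coset_equiv}).

Lemma qreprK q : qpi (qrepr q) = q. Proof. exact: reprK. Qed.

Lemma qpiP x y : (qpi x = qpi y) <-> sg_set N (x^-1 * y)%g.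
Proof. by split => [/eqmodP/asboolP//|h]; apply/eqmodP/asboolP. Qed.

Definition quot_one := qpi 1%g.
Definition quot_mul (p q : quot) := qpi (qrepr p * qrepr q)%g.
Definition quot_inv (p : quot) := qpi (qrepr p)^-1%g.

Lemma quot_mulE x y : quot_mul (qpi x) (qpi y) = qpi (x * y)%g.
Proof.
have /qpiP hx := qreprK (qpi x); have /qpiP hy := qreprK (qpi y).
apply/qpiP; rewrite invgM.
have -> : ((qrepr (qpi y))^-1 * (qrepr (qpi x))^-1 * (x * y) =
  ((qrepr (qpi y))^-1 * y) *
  (y^-1 * ((qrepr (qpi x))^-1 * x) * (y^-1)^-1))%g.
  by rewrite invgK !mulgA mulgK.
by apply: sgM => //; exact: nsgJ.
Qed.

Lemma quot_invE x : quot_inv (qpi x) = qpi x^-1%g.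
Proof.
have /qpiP/(@sgV _ N) hx := qreprK (qpi x).
apply/qpiP; rewrite invgK; move: hx; rewrite invgM invgK => hx.
by have := nsgJ x hx; rewrite !mulgA mulgV mul1g.
Qed.

Fact quot_mulA : associative quot_mul.
Proof.
move=> p q r; rewrite -(qreprK p) -(qreprK q) -(qreprK r).
by rewrite !quot_mulE mulgA.
Qed.
Fact quot_mul1 : left_id quot_one quot_mul.
Proof. by move=> p; rewrite -(qreprK p) quot_mulE mul1g. Qed.
Fact quot_mulr1 : right_id quot_one quot_mul.
Proof. by move=> p; rewrite -(qreprK p) quot_mulE mulg1. Qed.
Fact quot_mulV : left_inverse quot_one quot_inv quot_mul.
Proof. by move=> p; rewrite -(qreprK p) quot_invE quot_mulE mulVg. Qed.
Fact quot_mulrV : right_inverse quot_one quot_inv quot_mul.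
Proof. by move=> p; rewrite -(qreprK p) quot_invE quot_mulE mulgV. Qed.

HB.instance Definition _ := isGroup.Build quot
  quot_mulA quot_mul1 quot_mulr1 quot_mulV quot_mulrV.

End Quotient.

Section Symmetric.
Variable T : Type.

Record sym := Sym {
  sym_fun :> T -> T;
  sym_inv : T -> T;
  symK : cancel sym_fun sym_inv;
  symVK : cancel sym_inv sym_fun }.

Lemma sym_inj (f g : sym) : (forall x, f x = g x) -> f = g.
Proof.
case: f g => [f f' fK f'K] [g g' gK g'K] /= /funext efg.
have efg' : f' = g'.
  by apply/funext => x; rewrite -[in LHS](g'K x) -efg fK.
subst g g'.
by congr Sym; exact: Prop_irrelevance.
Qed.

HB.instance Definition _ := gen_eqMixin sym.
HB.instance Definition _ := gen_choiceMixin sym.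

Definition sym_one := @Sym id id (fun=> erefl) (fun=> erefl).
Definition sym_mul (f g : sym) : sym :=
  @Sym (f \o g) (sym_inv g \o sym_inv f)
       (can_comp (@symK f) (@symK g)) (can_comp (@symVK g) (@symVK f)).
Definition sym_opp (f : sym) : sym := Sym (@symVK f) (@symK f).

Fact sym_mulA : associative sym_mul.
Proof. by move=> f g h; exact: sym_inj. Qed.
Fact sym_mul1 : left_id sym_one sym_mul.
Proof. by move=> f; exact: sym_inj. Qed.
Fact sym_mulr1 : right_id sym_one sym_mul.
Proof. by move=> f; exact: sym_inj. Qed.
Fact sym_mulV : left_inverse sym_one sym_opp sym_mul.
Proof. by move=> f; apply: sym_inj => x /=; rewrite symK. Qed.
Fact sym_mulrV : right_inverse sym_one sym_opp sym_mul.
Proof. by move=> f; apply: sym_inj => x /=; rewrite symVK. Qed.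

HB.instance Definition _ := isGroup.Build sym
  sym_mulA sym_mul1 sym_mulr1 sym_mulV sym_mulrV.

End Symmetric.

(* 1 -> H -> K -> L -> 1 is exact, and the surjection has a homomorphic
   section. *)
Definition split_exact (H K L : groupType)
    (f : {multiplicative H -> K}) (g : {multiplicative K -> L}) : Prop :=
  [/\ injective f,
      forall y, g y = 1%g <-> exists x, f x = y,
      forall z, exists y, g y = z
    & exists sigma : {multiplicative L -> K}, cancel sigma g].

(* The operations are total; [gmul x y] is meaningful only when
   [gsrc x = grng y].  Units are identified with the corresponding arrows. *)
Record groupoid := Groupoid {
  gcar :> topologicalType;
  gsrc : gcar -> gcar;
  grng : gcar -> gcar;
  ginv : gcar -> gcar;
  gmul : gcar -> gcar -> gcar;
  gsrc_src : forall x, gsrc (gsrc x) = gsrc x;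
  grng_src : forall x, grng (gsrc x) = gsrc x;
  gsrc_rng : forall x, gsrc (grng x) = grng x;
  grng_rng : forall x, grng (grng x) = grng x;
  gsrc_inv : forall x, gsrc (ginv x) = grng x;
  grng_inv : forall x, grng (ginv x) = gsrc x;
  gsrc_mul : forall x y, gsrc x = grng y -> gsrc (gmul x y) = gsrc y;
  grng_mul : forall x y, gsrc x = grng y -> grng (gmul x y) = grng x;
  gmulA : forall x y z, gsrc x = grng y -> gsrc y = grng z ->
    gmul x (gmul y z) = gmul (gmul x y) z;
  gmul_src : forall x, gmul x (gsrc x) = x;
  gmul_rng : forall x, gmul (grng x) x = x;
  gmul_inv : forall x, gmul x (ginv x) = grng x;
  gmul_invl : forall x, gmul (ginv x) x = gsrc x;
  gsrc_continuous : continuous gsrc;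
  grng_continuous : continuous grng;
  ginv_continuous : continuous ginv;
  gmul_continuous : {within [set q : gcar * gcar | gsrc q.1 = grng q.2],
    continuous (fun q : gcar * gcar => gmul q.1 q.2)};
  g_locally_compact : locally_compact [set: gcar] }.

Arguments gsrc {g} x.
Arguments grng {g} x.
Arguments ginv {g} x.
Arguments gmul {g} x y.

(* [f] is a local homeomorphism onto open parts of the subspace [D]. *)
Definition local_homeomorphism (X Y : topologicalType) (D : set Y)
    (f : X -> Y) : Prop :=
  (forall x, D (f x)) /\
  forall x, exists U : set X,
    [/\ open U, U x, set_inj U f, {within U, continuous f}
      & forall V, open V -> V `<=` U ->
          exists2 W, open W & f @` V = W `&` D].

Section GroupoidDefs.
Variable G : groupoid.
Implicit Types (x y : G) (A B : set G).

Definition units : set G := [set u | gsrc u = u].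
Definition src_fiber (u : G) : set G := [set x | gsrc x = u].
Definition rng_fiber (u : G) : set G := [set x | grng x = u].
Definition iso_bundle : set G := [set x | grng x = gsrc x].

Definition etale : Prop :=
  local_homeomorphism units (@grng G) /\ local_homeomorphism units (@gsrc G).

Definition bisection B : Prop := set_inj B grng /\ set_inj B gsrc.

Definition cobisection B : Prop := [/\ compact B, open B & bisection B].

Definition ample : Prop :=
  etale /\ forall x (U : set G), open U -> U x ->
    exists B, [/\ cobisection B, B x & B `<=` U].

Definition effective : Prop := interior iso_bundle = units.

Definition set_gmul A B : set G :=
  [set z | exists a b, [/\ A a, B b, gsrc a = grng b & z = gmul a b]].
Definition set_ginv A : set G := [set ginv a | a in A].

End GroupoidDefs.

Section GroupoidTheory.
Variable G : groupoid.
Implicit Types (x y : G) (A B : set G).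

Lemma gsrc_unit x : units (gsrc x). Proof. exact: gsrc_src. Qed.
Lemma grng_unit x : units (grng x). Proof. exact: gsrc_rng. Qed.
Lemma unit_rng u : @units G u -> grng u = u.
Proof. by move=> uu; rewrite -[in LHS]uu grng_src. Qed.

Lemma gmul_unitr x u : units u -> gsrc x = grng u -> gmul x u = x.
Proof. by move=> uu; rewrite unit_rng// => <-; exact: gmul_src. Qed.
Lemma gmul_unitl x u : units u -> gsrc u = grng x -> gmul u x = x.
Proof. by move=> uu; rewrite uu => ->; exact: gmul_rng. Qed.

Lemma gmulK x y : gsrc x = grng y -> gmul (gmul x y) (ginv y) = x.
Proof.
by move=> xy; rewrite -gmulA ?grng_inv// gmul_inv -xy gmul_src.
Qed.
Lemma gmulVK x y : gsrc x = gsrc y -> gmul (gmul x (ginv y)) y = x.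
Proof.
by move=> xy; rewrite -gmulA ?grng_inv ?gsrc_inv// gmul_invl -xy gmul_src.
Qed.
Lemma gmulKl x y : gsrc x = grng y -> gmul (ginv x) (gmul x y) = y.
Proof.
by move=> xy; rewrite gmulA ?gsrc_inv// gmul_invl xy gmul_rng.
Qed.

Lemma ginvK x : ginv (ginv x) = x.
Proof.
have := @gmulKl (ginv x) x (gsrc_inv x).
by rewrite gmul_invl -(grng_inv x) -gsrc_inv gmul_src.
Qed.

Lemma ginv_mul x y : gsrc x = grng y ->
  ginv (gmul x y) = gmul (ginv y) (ginv x).
Proof.
move=> xy.
have c : gsrc (ginv y) = grng (ginv x) by rewrite gsrc_inv grng_inv.
have <- : gmul (gmul (gmul (ginv y) (ginv x)) (gmul x y)) (ginv (gmul x y)) =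
          gmul (ginv y) (ginv x).
  by apply: gmulK; rewrite gsrc_mul// gsrc_inv grng_mul.
rewrite -[gmul (gmul (ginv y) _) (gmul x y)]gmulA//; last first.
  by rewrite gsrc_inv grng_mul.
rewrite gmulKl// gmul_invl -(gsrc_mul xy) -grng_inv.
exact/esym/gmul_rng.
Qed.

Lemma set_gmulA A B (D : set G) :
  set_gmul A (set_gmul B D) = set_gmul (set_gmul A B) D.
Proof.
apply/seteqP; split => z.
  move=> [a [_ [Aa [b [d [Bb Dd bd ->]]] ab ->]]]; rewrite grng_mul// in ab.
  exists (gmul a b), d; split => //; last by rewrite gmulA.
  - by exists a, b.
  - by rewrite gsrc_mul.
move=> [_ [d [[a [b [Aa Bb ab ->]]] Dd bd ->]]]; rewrite gsrc_mul// in bd.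
exists a, (gmul b d); split => //; last by rewrite gmulA.
- by exists b, d.
- by rewrite grng_mul.
Qed.

Lemma set_gmul1 A : set_gmul (@units G) A = A.
Proof.
apply/seteqP; split => [z [u [a [uu Aa ua ->]]]|z Az].
  by rewrite gmul_unitl.
by exists (grng z), z; rewrite gsrc_rng gmul_rng; split => //; exact: grng_unit.
Qed.
Lemma set_gmulr1 A : set_gmul A (@units G) = A.
Proof.
apply/seteqP; split => [z [a [u [Aa uu au ->]]]|z Az].
  by rewrite gmul_unitr.
by exists z, (gsrc z); rewrite grng_src gmul_src; split => //; exact: gsrc_unit.
Qed.

Lemma set_ginvK A : set_ginv (set_ginv A) = A.
Proof.
apply/seteqP; split => [_ [_ [a Aa <-] <-]|a Aa]; first by rewrite ginvK.
by exists (ginv a); [exists a|exact: ginvK].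
Qed.

Lemma set_ginv_mul A B :
  set_ginv (set_gmul A B) = set_gmul (set_ginv B) (set_ginv A).
Proof.
apply/seteqP; split.
  move=> _ [_ [a [b [Aa Bb ab ->]]] <-]; exists (ginv b), (ginv a).
  by split; [exists b|exists a|rewrite gsrc_inv grng_inv|exact: ginv_mul].
move=> _ [_ [_ [[b Bb <-] [a Aa <-] ba ->]]].
rewrite gsrc_inv grng_inv in ba.
by exists (gmul a b); [exists a, b|rewrite ginv_mul].
Qed.

Lemma gsrc_open_map : etale G -> forall V : set G, open V -> open (gsrc @` V).
Proof.
move=> [_ [_ lh]].
have units_open : open (@units G).
  rewrite openE => u uu; have [U [oU Uu injU _ _]] := lh u.
  have : nbhs u (U `&` gsrc @^-1` U).
    apply: filterI; first exact: open_nbhs_nbhs.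
    apply: (@gsrc_continuous G u); apply: open_nbhs_nbhs; split => //.
    by rewrite uu.
  apply: filterS => x [Ux Usx].
  by apply: injU; rewrite ?inE// gsrc_src.
move=> V oV; rewrite openE => _ [x Vx <-].
have [U [oU Ux _ _ opU]] := lh x.
have [W oW eW] := opU (V `&` U) (openI oV oU) (@subIsetr _ _ _).
have oWu : open (W `&` @units G) by exact: openI.
rewrite -eW in oWu.
have : nbhs (gsrc x) (gsrc @` (V `&` U)).
  by apply: open_nbhs_nbhs; split => //; exists x.
by apply: filterS => _ [y [Vy _] <-]; exists y.
Qed.

Lemma units_open : etale G -> open (@units G).
Proof.
move=> eG; have -> : @units G = gsrc @` [set: G].
  by apply/seteqP; split => [u uu|_ [x _ <-]]; [exists u|exact: gsrc_unit].
by apply: gsrc_open_map => //; exact: openT.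
Qed.

Lemma set_ginv_open A : open A -> open (set_ginv A).
Proof.
have -> : set_ginv A = ginv @^-1` A.
  apply/seteqP; split => [_ [a Aa <-]|a Aa] /=; first by rewrite ginvK.
  by exists (ginv a) => //; exact: ginvK.
by move=> oA; apply: open_comp => // x _; exact: ginv_continuous.
Qed.

Lemma set_gmul_open A B : etale G -> open A -> open B -> bisection B ->
  gsrc @` B = @units G -> open (set_gmul A B).
Proof.
move=> eG oA oB [_ injB] sB.
have /choice[b bP] (x : G) : exists b, B b /\ gsrc b = gsrc x.
  have : @units G (gsrc x) by exact: gsrc_unit.
  by rewrite -sB => -[b Bb eb]; exists b.
have b_cont : continuous b.
  move=> x V /=; rewrite nbhsE => -[W [oW Wbx] WV].
  have oS : open (gsrc @` (W `&` B)).
    by apply: gsrc_open_map => //; exact: openI.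
  have : nbhs x (gsrc @^-1` (gsrc @` (W `&` B))).
    apply: (@gsrc_continuous G x); apply: open_nbhs_nbhs; split => //.
    by case: (bP x) => Bb eb; exists (b x).
  apply: filterS => y [w [Ww Bw] ew] /=; apply: WV.
  have [By ey] := bP y.
  suff -> : b y = w by [].
  by apply: injB; rewrite ?inE// ey.
have -> : set_gmul A B = [set x | A (gmul x (ginv (b x)))].
  apply/seteqP; split => [_ [a [b' [Aa Bb' ab ->]]]|x Ax] /=.
    have -> : b (gmul a b') = b'.
      have [By ey] := bP (gmul a b').
      by apply: injB; rewrite ?inE// ey gsrc_mul.
    by rewrite gmulK.
  have [Bx ex] := bP x.
  exists (gmul x (ginv (b x))), (b x); split => //.
    by rewrite gsrc_mul ?gsrc_inv// grng_inv ex.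
  by rewrite gmulVK.
rewrite openE => x /= Ax.
have [Bx ex] := bP x.
have /subspace_continuousP/(_ (x, ginv (b x))) := @gmul_continuous G.
rewrite /= grng_inv ex => /(_ erefl).
move=> /(_ A); rewrite /= => /(_ (open_nbhs_nbhs (conj oA Ax))).
rewrite /within /= => nA.
have cb : (fun y => (y, ginv (b y))) @ x --> (x, ginv (b x)).
  apply: cvg_pair; first exact: cvg_id.
  apply: (@continuous_comp _ _ _ b ginv); first exact: b_cont.
  exact: ginv_continuous.
have : nbhs x (fun y => gsrc y = grng (ginv (b y)) ->
    A (gmul y (ginv (b y)))) by exact: (cb _ nA).
apply: filterS => y /= hy; apply: hy.
by rewrite grng_inv; case: (bP y).
Qed.

Lemma set_gmulV B : bisection B -> gsrc @` B = @units G ->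
  set_gmul (set_ginv B) B = @units G.
Proof.
move=> [injr _] sB; apply/seteqP; split => [_ [_ [b [[c Bc <-] Bb cb ->]]]|u uu].
  rewrite gsrc_inv in cb; have -> : c = b by apply: injr; rewrite ?inE.
  by rewrite gmul_invl; exact: gsrc_unit.
move: (uu); rewrite -sB => -[b Bb <-]; exists (ginv b), b.
by rewrite gsrc_inv gmul_invl; split => //; exists b.
Qed.

Lemma set_gmulrV B : bisection B -> grng @` B = @units G ->
  set_gmul B (set_ginv B) = @units G.
Proof.
move=> [_ injs] sB; apply/seteqP; split => [_ [b [_ [Bb [c Bc <-] bc ->]]]|u uu].
  rewrite grng_inv in bc; have -> : c = b by apply: injs; rewrite ?inE.
  by rewrite gmul_inv; exact: grng_unit.
move: (uu); rewrite -sB => -[b Bb <-]; exists b, (ginv b).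
by rewrite grng_inv gmul_inv; split => //; exists b.
Qed.

End GroupoidTheory.

Section FullGroup.
Variables (G : groupoid) (eG : etale G).

Record full_bisection := FullGroup {
  fg_set : set G;
  fg_open : open fg_set;
  fg_bisection : bisection fg_set;
  fg_rng : grng @` fg_set = @units G;
  fg_src : gsrc @` fg_set = @units G }.

Lemma fg_inj (A B : full_bisection) : fg_set A = fg_set B -> A = B.
Proof.
case: A B => [A oA bA rA sA] [B oB bB rB sB] /= eAB.
subst B.
by congr FullGroup; exact: Prop_irrelevance.
Qed.

(* The group operations need [G] to be etale. *)
Definition full_group of etale G : Type := full_bisection.

HB.instance Definition _ := gen_eqMixin (full_group eG).
HB.instance Definition _ := gen_choiceMixin (full_group eG).

Program Definition fg_one : full_bisection := @FullGroup (@units G) _ _ _ _.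
Next Obligation. exact: units_open. Qed.
Next Obligation.
split => u v; rewrite !inE => uu uv; first by rewrite !unit_rng.
by rewrite uu uv.
Qed.
Next Obligation.
apply/seteqP; split => [_ [x _ <-]|u uu]; first exact: grng_unit.
by exists u => //; exact: unit_rng.
Qed.
Next Obligation.
by apply/seteqP; split => [_ [x _ <-]|u uu]; [exact: gsrc_unit|exists u].
Qed.

Program Definition fg_mul (A B : full_bisection) : full_bisection :=
  @FullGroup (set_gmul (fg_set A) (fg_set B)) _ _ _ _.
Next Obligation.
move=> [A oA bA rA sA] [B oB bB rB sB] /=; exact: set_gmul_open.
Qed.
Next Obligation.
move=> [A oA [iAr iAs] rA sA] [B oB [iBr iBs] rB sB] /=; split => z z'.
  rewrite !inE => -[a [b [Aa Bb ab ->]]] [a' [b' [Aa' Bb' ab' ->]]].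
  rewrite !grng_mul// => /iAr; rewrite !inE => /(_ Aa Aa') ea.
  have /iBr : grng b = grng b' by rewrite -ab -ab' ea.
  by rewrite !inE => /(_ Bb Bb') ->; rewrite ea.
rewrite !inE => -[a [b [Aa Bb ab ->]]] [a' [b' [Aa' Bb' ab' ->]]].
rewrite !gsrc_mul// => /iBs; rewrite !inE => /(_ Bb Bb') eb.
have /iAs : gsrc a = gsrc a' by rewrite ab ab' eb.
by rewrite !inE => /(_ Aa Aa') ->; rewrite eb.
Qed.
Next Obligation.
move=> [A oA bA rA sA] [B oB bB rB sB] /=.
apply/seteqP; split => [_ [x _ <-]|u]; first exact: grng_unit.
rewrite -{1}rA => -[a Aa <-]; have : @units G (gsrc a) by exact: gsrc_unit.
rewrite -rB => -[b Bb ba]; exists (gmul a b); last by rewrite grng_mul.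
by exists a, b.
Qed.
Next Obligation.
move=> [A oA bA rA sA] [B oB bB rB sB] /=.
apply/seteqP; split => [_ [x _ <-]|u]; first exact: gsrc_unit.
rewrite -{1}sB => -[b Bb <-]; have : @units G (grng b) by exact: grng_unit.
rewrite -sA => -[a Aa ab]; exists (gmul a b); last by rewrite gsrc_mul.
by exists a, b.
Qed.

Program Definition fg_inv (A : full_bisection) : full_bisection :=
  @FullGroup (set_ginv (fg_set A)) _ _ _ _.
Next Obligation. by move=> [A oA bA rA sA] /=; exact: set_ginv_open. Qed.
Next Obligation.
move=> [A oA [ir is_] rA sA] /=; split => x y.
  rewrite !inE => -[a Aa <-] [b Ab <-]; rewrite !grng_inv => ab.
  by congr ginv; apply: is_; rewrite ?inE.
rewrite !inE => -[a Aa <-] [b Ab <-]; rewrite !gsrc_inv => ab.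
by congr ginv; apply: ir; rewrite ?inE.
Qed.
Next Obligation.
move=> [A oA bA rA sA] /=; apply/seteqP.
split => [_ [x _ <-]|u]; first exact: grng_unit.
rewrite -{1}sA => -[a Aa <-]; exists (ginv a); last exact: grng_inv.
by exists a.
Qed.
Next Obligation.
move=> [A oA bA rA sA] /=; apply/seteqP.
split => [_ [x _ <-]|u]; first exact: gsrc_unit.
rewrite -{1}rA => -[a Aa <-]; exists (ginv a); last exact: gsrc_inv.
by exists a.
Qed.

Fact fg_mulA : associative fg_mul.
Proof. by move=> A B D; apply: fg_inj; exact: set_gmulA. Qed.
Fact fg_mul1 : left_id fg_one fg_mul.
Proof. by move=> A; apply: fg_inj; exact: set_gmul1. Qed.
Fact fg_mulr1 : right_id fg_one fg_mul.
Proof. by move=> A; apply: fg_inj; exact: set_gmulr1. Qed.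
Fact fg_mulV : left_inverse fg_one fg_inv fg_mul.
Proof.
by move=> A; apply: fg_inj; apply: set_gmulV (fg_bisection A) (fg_src A).
Qed.
Fact fg_mulrV : right_inverse fg_one fg_inv fg_mul.
Proof.
by move=> A; apply: fg_inj; apply: set_gmulrV (fg_bisection A) (fg_rng A).
Qed.

HB.instance Definition _ := isGroup.Build (full_group eG)
  fg_mulA fg_mul1 fg_mulr1 fg_mulV fg_mulrV.

End FullGroup.

Section GroupoidAut.
Variable G : groupoid.

Definition groupoid_hom (phi : G -> G) : Prop :=
  forall x y, gsrc x = grng y ->
    gsrc (phi x) = grng (phi y) /\ phi (gmul x y) = gmul (phi x) (phi y).

Definition gaut_set : set (sym G) :=
  [set phi : sym G | [/\ groupoid_hom phi, continuous phi & continuous (sym_inv phi)]].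

Lemma ghom_src (phi : G -> G) x :
  groupoid_hom phi -> phi (gsrc x) = gsrc (phi x).
Proof.
move=> hphi; have [c e] := hphi x (gsrc x) (esym (grng_src x)).
rewrite gmul_src in e.
have cs : gsrc (gsrc x) = grng (gsrc x) by rewrite gsrc_src grng_src.
have [c' e'] := hphi _ _ cs.
have ee : gmul (gsrc x) (gsrc x) = gsrc x by rewrite -{2}(gsrc_src x) gmul_src.
rewrite ee in e'.
have h := gmulKl c'; rewrite -e' gmul_invl in h.
by rewrite -{1}h [in RHS]e gsrc_mul.
Qed.

Lemma ghom_rng (phi : G -> G) x :
  groupoid_hom phi -> phi (grng x) = grng (phi x).
Proof.
move=> hphi; have [c _] := hphi (grng x) x (gsrc_rng x).
by rewrite -c -(ghom_src _ hphi) gsrc_rng.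
Qed.

Fact gaut1 : gaut_set 1%g.
Proof. by split => //; move=> x. Qed.
Fact gautM f g : gaut_set f -> gaut_set g -> gaut_set (f * g)%g.
Proof.
move=> [hf cf cf'] [hg cg cg']; split.
- move=> x y xy; have [c1 e1] := hg x y xy; have [c2 e2] := hf _ _ c1.
  by split => //=; rewrite e1.
- by move=> x; apply: continuous_comp; [exact: cg|exact: cf].
- by move=> x; apply: continuous_comp; [exact: cf'|exact: cg'].
Qed.
Fact gautV f : gaut_set f -> gaut_set (f^-1)%g.
Proof.
move=> [hf cf cf']; split => // x y xy /=.
have fi : injective f by exact: can_inj (@symK _ f).
have c : gsrc (sym_inv f x) = grng (sym_inv f y).
  by apply: fi; rewrite ghom_src// ghom_rng// !symVK.
split => //; apply: fi; have [_ ->] := hf _ _ c.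
by rewrite !symVK.
Qed.

Definition gaut_subgroup := Subgroup gaut1 gautM gautV.
Definition gaut := subg gaut_subgroup.
HB.instance Definition _ := monoid.Group.on gaut.

Definition gaut_fun (phi : gaut) : G -> G := subg_val phi.

Definition implements (B : set G) (phi : gaut) : Prop :=
  forall x, set_gmul (set_gmul B [set x]) (set_ginv B) = [set gaut_fun phi x].

End GroupoidAut.

Section FullGroupNormal.
Variables (G : groupoid) (eG : etale G).
Implicit Types (A B : set G) (phi psi : gaut G).

(* The image of the full group under the identification of B with the
   automorphism x |-> B x B^-1, which is injective when [G] is effective. *)
Definition fg_gaut_set : set (gaut G) :=
  [set phi | exists B : full_group eG, implements (fg_set B) phi].

Fact fg_gaut1 : fg_gaut_set 1%g.
Proof.
exists 1%g => x; rewrite set_gmul1.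
have -> : set_ginv (fg_set (1%g : full_group eG)) = @units G.
  by have := congr1 (@fg_set _) (@invg1 (full_group eG)).
by rewrite set_gmulr1.
Qed.

Fact fg_gautM phi psi :
  fg_gaut_set phi -> fg_gaut_set psi -> fg_gaut_set (phi * psi)%g.
Proof.
move=> [A Aphi] [B Bpsi]; exists (A * B)%g => x.
have -> : fg_set (A * B : full_group eG)%g = set_gmul (fg_set A) (fg_set B).
  by [].
have := Aphi (gaut_fun psi x); rewrite -Bpsi set_ginv_mul !set_gmulA => ->.
by [].
Qed.

Fact fg_gautV phi : fg_gaut_set phi -> fg_gaut_set (phi^-1)%g.
Proof.
move=> [A Aphi]; exists (A^-1)%g => x /=.
rewrite set_ginvK; have := Aphi (gaut_fun (phi^-1)%g x).
have -> : gaut_fun phi (gaut_fun (phi^-1)%g x) = x by exact: symVK.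
move=> <-; rewrite !set_gmulA set_gmulV; last 2 first.
- exact: fg_bisection.
- exact: fg_src.
rewrite set_gmul1 -set_gmulA set_gmulV; last 2 first.
- exact: fg_bisection.
- exact: fg_src.
by rewrite set_gmulr1.
Qed.

Lemma gaut_inj phi : injective (gaut_fun phi).
Proof. exact: can_inj (@symK _ _). Qed.

Lemma gaut_src phi x : gsrc (gaut_fun phi x) = gaut_fun phi (gsrc x).
Proof. by have [h _ _] := subg_mem phi; rewrite /gaut_fun (ghom_src _ h). Qed.
Lemma gaut_rng phi x : grng (gaut_fun phi x) = gaut_fun phi (grng x).
Proof. by have [h _ _] := subg_mem phi; rewrite /gaut_fun (ghom_rng _ h). Qed.
Lemma gaut_mul phi x y : gsrc x = grng y ->
  gaut_fun phi (gmul x y) = gmul (gaut_fun phi x) (gaut_fun phi y).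
Proof. by have [h _ _] := subg_mem phi; move=> /h[]. Qed.
Lemma gaut_inv phi x : gaut_fun phi (ginv x) = ginv (gaut_fun phi x).
Proof.
have c : gsrc (gaut_fun phi x) = grng (gaut_fun phi (ginv x)).
  by rewrite gaut_src gaut_rng grng_inv.
rewrite -(gmulKl c) -gaut_mul ?grng_inv// gmul_inv -gaut_rng.
by rewrite gmul_unitr ?gsrc_inv ?grng_rng//; exact: grng_unit.
Qed.

Lemma gaut_set_mul phi A B : gaut_fun phi @` set_gmul A B =
  set_gmul (gaut_fun phi @` A) (gaut_fun phi @` B).
Proof.
apply/seteqP; split.
  move=> _ [_ [a [b [Aa Bb ab ->]]] <-].
  exists (gaut_fun phi a), (gaut_fun phi b); rewrite gaut_src gaut_rng ab.
  by split=> //; exact: gaut_mul.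
move=> _ [_ [_ [[a Aa <-] [b Bb <-] ab ->]]].
have ab' : gsrc a = grng b.
  by apply: (@gaut_inj phi); rewrite -gaut_src -gaut_rng.
by exists (gmul a b); [exists a, b|rewrite gaut_mul].
Qed.

Lemma gaut_set_inv phi A :
  gaut_fun phi @` set_ginv A = set_ginv (gaut_fun phi @` A).
Proof.
apply/seteqP; split => [_ [_ [a Aa <-] <-]|_ [_ [a Aa <-] <-]].
  by rewrite gaut_inv; exists (gaut_fun phi a) => //; exists a.
by rewrite -gaut_inv; exists (ginv a) => //; exists a.
Qed.

Lemma gaut_funK phi : cancel (gaut_fun (phi^-1)%g) (gaut_fun phi).
Proof. exact: symVK. Qed.
Lemma gaut_funVK phi : cancel (gaut_fun phi) (gaut_fun (phi^-1)%g).
Proof. exact: symK. Qed.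

Lemma gaut_units phi x : units (gaut_fun phi x) <-> units x.
Proof.
rewrite /units /= gaut_src.
by split => [/(@gaut_inj phi)|->].
Qed.

Program Definition gaut_fg phi (B : full_group eG) : full_group eG :=
  @FullGroup _ (gaut_fun phi @` fg_set B) _ _ _ _.
Next Obligation.
move=> phi [B oB bB rB sB] /=.
have -> : gaut_fun phi @` B = gaut_fun (phi^-1)%g @^-1` B.
  apply/seteqP; split => [_ [b Bb <-]|x Bx] /=; first by rewrite gaut_funVK.
  by exists (gaut_fun (phi^-1)%g x) => //; exact: gaut_funK.
by apply: open_comp => // x _; have [_ _ c] := subg_mem phi; exact: c.
Qed.
Next Obligation.
move=> phi [B oB [ir is_] rB sB] /=; split => x y.
  rewrite !inE => -[a Ba <-] [b Bb <-]; rewrite !gaut_rng => /gaut_inj ab.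
  by congr gaut_fun; apply: ir; rewrite ?inE.
rewrite !inE => -[a Ba <-] [b Bb <-]; rewrite !gaut_src => /gaut_inj ab.
by congr gaut_fun; apply: is_; rewrite ?inE.
Qed.
Next Obligation.
move=> phi [B oB bB rB sB] /=.
apply/seteqP; split => [_ [x _ <-]|u uu]; first exact: grng_unit.
have : @units G (gaut_fun (phi^-1)%g u) by apply/gaut_units.
rewrite -rB => -[b Bb eb]; exists (gaut_fun phi b); first by exists b.
by rewrite gaut_rng eb gaut_funK.
Qed.
Next Obligation.
move=> phi [B oB bB rB sB] /=.
apply/seteqP; split => [_ [x _ <-]|u uu]; first exact: gsrc_unit.
have : @units G (gaut_fun (phi^-1)%g u) by apply/gaut_units.
rewrite -sB => -[b Bb eb]; exists (gaut_fun phi b); first by exists b.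
by rewrite gaut_src eb gaut_funK.
Qed.

Fact fg_gautJ phi psi : fg_gaut_set phi -> fg_gaut_set (psi * phi * psi^-1)%g.
Proof.
move=> [B Bphi]; exists (gaut_fg psi B) => x /=.
rewrite -gaut_set_inv -{1}(gaut_funK psi x) -image_set1 -!gaut_set_mul.
by rewrite Bphi image_set1.
Qed.

Definition fg_subgroup := Subgroup fg_gaut1 fg_gautM fg_gautV.
Definition fg_normal := @NormalSubgroup _ fg_subgroup fg_gautJ.

End FullGroupNormal.

(* Not necessarily unital. *)
Record banachAlg (K : numFieldType) := BanachAlg {
  ba_car :> completeNormedModType K;
  ba_mul : ba_car -> ba_car -> ba_car;
  ba_mulA : associative ba_mul;
  ba_mul_linearl : forall c a b d,
    ba_mul (c *: a + b) d = c *: ba_mul a d + ba_mul b d;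
  ba_mul_linearr : forall c a b d,
    ba_mul d (c *: a + b) = c *: ba_mul d a + ba_mul d b;
  ba_norm_mul : forall a b, `|ba_mul a b| <= `|a| * `|b| }.

Record unital (K : numFieldType) (A : banachAlg K) := Unital {
  ba_one : A;
  ba_mul1 : left_id ba_one (@ba_mul K A);
  ba_mulr1 : right_id ba_one (@ba_mul K A);
  ba_norm1 : `|ba_one| = 1 }.

Section BanachAut.
Variables (K : numFieldType) (A : banachAlg K).
Local Notation "a ** b" := (@ba_mul K A a b) (at level 40, left associativity).

Definition baut_set : set (sym A) := [set alpha : sym A |
  [/\ forall c a b, alpha (c *: a + b) = c *: alpha a + alpha b,
      forall a b, alpha (a ** b) = alpha a ** alpha b
    & forall a, `|alpha a| = `|a| ] ].

Fact baut1 : baut_set 1%g. Proof. by []. Qed.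
Fact bautM f g : baut_set f -> baut_set g -> baut_set (f * g)%g.
Proof.
move=> [lf mf nf] [lg mg ng]; split => [c a b|a b|a] /=.
- by rewrite lg lf.
- by rewrite mg mf.
- by rewrite nf ng.
Qed.
Fact bautV f : baut_set f -> baut_set (f^-1)%g.
Proof.
move=> [lf mf nf]; have fi : injective f by exact: can_inj (@symK _ f).
split => [c a b|a b|a] /=.
- by apply: fi; rewrite lf !symVK.
- by apply: fi; rewrite mf !symVK.
- by rewrite -nf symVK.
Qed.

Definition baut_subgroup := Subgroup baut1 bautM bautV.
Definition baut := subg baut_subgroup.
HB.instance Definition _ := monoid.Group.on baut.

Definition baut_fun (alpha : baut) : A -> A := subg_val alpha.

Variable U : unital A.

Definition is_unitary_pair (u v : A) : Prop :=
  [/\ u ** v = ba_one U, v ** u = ba_one U, `|u| = 1 & `|v| = 1].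

Definition inn_set : set baut := [set alpha : baut |
  exists u v, is_unitary_pair u v /\
    forall a, baut_fun alpha a = u ** a ** v].

Fact inn1 : inn_set 1%g.
Proof.
exists (ba_one U), (ba_one U); split.
  by split; rewrite ?ba_mul1 ?ba_norm1.
by move=> a; rewrite ba_mul1 ba_mulr1.
Qed.

Lemma baut_one (alpha : baut) : baut_fun alpha (ba_one U) = ba_one U.
Proof.
case: alpha => alpha [la ma na]; rewrite /baut_fun /=.
by rewrite -[LHS](ba_mulr1 U) -{2}(symVK alpha (ba_one U)) -ma ba_mul1 symVK.
Qed.

Fact innM f g : inn_set f -> inn_set g -> inn_set (f * g)%g.
Proof.
move=> [u [v [[uv vu nu nv] fE]]] [w [x [[wx xw nw nx] gE]]].
have e1 : (u ** w) ** (x ** v) = ba_one U.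
  by rewrite -ba_mulA (ba_mulA w) wx ba_mul1.
have e2 : (x ** v) ** (u ** w) = ba_one U.
  by rewrite -ba_mulA (ba_mulA v) vu ba_mul1.
have le1 : `|u ** w| <= 1.
  by apply: le_trans (ba_norm_mul _ _) _; rewrite nu nw mulr1.
have le2 : `|x ** v| <= 1.
  by apply: le_trans (ba_norm_mul _ _) _; rewrite nv nx mulr1.
have ge0 : 1 <= `|u ** w| * `|x ** v|.
  by rewrite -(ba_norm1 U) -e1; exact: ba_norm_mul.
exists (u ** w), (x ** v); split.
  split => //; apply/eqP; rewrite eq_le ?le1 ?le2 /=.
    by apply: le_trans ge0 _; exact: ler_piMr.
  by apply: le_trans ge0 _; exact: ler_piMl.
move=> a; have -> : baut_fun (f * g)%g a = baut_fun f (baut_fun g a) by [].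
by rewrite fE gE !ba_mulA.
Qed.

Fact innV f : inn_set f -> inn_set (f^-1)%g.
Proof.
move=> [u [v [[uv vu nu nv] fE]]]; exists v, u; split; first by split.
move=> a; have fi : injective (baut_fun f) by exact: can_inj (@symK _ _).
apply: fi.
have -> : baut_fun f (baut_fun (f^-1)%g a) = a by exact: symVK.
by rewrite fE !ba_mulA uv ba_mul1 -ba_mulA uv ba_mulr1.
Qed.

Fact innJ (f g : baut) : inn_set f -> inn_set (g * f * g^-1)%g.
Proof.
move=> [u [v [[uv vu nu nv] fE]]].
have gM a b : baut_fun g (a ** b) = baut_fun g a ** baut_fun g b.
  by have [_ h _] := subg_mem g; exact: h.
have gN a : `|baut_fun g a| = `|a|.
  by have [_ _ h] := subg_mem g; exact: h.
exists (baut_fun g u), (baut_fun g v); split.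
  by split; rewrite -?gM ?uv ?vu ?baut_one ?gN ?nu ?nv.
move=> a.
have -> : baut_fun (g * f * g^-1)%g a =
  baut_fun g (baut_fun f (baut_fun (g^-1)%g a)) by [].
have gV : baut_fun g (baut_fun (g^-1)%g a) = a by exact: symVK.
by rewrite fE !gM gV.
Qed.

Definition inn_subgroup := Subgroup inn1 innM innV.
Definition inn_normal := @NormalSubgroup _ inn_subgroup innJ.

End BanachAut.

(* Typed as a numClosedFieldType so that it carries its normed topology. *)
Definition Cplx (R : realType) : numClosedFieldType := R[i].

Definition modulus (R : realType) (z : Cplx R) : R := complex.Re `|z|.

Section Cocycles.
Variables (R : realType) (G : groupoid).
Local Notation C := (Cplx R).

Definition is_cocycle (xi : G -> C) : Prop :=
  [/\ continuous xi, forall x, `|xi x| = 1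
    & forall x y, gsrc x = grng y -> xi (gmul x y) = xi x * xi y].

Record cocycle := Cocycle { coc :> G -> C; cocP : is_cocycle coc }.

Lemma coc_inj (f g : cocycle) : (forall x, f x = g x) -> f = g.
Proof.
case: f g => [f fP] [g gP] /= /funext efg; subst g.
by congr Cocycle; exact: Prop_irrelevance.
Qed.

HB.instance Definition _ := gen_eqMixin cocycle.
HB.instance Definition _ := gen_choiceMixin cocycle.

Lemma coc_neq0 (f : cocycle) x : f x != 0.
Proof. by case: f => f [_ h _] /=; rewrite -normr_eq0 h oner_neq0. Qed.

Program Definition coc_one : cocycle := @Cocycle (fun=> 1) _.
Next Obligation.
by split => [x|x|x y _]; rewrite ?normr1 ?mulr1//; exact: cst_continuous.
Qed.
Program Definition coc_mul (f g : cocycle) : cocycle :=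
  @Cocycle (fun x => f x * g x) _.
Next Obligation.
move=> [f [cf nf mf]] [g [cg ng mg]]; split => [x|x|x y xy] /=.
- by apply: continuousM; [exact: cf|exact: cg].
- by rewrite normrM nf ng mulr1.
- by rewrite mf// mg// mulrACA.
Qed.
Program Definition coc_inv (f : cocycle) : cocycle :=
  @Cocycle (fun x => (f x)^-1) _.
Next Obligation.
move=> f; have f0 := @coc_neq0 f.
case: f f0 => [f [cf nf mf]] /= f0; split => [x|x|x y xy] /=.
- by apply: continuousV; [exact: f0|exact: cf].
- by rewrite normfV nf invr1.
- by rewrite mf// invfM.
Qed.

Fact coc_mulA : associative coc_mul.
Proof. by move=> f g h; apply: coc_inj => x /=; rewrite mulrA. Qed.
Fact coc_mul1 : left_id coc_one coc_mul.
Proof. by move=> f; apply: coc_inj => x /=; rewrite mul1r. Qed.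
Fact coc_mulr1 : right_id coc_one coc_mul.
Proof. by move=> f; apply: coc_inj => x /=; rewrite mulr1. Qed.
Fact coc_mulV : left_inverse coc_one coc_inv coc_mul.
Proof. by move=> f; apply: coc_inj => x /=; rewrite mulVf ?coc_neq0. Qed.
Fact coc_mulrV : right_inverse coc_one coc_inv coc_mul.
Proof. by move=> f; apply: coc_inj => x /=; rewrite mulfV ?coc_neq0. Qed.

HB.instance Definition _ := isGroup.Build cocycle
  coc_mulA coc_mul1 coc_mulr1 coc_mulV coc_mulrV.

(* Only the restriction of [f] to the units is relevant. *)
Definition cob_set : set cocycle := [set xi : cocycle | exists f : G -> C,
  [/\ {within @units G, continuous f}, forall u, units u -> `|f u| = 1
    & forall x, xi x = (f (grng x))^* * f (gsrc x)] ].

Fact cob1 : cob_set 1%g.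
Proof.
exists (fun=> 1); split => [x|u _|x]; rewrite ?normr1 ?rmorph1 ?mulr1//.
exact: cst_continuous.
Qed.
Fact cobM f g : cob_set f -> cob_set g -> cob_set (f * g)%g.
Proof.
move=> [a [ca na fE]] [b [cb nb gE]]; exists (fun x => a x * b x); split.
- by move=> x; apply: continuousM; [exact: ca|exact: cb].
- by move=> u uu; rewrite normrM na// nb// mulr1.
- have h x : (f * g)%g x = f x * g x by [].
  by move=> x; rewrite h fE gE rmorphM mulrACA.
Qed.
Fact cobV f : cob_set f -> cob_set (f^-1)%g.
Proof.
move=> [a [ca na fE]].
have a0 u : @units G u -> a u != 0.
  by move=> uu; rewrite -normr_eq0 na ?oner_neq0.
have aV u : @units G u -> (a u)^-1 = (a u)^*.
  by move=> uu; rewrite invC_norm na// expr1n invr1 mul1r.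
exists (fun x => (a x)^*); split.
- apply/subspace_continuousP => u uu; rewrite /from_subspace /=.
  have caV : a x @[x --> within (@units G) (nbhs u)] --> a u.
    by move/subspace_continuousP : ca; exact.
  rewrite -(aV u uu).
  have : (a x)^-1 @[x --> within (@units G) (nbhs u)] --> (a u)^-1.
    by apply: cvgV => //; exact: a0.
  apply: cvg_trans; apply: near_eq_cvg.
  by apply: (@filterE _ (nbhs u)) => y uy; rewrite aV.
- by move=> u uu; rewrite norm_conjC na.
- have h x : (f^-1)%g x = (f x)^-1 by [].
  move=> x; rewrite h fE invfM conjCK -(aV _ (grng_unit x)) invrK.
  by rewrite -(aV _ (gsrc_unit x)).
Qed.
Fact cobJ (f g : cocycle) : cob_set f -> cob_set (g * f * g^-1)%g.
Proof.
suff -> : (g * f * g^-1)%g = f by [].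
apply: coc_inj => x.
have -> : (g * f * g^-1)%g x = g x * f x * (g x)^-1 by [].
by rewrite mulrAC mulfV ?mul1r// coc_neq0.
Qed.

Definition cob_subgroup := Subgroup cob1 cobM cobV.
Definition cob_normal := @NormalSubgroup _ cob_subgroup cobJ.

End Cocycles.

Section GroupoidAlgebras.
Variables (R : realType) (G : groupoid).
Local Notation C := (Cplx R).
Implicit Types f g : G -> C.

Definition supp f : set G := [set x | f x != 0].

Definition is_Cc f : Prop := continuous f /\ compact (closure (supp f)).

Definition is_C0 f : Prop := continuous f /\
  forall e : R, 0 < e -> exists K : set G,
    compact K /\ forall x, ~ K x -> modulus (f x) < e.

(* For [f] and [g] in C_c(G) the sum has finitely many nonzero terms. *)
Definition conv f g (x : G) : C :=
  \sum_(q \in [set q : G * G | gsrc q.1 = grng q.2 /\ gmul q.1 q.2 = x])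
    f q.1 * g q.2.

Definition star f (x : G) : C := (f (ginv x))^*.

(* Supremum in [0, +oo], so that the supremum of the empty set is 0. *)
Definition sup0 (S : set (\bar R)) : \bar R := ereal_sup (0%E |` S).

Definition Inorm f : \bar R :=
  maxe (sup0 [set \esum_(x in src_fiber u) (modulus (f x))%:E | u in @units G])
       (sup0 [set \esum_(x in rng_fiber u) (modulus (f x))%:E | u in @units G]).

Definition lpnorm (p : R) (D : set G) (xi : G -> C) : \bar R :=
  ((\esum_(x in D) (modulus (xi x) `^ p)%:E) `^ p^-1)%E.

(* For [x] in [src_fiber u]; finitely many nonzero terms if [f] is in C_c(G). *)
Definition lreg (u : G) f (xi : G -> C) (x : G) : C :=
  \sum_(y \in src_fiber u) f (gmul x (ginv y)) * xi y.

Definition lreg_opnorm (p : R) (u : G) f : \bar R :=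
  ereal_sup [set lpnorm p (src_fiber u) (lreg u f xi) |
    xi in [set xi | (lpnorm p (src_fiber u) xi <= 1)%E]].

Definition Fpnorm (p : R) f : \bar R :=
  sup0 [set lreg_opnorm p u f | u in @units G].

End GroupoidAlgebras.

Inductive algebra_kind (R : realType) :=
  | alg_LI
  | alg_Fp of R
  | alg_Fpstar of R.

Definition admissible (R : realType) (k : algebra_kind R) : Prop :=
  match k with
  | alg_LI => True
  | alg_Fp p | alg_Fpstar p => 1 <= p /\ p != 2
  end.

Definition kind_norm (R : realType) (G : groupoid) (k : algebra_kind R)
    (f : G -> Cplx R) : \bar R :=
  match k with
  | alg_LI => Inorm f
  | alg_Fp p => Fpnorm p f
  | alg_Fpstar p => maxe (Fpnorm p f) (Fpnorm p (star f))
  end.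

Section Completion.
Variables (R : realType) (G : groupoid) (A : banachAlg (Cplx R)).
Local Notation C := (Cplx R).

(* Completions are characterised up to isometric isomorphism; the values of
   [iota] outside C_c(G) are irrelevant. *)
Record is_completion (k : algebra_kind R) (iota : (G -> C) -> A) : Prop := {
  cmp_linear : forall c f g, is_Cc f -> is_Cc g ->
    iota (fun x => c * f x + g x) = c *: iota f + iota g;
  cmp_conv : forall f g, is_Cc f -> is_Cc g ->
    iota (conv f g) = ba_mul (iota f) (iota g);
  cmp_norm : forall f, is_Cc f -> (complex.Re `|iota f|)%:E = kind_norm k f;
  cmp_dense : closure (iota @` [set f | is_Cc f]) = setT }.

Variable iota : (G -> C) -> A.

(* At most one [j] satisfies this, since C_c(G) is dense in [A]. *)
Record is_C0_inclusion (j : A -> G -> C) : Prop := {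
  C0i_linear : forall c a b x, j (c *: a + b) x = c * j a x + j b x;
  C0i_C0 : forall a, is_C0 (j a);
  C0i_contractive : forall a x, `|j a x| <= `|a|;
  C0i_injective : injective j;
  C0i_extends : forall f, is_Cc f -> j (iota f) = f }.

Definition is_Gamma (Gam : cocycle R G -> baut A) : Prop :=
  forall (xi : cocycle R G) f, is_Cc f ->
    baut_fun (Gam xi) (iota f) = iota (fun x => xi x * f x).

Variable j : A -> G -> C.

Definition is_unit_homeo (ups ups' : G -> G) : Prop :=
  [/\ forall u, units u -> units (ups u) /\ ups' (ups u) = u,
      forall u, units u -> units (ups' u) /\ ups (ups' u) = u,
      {within @units G, continuous ups}
    & {within @units G, continuous ups'}].

(* The elements [a] with [supp (j a) `<=` units] form C_0(G^(0)). *)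
Definition is_Upsilon (alpha : baut A) (ups : G -> G) : Prop :=
  exists ups' : G -> G, is_unit_homeo ups ups' /\
    forall a, supp (j a) `<=` @units G ->
      supp (j (baut_fun alpha a)) `<=` @units G /\
      forall u, units u -> j (baut_fun alpha a) u = j a (ups' u).

(* Meaningful for compact open bisections, where [\1_B] is in C_c(G). *)
Definition Phi (alpha : baut A) (B : set G) : set G :=
  supp (j (baut_fun alpha (iota \1_B))).

(* For each [x] in [B]: [Om alpha x] is the only element of [Phi alpha B] whose
   source is [ups (gsrc x)]. *)
Definition is_Omega (Om : baut A -> gaut G) : Prop :=
  forall alpha, exists ups, is_Upsilon alpha ups /\
    forall x B, cobisection B -> B x ->
      forall y, (Phi alpha B y /\ gsrc y = ups (gsrc x)) <->
                y = gaut_fun (Om alpha) x.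

End Completion.

(* Main.v *)
(* Every algebra in question sits isometrically inside the functions on G, and
   its norm dominates the operator norm of the left regular representations on
   l^p(G_u) for some p <> 2 (p = 1 for L^I).  For p <> 2 the equality case of
   Clarkson's inequality makes every isometry of l^p preserve disjointness of
   supports (Lamperti).

   An automorphism alpha maps 1_K, for K a compact open set of units, to an
   idempotent e such that all 1 + (z - 1) e with |z| = 1 act isometrically;
   disjointness then forces e to be supported on units, so alpha permutes the
   compact open sets of units and, by Stone duality, preserves C_0 of the units.
   For a compact open bisection B, alpha(1_B) is a partial isometry between two
   such idempotents, and the same principle shows that its matrix has a single
   entry, of modulus 1, in each row and column: alpha(1_B) is T-valued on a
   compact open bisection.  The resulting order automorphism of the compact open
   bisections comes, again by Stone duality, from an automorphism of G, which
   is Omega(alpha).  If it is trivial, the values of the alpha(1_B) glue to a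
   cocycle xi with alpha(f) = xi f.  A unitary of the algebra is likewise T-valued
   on a full bisection, so inner automorphisms induce elements of the full group,
   and those inducing the identity are implemented by unitaries on the units. *)
Require Import Defs.
From HB Require Import structures.
From mathcomp Require Import all_boot all_order all_algebra.
From mathcomp Require Import all_classical all_reals all_analysis.
From mathcomp Require Import complex ring lra.

Set Implicit Arguments.
Unset Strict Implicit.
Unset Printing Implicit Defensive.

Import Order.TTheory GRing.Theory Num.Theory.
Import numFieldNormedType.Exports.

Local Open Scope classical_set_scope.
Local Open Scope ring_scope.

Local Notation conv := Defs.conv.
Local Notation sup0 := Defs.sup0.

(** The elements of [A] are abstract limits, and the point masses of l^p(G_u) do not belong to [A].
    The first gap is bridged by rewriting every norm bound as a family of inequalities between
    finite sums ([kind_bound]). Such bounds survive pointwise limits, which is why an element of [A]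
    is determined by its function. For the second, the indicator of a compact open bisection through
    x restricts to the point mass at x on the fibre over s(x), and [fsum] measures an element of [A]
    along one fibre. Left multiplication by a contraction does not increase [fsum], so mutually
    inverse contractions preserve it, and the equality case of Clarkson's inequality can be used
    inside [A].

    At p = 2 Clarkson's inequality is the parallelogram law, an equality for all vectors, which says
    nothing about supports.

    The splitting is f |-> f o phi^-1. Conjugation by 1_B is this same automorphism when phi is
    implemented by B, so one section serves all three sequences. *)

(** * Homomorphisms induced on subgroups and quotients *)

Section Morphisms.

Definition multiplicative_of (H K : groupType) (f : H -> K)
  (fM : forall x y, f (x * y)%g = (f x * f y)%g) : {multiplicative H -> K} :=
  HB.pack f (isMultiplicative.Build H K f fM).

Lemma quot_morph (H K : groupType) (N : normal_subgroup H) (M : normal_subgroup K)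
  (f : {multiplicative H -> K}) : (forall x, sg_set N x -> sg_set M (f x)) ->
  exists F : {multiplicative quot N -> quot M}, forall x, F (qpi N x) = qpi M (f x).
Proof.
move=> fNM; pose F (q : quot N) := qpi M (f (qrepr q)).
have FE x : F (qpi N x) = qpi M (f x).
  have f1 : f 1%g = 1%g by apply: (mulIg (f 1%g)); rewrite -gmulfM !mul1g.
  have fV y : f (y^-1)%g = ((f y)^-1)%g.
    by apply: (mulIg (f y)); rewrite -gmulfM !mulVg.
  by apply/qpiP; rewrite -fV -gmulfM; apply: fNM; apply/qpiP; exact: qreprK.
have FM p q : F (p * q)%g = (F p * F q)%g.
  rewrite -(qreprK p) -(qreprK q).
  rewrite -[(qpi N _ * qpi N _)%g]/(quot_mul _ _) quot_mulE !FE gmulfM.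
  by rewrite -[RHS]/(quot_mul _ _) quot_mulE.
by exists (multiplicative_of FM).
Qed.

Lemma subg_morph (H K : groupType) (S : subgroup H) (T : subgroup K)
  (f : {multiplicative H -> K}) : (forall x, sg_set S x -> sg_set T (f x)) ->
  exists F : {multiplicative subg S -> subg T}, forall x, subg_val (F x) = f (subg_val x).
Proof.
move=> fST; pose F (x : subg S) := Subg (fST _ (subg_mem x)).
have FM x y : F (x * y)%g = (F x * F y)%g by apply: subg_inj; exact: gmulfM.
by exists (multiplicative_of FM).
Qed.

End Morphisms.

(** * Complex moduli and Clarkson's inequality *)

Section Modulus.
Variable R : realType.
Local Notation C := (Cplx R).
Local Notation md := (@modulus R).
Local Notation rC := (real_complex R : R -> C).

Lemma Re_eq (x : C) : 0 <= x -> x = rC (complex.Re x).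
Proof. by case: x => a b; rewrite lecE /= => /andP[/eqP -> _]. Qed.

Lemma Re_le (x y : C) : x <= y -> complex.Re x <= complex.Re y.
Proof. by rewrite lecE => /andP[]. Qed.

Lemma ReD (x y : C) : complex.Re (x + y) = complex.Re x + complex.Re y.
Proof. by case: x y => [a b] [c d]. Qed.

Lemma ReM_ge0 (x y : C) :
  0 <= x -> 0 <= y -> complex.Re (x * y) = complex.Re x * complex.Re y.
Proof.
by move=> /Re_eq -> /Re_eq ->; rewrite -rmorphM.
Qed.

Lemma rC_le (x y : R) : (rC x <= rC y) = (x <= y).
Proof. exact: lecR. Qed.

Lemma modE (z : C) : `|z| = rC (md z).
Proof. by apply: Re_eq; exact: normr_ge0. Qed.

Lemma mod_ge0 z : 0 <= md z.
Proof. by have := Re_le (normr_ge0 z). Qed.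
Hint Resolve mod_ge0 : core.

Lemma mod0 : md 0 = 0. Proof. by rewrite /md normr0. Qed.
Lemma mod1 : md 1 = 1. Proof. by rewrite /md normr1. Qed.
Lemma modN z : md (- z) = md z. Proof. by rewrite /md normrN. Qed.
Lemma modB x y : md (x - y) = md (y - x). Proof. by rewrite /md distrC. Qed.
Lemma mod_conj z : md z^* = md z. Proof. by rewrite /md norm_conjC. Qed.
Lemma modM x y : md (x * y) = md x * md y.
Proof. by rewrite /md normrM ReM_ge0. Qed.
Lemma modD x y : md (x + y) <= md x + md y.
Proof. by rewrite /md -ReD; apply: Re_le; exact: ler_normD. Qed.

Lemma mod_eq0 z : (md z == 0) = (z == 0).
Proof.
by rewrite -[RHS]normr_eq0 modE -(rmorph0 rC) (inj_eq (fmorph_inj rC)).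
Qed.

Lemma mod_gt0 z : (0 < md z) = (z != 0).
Proof. by rewrite lt0r mod_eq0 mod_ge0 andbT. Qed.

Lemma norm_mod1 z : (`|z| = 1) <-> (md z = 1).
Proof.
split=> [h|h]; first by rewrite /modulus h.
by rewrite modE h rmorph1.
Qed.

Lemma mod_rC (r : R) : 0 <= r -> md (rC r) = r.
Proof.
by move=> r0; rewrite /modulus ger0_norm// -(rmorph0 rC) rC_le.
Qed.

Lemma mod_sum (I : Type) (s : seq I) (F : I -> C) :
  md (\sum_(i <- s) F i) <= \sum_(i <- s) md (F i).
Proof.
elim: s => [|i s ih]; first by rewrite !big_nil mod0.
by rewrite !big_cons (le_trans (modD _ _))// lerD2l.
Qed.

Lemma mod_sqr z : md z ^+ 2 = complex.Re z ^+ 2 + complex.Im z ^+ 2.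
Proof.
by rewrite /modulus normc_def /= sqr_sqrtr// addr_ge0// sqr_ge0.
Qed.

Lemma mod_parallelogram x y :
  md (x + y) ^+ 2 + md (x - y) ^+ 2 = 2 * (md x ^+ 2 + md y ^+ 2).
Proof.
rewrite !mod_sqr; case: x y => [a b] [c d] /=; ring.
Qed.

Lemma Re_mod z : `|complex.Re z| <= md z.
Proof.
rewrite -(ler_pXn2r (ltn0Sn 1)) ?nnegrE// mod_sqr real_normK ?num_real//.
by rewrite lerDl sqr_ge0.
Qed.
Lemma Im_mod z : `|complex.Im z| <= md z.
Proof.
rewrite -(ler_pXn2r (ltn0Sn 1)) ?nnegrE// mod_sqr real_normK ?num_real//.
by rewrite lerDr sqr_ge0.
Qed.
Lemma mod_Re_Im z : md z <= `|complex.Re z| + `|complex.Im z|.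
Proof.
rewrite -(ler_pXn2r (ltn0Sn 1)) ?nnegrE ?addr_ge0// mod_sqr.
rewrite sqrrD !real_normK ?num_real// addrAC lerDl mulrn_wge0//.
Qed.

Lemma powR_convex p (t s x : R) : 1 <= p -> 0 < t -> t < 1 -> 0 <= s -> 0 <= x ->
  (t * s + (1 - t) * x) `^ p <= t * s `^ p + (1 - t) * x `^ p.
Proof.
move=> p1 t0 t1 s0 x0.
have := convex_powR p1 (Itv01 (ltW t0) (ltW t1)) (x := s) (y := x).
by rewrite !inE /= !in_itv /= !andbT s0 x0 => /(_ erefl erefl).
Qed.

Lemma powR_midpoint q (s t : R) : 1 <= q -> 0 <= s -> 0 <= t ->
  2 * ((s + t) / 2) `^ q <= s `^ q + t `^ q.
Proof.
move=> q1 s0 t0.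
have h : (0 : R) < 2^-1 by lra.
have h' : (2^-1 : R) < 1 by lra.
have := powR_convex q1 h h' s0 t0.
have -> : 1 - 2^-1 = 2^-1 :> R by lra.
have -> : 2^-1 * s + 2^-1 * t = (s + t) / 2 by lra.
lra.
Qed.

(** For a, b > 0 write t^q = t t^(q-1): both a^(q-1) and b^(q-1) are smaller than (a + b)^(q-1). The
    strictness is what later detects disjoint supports. *)
Lemma powR_superadd q (a b : R) : 1 < q -> 0 <= a -> 0 <= b ->
  a `^ q + b `^ q <= (a + b) `^ q ?= iff (a * b == 0).
Proof.
move=> q1 a0 b0; have q0 : 0 < q by lra.
have q0' : q != 0 by lra.
have [->|an0] := eqVneq a 0.
  by rewrite mul0r eqxx powR0// !add0r; split; rewrite ?lexx ?eqxx.
have [->|bn0] := eqVneq b 0.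
  by rewrite mulr0 eqxx powR0// !addr0; split; rewrite ?lexx ?eqxx.
have ap : 0 < a by rewrite lt0r an0.
have bp : 0 < b by rewrite lt0r bn0.
suff lt : a `^ q + b `^ q < (a + b) `^ q.
  by split; rewrite ?(ltW lt)// lt_eqF// mulf_eq0 (negbTE an0) (negbTE bn0).
rewrite -(mulr_powRB1 a0 q0) -(mulr_powRB1 b0 q0).
rewrite -(mulr_powRB1 (addr_ge0 a0 b0) q0) mulrDl.
apply: ltrD; rewrite ltr_pM2l//; apply: gt0_ltr_powR; rewrite ?nnegrE; lra.
Qed.

(** Midpoint convexity bounds s^q + t^q below by 2 (a + b)^q, and superadditivity does the rest, so
    equality overall forces its equality case. Meant for the squared moduli of x + y, x - y, x, y,
    where the hypothesis is the parallelogram law. *)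
Lemma powR_sum_ge q (s t a b : R) : 1 < q -> 0 <= s -> 0 <= t -> 0 <= a -> 0 <= b ->
  s + t = 2 * (a + b) ->
  2 * (a `^ q + b `^ q) <= s `^ q + t `^ q /\
  (2 * (a `^ q + b `^ q) = s `^ q + t `^ q -> a * b = 0).
Proof.
move=> q1 s0 t0 a0 b0 st.
have := powR_midpoint (ltW q1) s0 t0.
have -> : (s + t) / 2 = a + b by lra.
have [le eq] := powR_superadd q1 a0 b0.
move=> h; split; first by lra.
by move=> e; apply/eqP; rewrite -eq; apply/eqP; lra.
Qed.

(** The same two inequalities read backwards: now s, t, a, b are p-th powers of moduli and q = 2/p,
    so that the parallelogram law is the hypothesis on q-th powers. *)
Lemma powR_sum_le q (s t a b : R) : 1 < q -> 0 <= s -> 0 <= t -> 0 <= a -> 0 <= b ->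
  s `^ q + t `^ q = 2 * (a `^ q + b `^ q) ->
  s + t <= 2 * (a + b) /\ (s + t = 2 * (a + b) -> a * b = 0).
Proof.
move=> q1 s0 t0 a0 b0 st.
have := powR_midpoint (ltW q1) s0 t0.
have [le eq] := powR_superadd q1 a0 b0.
move=> h; have h2 : ((s + t) / 2) `^ q <= (a + b) `^ q by lra.
have q0 : 0 < q by lra.
split.
  rewrite leNgt; apply/negP => lt.
  have : (a + b) `^ q < ((s + t) / 2) `^ q.
    by apply: gt0_ltr_powR; rewrite ?nnegrE; lra.
  by rewrite ltNge h2.
move=> e; apply/eqP; rewrite -eq; apply/eqP.
have e2 : (s + t) / 2 = a + b by lra.
rewrite e2 in h; lra.
Qed.

Lemma powR_half p (x : R) : 0 <= x -> x `^ p = (x ^+ 2) `^ (p / 2).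
Proof.
by move=> x0; rewrite -powR_mulrn// -powRrM mulrC mulfVK// pnatr_eq0.
Qed.

(** This is the parallelogram law raised to the power p/2 > 1. For p < 2 the inequality reverses,
    hence a second version; in both, equality forces one of x, y to vanish. *)
Lemma mod_clarkson p (x y : C) : 2 < p ->
  2 * (md x `^ p + md y `^ p) <= md (x + y) `^ p + md (x - y) `^ p /\
  (2 * (md x `^ p + md y `^ p) = md (x + y) `^ p + md (x - y) `^ p -> x * y = 0).
Proof.
move=> p2; have q1 : 1 < p / 2 by lra.
have [le eq] := powR_sum_ge q1 (sqr_ge0 _) (sqr_ge0 _) (sqr_ge0 _) (sqr_ge0 _)
  (mod_parallelogram x y).
rewrite !(@powR_half p)//; split => // /eq /eqP.
by rewrite mulf_eq0 !sqrf_eq0 !mod_eq0 -mulf_eq0 => /eqP.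
Qed.

Lemma mod_clarkson_lt p (x y : C) : 0 < p -> p < 2 ->
  md (x + y) `^ p + md (x - y) `^ p <= 2 * (md x `^ p + md y `^ p) /\
  (md (x + y) `^ p + md (x - y) `^ p = 2 * (md x `^ p + md y `^ p) -> x * y = 0).
Proof.
move=> p0 p2; have q1 : 1 < 2 / p by rewrite ltr_pdivlMr// mul1r.
have E z : md z ^+ 2 = (md z `^ p) `^ (2 / p).
  by rewrite -powRrM mulrC divfK ?gt_eqF// powR_mulrn.
have := mod_parallelogram x y; rewrite !E => st.
have [le eq] := powR_sum_le q1 (powR_ge0 _ _) (powR_ge0 _ _) (powR_ge0 _ _)
  (powR_ge0 _ _) st.
split=> // /eq /eqP; rewrite mulf_eq0 !powR_eq0 (gt_eqF p0) !andbT.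
by rewrite !mod_eq0 -mulf_eq0 => /eqP.
Qed.

End Modulus.
#[global] Hint Extern 0 (is_true (@Order.le _ _ _ (modulus _))) => exact: mod_ge0 : core.

(** * Compact open bisections and functions with compact support *)

Section Topology.
Variables (R : realType) (G : groupoid).
Hypotheses (hG : hausdorff_space G) (aG : ample G).
Local Notation C := (Cplx R).
Local Notation md := (@modulus R).
Implicit Types (f g : G -> C) (B K : set G).

Lemma cplx_continuousD (T : topologicalType) (f g : T -> C) x :
  {for x, continuous f} -> {for x, continuous g} ->
  {for x, continuous (fun y => f y + g y)}.
Proof. by move=> cf cg; exact: (@cvgD C C^o _ _ _ _ _ _ _ cf cg). Qed.

Lemma cplx_continuousB (T : topologicalType) (f g : T -> C) x :
  {for x, continuous f} -> {for x, continuous g} ->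
  {for x, continuous (fun y => f y - g y)}.
Proof. by move=> cf cg; exact: (@cvgB C C^o _ _ _ _ _ _ _ cf cg). Qed.

Lemma cobis_compact B : cobisection B -> compact B. Proof. by case. Qed.
Lemma cobis_open B : cobisection B -> open B. Proof. by case. Qed.
Lemma cobis_closed B : cobisection B -> closed B.
Proof. by case=> cB _ _; exact: compact_closed. Qed.
Lemma cobis_injr B x y : cobisection B -> B x -> B y -> grng x = grng y -> x = y.
Proof. by case=> _ _ [h _] Bx By; apply: h; rewrite ?inE. Qed.
Lemma cobis_injs B x y : cobisection B -> B x -> B y -> gsrc x = gsrc y -> x = y.
Proof. by case=> _ _ [_ h] Bx By; apply: h; rewrite ?inE. Qed.

Lemma cobis_sub B B' : cobisection B -> compact B' -> open B' -> B' `<=` B ->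
  cobisection B'.
Proof.
move=> [cB oB [ir is_]] cB' oB' sB; split=> //; split => x y; rewrite !inE => hx hy.
  by apply: ir; rewrite inE; exact: sB.
by apply: is_; rewrite inE; exact: sB.
Qed.

Lemma cobis_ex x U : open U -> U x -> exists B, [/\ cobisection B, B x & B `<=` U].
Proof. by case: aG => _; exact. Qed.

Lemma cobis_exT x : exists B, cobisection B /\ B x.
Proof. by have [B [? ? _]] := cobis_ex (@openT G) (I : setT x); exists B. Qed.

Lemma cobisI B B' : cobisection B -> cobisection B' -> cobisection (B `&` B').
Proof.
move=> hB hB'; apply: (cobis_sub hB) => //.
- by apply: compact_closedI; [case: hB|exact: cobis_closed].
- by apply: openI; [case: hB|case: hB'].
Qed.

Lemma cobis_preim B (h : G -> G) K : cobisection B -> cobisection K ->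
  continuous h -> cobisection (B `&` h @^-1` K).
Proof.
move=> hB hK ch; apply: (cobis_sub hB) => //.
- apply: compact_closedI; first by case: hB.
  by apply: closed_comp => [x _|]; [exact: ch|exact: cobis_closed].
- apply: openI; first by case: hB.
  by apply: open_comp => [x _|]; [exact: ch|case: hK].
Qed.

Lemma grng_open_map V : open V -> open (grng @` V : set G).
Proof.
move=> oV; have -> : grng @` V = gsrc @` set_ginv V.
  apply/seteqP; split => [_ [x Vx <-]|_ [_ [x Vx <-] <-]].
    by exists (ginv x); [exists x|rewrite gsrc_inv].
  by exists x => //; rewrite gsrc_inv.
by apply: (gsrc_open_map (proj1 aG)); exact: set_ginv_open.
Qed.

Lemma cobis_units K : compact K -> open K -> K `<=` @units G -> cobisection K.
Proof.
move=> cK oK sK; split => //; split => x y; rewrite !inE => /sK ux /sK uy.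
  by rewrite !unit_rng.
by rewrite ux uy.
Qed.

Lemma cobis_rng B : cobisection B -> cobisection (grng @` B).
Proof.
move=> hB; apply: cobis_units => [||_ [x _ <-]]; last exact: grng_unit.
- apply: continuous_compact; last by case: hB.
  by apply: continuous_subspaceT; exact: grng_continuous.
- by apply: grng_open_map; case: hB.
Qed.

Lemma cobis_src B : cobisection B -> cobisection (gsrc @` B).
Proof.
move=> hB; apply: cobis_units => [||_ [x _ <-]]; last exact: gsrc_unit.
- apply: continuous_compact; last by case: hB.
  by apply: continuous_subspaceT; exact: gsrc_continuous.
- by apply: (gsrc_open_map (proj1 aG)); case: hB.
Qed.

Lemma set_ginvE B : set_ginv B = ginv @^-1` B.
Proof.
apply/seteqP; split => [_ [a Aa <-]|a Aa] /=; first by rewrite ginvK.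
by exists (ginv a) => //; exact: ginvK.
Qed.

Lemma ginv_compact B : compact B -> compact (set_ginv B).
Proof.
by apply: continuous_compact; apply: continuous_subspaceT; exact: ginv_continuous.
Qed.

Lemma cobis_inv B : cobisection B -> cobisection (set_ginv B).
Proof.
move=> [cB oB [ir is_]]; split; [exact: ginv_compact|exact: set_ginv_open|].
split => x y; rewrite !inE set_ginvE /= => Bx By e.
  by rewrite -[x]ginvK -[y]ginvK; congr ginv; apply: is_; rewrite ?inE// !gsrc_inv.
by rewrite -[x]ginvK -[y]ginvK; congr ginv; apply: ir; rewrite ?inE// !grng_inv.
Qed.

Lemma cobis0 : cobisection (set0 : set G).
Proof.
by apply: cobis_units => //; [exact: compact0|exact: open0].
Qed.

Lemma cont_clopen B f : open B -> closed B -> {in B, forall x, {for x, continuous f}} ->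
  (forall x, ~ B x -> f x = 0) -> continuous f.
Proof.
move=> oB cB cf f0 x; have [Bx|nBx] := pselect (B x).
  by apply: cf; rewrite inE.
have oC : open (~` B) by exact: closed_openC.
rewrite /prop_for /continuous_at f0//.
have : (fun _ : G => 0 : C) @ x --> (0 : C) by exact: cvg_cst.
apply: cvg_trans; apply: near_eq_cvg.
have : nbhs x (~` B) by exact: open_nbhs_nbhs.
by apply: filterS => y /= nBy; rewrite f0.
Qed.

Lemma cindicE B x : (\1_B x : C) = if `[< B x >] then 1 else 0.
Proof. by rewrite indicE; case: asboolP => h; [rewrite mem_set|rewrite memNset]. Qed.

Lemma indic1 B x : B x -> (\1_B x : C) = 1.
Proof. by rewrite cindicE => /asboolP ->. Qed.
Lemma indic0 B x : ~ B x -> (\1_B x : C) = 0.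
Proof. by rewrite cindicE => /asboolPn/negbTE ->. Qed.

Lemma supp_indic B : supp (\1_B : G -> C) = B.
Proof.
apply/seteqP; split => x; rewrite /supp /= cindicE; case: asboolP; rewrite ?eqxx ?oner_neq0//.
Qed.

Lemma Cc_intro f K : continuous f -> compact K -> supp f `<=` K -> is_Cc f.
Proof.
move=> cf cK sK; split=> //; apply: (@subclosed_compact _ _ K) => //.
  exact: closed_closure.
have clK : closed K by exact: compact_closed.
by rewrite closureE; apply: smallest_sub.
Qed.

Lemma Cc_bound f : is_Cc f -> exists K, compact K /\ supp f `<=` K.
Proof. by case=> _ cK; exists (closure (supp f)); split => //; exact: subset_closure. Qed.

Lemma Cc_indic B : compact B -> open B -> is_Cc (\1_B : G -> C).
Proof.
move=> cB oB; apply: (@Cc_intro _ B) => //; last by rewrite supp_indic.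
apply: (@cont_clopen B) => // [|x|x]; first exact: compact_closed.
  rewrite inE => Bx; rewrite /prop_for /continuous_at indic1//.
  have : (fun _ : G => 1 : C) @ x --> (1 : C) by exact: cvg_cst.
  apply: cvg_trans; apply: near_eq_cvg.
  have : nbhs x B by exact: open_nbhs_nbhs.
  by apply: filterS => y /= By; rewrite indic1.
by move=> nBx; rewrite indic0.
Qed.

Lemma Cc_cobis B : cobisection B -> is_Cc (\1_B : G -> C).
Proof. by case=> cB oB _; exact: Cc_indic. Qed.

Lemma Cc0 : is_Cc ((fun=> 0) : G -> C).
Proof.
apply: (@Cc_intro _ set0); [by move=> x; exact: cvg_cst|exact: compact0|].
by move=> x; rewrite /supp /= eqxx.
Qed.

Lemma Cc_lin c f g : is_Cc f -> is_Cc g -> is_Cc (fun x => c * f x + g x).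
Proof.
move=> cf cg; have [K [cK fK]] := Cc_bound cf; have [L [cL gL]] := Cc_bound cg.
apply: (@Cc_intro _ (K `|` L)); [|exact: compactU|].
  have [cf' _] := cf; have [cg' _] := cg => x.
  apply: (@cplx_continuousD _ (fun x => c * f x) g); last exact: cg'.
  by apply: continuousM; [exact: cst_continuous|exact: cf'].
move=> x; rewrite /supp /=; have [fx0|fx] := eqVneq (f x) 0.
  by rewrite fx0 mulr0 add0r => gx; right; exact: gL.
by left; exact: fK.
Qed.

Lemma Cc_mul f g : is_Cc f -> continuous g -> is_Cc (fun x => g x * f x).
Proof.
move=> cf cg; have [K [cK fK]] := Cc_bound cf.
apply: (@Cc_intro _ K); [|exact: cK|].
  have [cf' _] := cf => x.
  by apply: continuousM; [exact: cg|exact: cf'].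
move=> x; rewrite /supp /= => gfx; apply: fK; rewrite /supp /=.
by apply: contra_neq gfx => ->; rewrite mulr0.
Qed.

Lemma Cc_comp f (h h' : G -> G) : is_Cc f -> continuous h -> continuous h' ->
  cancel h h' -> is_Cc (f \o h).
Proof.
move=> cf ch ch' hK; have [K [cK fK]] := Cc_bound cf.
apply: (@Cc_intro _ (h' @` K)).
- by have [cf' _] := cf => x; apply: continuous_comp; [exact: ch|exact: cf'].
- by apply: continuous_compact => //; exact: continuous_subspaceT.
- by move=> x fx; exists (h x); [exact: fK|rewrite hK].
Qed.

Lemma conj_continuous : continuous (fun z : C => z^*).
Proof.
move=> z; apply/(cvgrPdist_lt (FF := nbhs_filter z)) => e e0.
have := @cvgr_dist_lt _ _ _ _ (nbhs_filter z) id z cvg_id e e0.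
by apply: filterS => w; rewrite -rmorphB norm_conjC.
Qed.

Lemma Cc_star f : is_Cc f -> is_Cc (star f).
Proof.
move=> cf; have cf' : is_Cc (f \o ginv).
  by apply: (Cc_comp cf (h' := ginv)); [exact: ginv_continuous..|exact: ginvK].
have [K [cK fK]] := Cc_bound cf'.
apply: (@Cc_intro _ K); [|exact: cK|].
  move=> x; apply: (@continuous_comp _ _ _ (f \o ginv) (fun z => z^*)).
    by have [cf'' _] := cf'; exact: cf''.
  exact: conj_continuous.
move=> x; rewrite /supp /= /star => h; apply: fK; rewrite /supp /=.
by apply: contra_neq h => ->; rewrite rmorph0.
Qed.

(** The near-covering form of compactness is applied to the filter of finite lists that eventually
    contain any prescribed list; a property that holds eventually near each point then holds for one
    list on all of K. *)
Lemma compact_seq_cover (T : topologicalType) (K : set T) (b : T -> set T) :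
  compact K -> (forall x, open (b x) /\ b x x) ->
  exists s : seq T, forall x, K x -> exists2 i, i \in s & b i x.
Proof.
move=> /compact_near_coveringP cK bP.
pose F : set_system (seq T) :=
  [set A | exists s0 : seq T, forall s : seq T, {subset s0 <= s} -> A s].
have FF : Filter F.
  split.
  - by exists [::].
  - move=> A B [s sA] [t tB]; exists (s ++ t) => r rs; split.
      by apply: sA => x xs; apply: rs; rewrite mem_cat xs.
    by apply: tB => x xs; apply: rs; rewrite mem_cat xs orbT.
  - by move=> A B AB [s sA]; exists s => t /sA/AB.
have [x Kx|s sK] := cK _ F (fun (s : seq T) x => exists2 i, i \in s & b i x) FF.
  exists (b x, [set s : seq T | x \in s]) => /=.
    split; first by apply: open_nbhs_nbhs; case: (bP x).
    by exists [:: x] => s; apply; rewrite inE.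
  by move=> [y s] /= [bxy xs]; exists x.
by exists s => x; exact: sK.
Qed.

(** Finitely many compact open bisections cover the support, and their indicators are continuous, so
    they cut f into pieces carried by single bisections. Identities linear in f are thereby reduced
    to the case where each convolution sum has at most one term. *)
Lemma Cc_ind (P : (G -> C) -> Prop) :
  P (fun=> 0) ->
  (forall f g, is_Cc f -> is_Cc g -> P f -> P g -> P (fun x => f x + g x)) ->
  (forall f B, is_Cc f -> cobisection B -> supp f `<=` B -> P f) ->
  forall f, is_Cc f -> P f.
Proof.
move=> P0 PD PB f cf; have [K [cK fK]] := Cc_bound cf.
have /choice[b bP] := cobis_exT.
have [i|s Ks] := @compact_seq_cover _ K b cK.
  by case: (bP i) => -[].
have {fK Ks} : forall x, f x != 0 -> exists2 i, i \in s & b i x.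
  by move=> x /fK/Ks.
elim: s f cf => [|i s ih] f cf fcov.
  suff -> : f = fun=> 0 by [].
  apply/funext => x; apply/eqP/negPn/negP => h.
  by case: (fcov x h) => i; rewrite in_nil.
have [hb _] := bP i.
pose f1 x := \1_(b i) x * f x; pose f2 x := (1 - \1_(b i) x) * f x.
have ci : continuous (\1_(b i) : G -> C) by case: (Cc_cobis hb).
have cf1 : is_Cc f1 by apply: Cc_mul; [exact: cf|exact: ci].
have cf2 : is_Cc f2.
  apply: Cc_mul; [exact: cf|move=> x]; apply: (@cplx_continuousB _ (fun=> 1)); last exact: ci.
  exact: cst_continuous.
have -> : f = fun x => f1 x + f2 x.
  by apply/funext => x; rewrite /f1 /f2 -mulrDl addrC subrK mul1r.
apply: PD => //.
  apply: (PB _ (b i)) => // x; rewrite /supp /= /f1.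
  by rewrite cindicE; case: asboolP => //; rewrite mul0r eqxx.
apply: ih => // x; rewrite /f2 cindicE; case: asboolP.
  by rewrite subrr mul0r eqxx.
rewrite subr0 mul1r => nb h; case: (fcov x h) => j; rewrite in_cons => /orP[/eqP ->//|js bj].
by exists j.
Qed.

Lemma set_inj_finite (T U : choiceType) (A : set T) (h : T -> U) (u : U) :
  set_inj A h -> finite_set (A `&` [set x | h x = u]).
Proof.
move=> hi; have [[x [Ax hx]]|no] := pselect (exists x, A x /\ h x = u).
  apply: (sub_finite_set (B := [set x])); last exact: finite_set1.
  by move=> y [Ay hy]; apply: hi; rewrite ?inE// hx hy.
by rewrite (_ : _ `&` _ = set0)//; apply/seteqP; split => // y [Ay hy]; case: no; exists y.
Qed.

Lemma Cc_fin f u : is_Cc f ->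
  finite_set (supp f `&` rng_fiber u) /\ finite_set (supp f `&` src_fiber u).
Proof.
move: f; apply: Cc_ind.
- have -> : supp (fun _ : G => 0 : C) = set0.
    by apply/seteqP; split => // x; rewrite /supp /= eqxx.
  by rewrite !set0I.
- move=> f g _ _ [f1 f2] [g1 g2].
  have h : supp (fun x => f x + g x) `<=` supp f `|` supp g.
    move=> x; rewrite /supp /=; have [->|? _] := eqVneq (f x) 0; last by left.
    by rewrite add0r; right.
  split.
    apply: (sub_finite_set (B := (supp f `&` rng_fiber u) `|` (supp g `&` rng_fiber u))).
      by rewrite -setIUl; exact: setSI.
    by rewrite finite_setU.
  apply: (sub_finite_set (B := (supp f `&` src_fiber u) `|` (supp g `&` src_fiber u))).
    by rewrite -setIUl; exact: setSI.
  by rewrite finite_setU.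
- move=> f B _ [_ _ [ir is_]] sB; split.
    by apply: sub_finite_set (set_inj_finite u ir); exact: setSI.
  by apply: sub_finite_set (set_inj_finite u is_); exact: setSI.
Qed.

End Topology.

(** * Stone duality for a basis of compact open sets *)

Section Stone.
Variables (T : topologicalType) (hT : hausdorff_space T).
Variables (BB : set (set T)) (U0 : set T) (Phi Psi : set T -> set T).
Hypothesis BB0 : BB set0.
Hypothesis BBco : forall B, BB B -> [/\ compact B, open B & B `<=` U0].
Hypothesis BBbase : forall x U, U0 x -> open U -> U x ->
  exists B, [/\ BB B, B x & B `<=` U].
Hypotheses (PhiB : forall B, BB B -> BB (Phi B)) (PsiB : forall B, BB B -> BB (Psi B)).
Hypotheses (PhiK : forall B, BB B -> Psi (Phi B) = B)
  (PsiK : forall B, BB B -> Phi (Psi B) = B).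
Hypotheses
  (Phi_mono : forall B D, BB B -> BB D -> B `<=` D -> Phi B `<=` Phi D)
  (Psi_mono : forall B D, BB B -> BB D -> B `<=` D -> Psi B `<=` Psi D).

(** Disjointness is visible in the order: a basic F inside both images would pull back to a subset
    of B and of D, hence to the empty set. *)
Lemma stone_disjoint B D : BB B -> BB D -> B `&` D = set0 -> Phi B `&` Phi D = set0.
Proof.
move=> hB hD BD; apply/seteqP; split=> // z [Bz Dz].
have [_ oPB sPB] := BBco (PhiB hB); have [_ oPD _] := BBco (PhiB hD).
have [F [hF Fz sF]] := BBbase (sPB z Bz) (openI oPB oPD) (conj Bz Dz).
have F0 : Psi F `<=` set0.
  rewrite -BD -[B in B `&` _](PhiK hB) -[D in _ `&` D](PhiK hD) => t Ft.
  by split; [apply: (Psi_mono hF (PhiB hB)) Ft|apply: (Psi_mono hF (PhiB hD)) Ft];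
    move=> s /sF[].
(* The comparison is with [Psi set0], whose image under [Phi] is known to be empty, rather than with
   [set0] itself. *)
have F0' : F `<=` Phi (Psi set0).
  rewrite -{1}(PsiK hF); apply: Phi_mono; [exact: PsiB|exact: PsiB|].
  by move=> t /F0.
by rewrite PsiK// in F0'; exact: F0' Fz.
Qed.

(* The points of U0 are the prime filters of the poset BB, which only depends
   on its order. *)
Lemma stone_point x : U0 x -> exists y, U0 y /\ forall B, BB B -> (B x <-> Phi B y).
Proof.
(* The images of the basic sets around x generate a proper filter; the compact set [Phi B0] gives it
   a cluster point, which will be y. *)
move=> Ux; pose F : set_system T := [set A | exists B, [/\ BB B, B x & Phi B `<=` A]].
have [B0 [hB0 B0x _]] := BBbase Ux (@openT T) (I : setT x).
have FF : ProperFilter F.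
  split.
    move=> [B [hB Bx B0']]; have : Psi (Phi B) x by rewrite PhiK.
    move=> /(Psi_mono (PhiB hB) (PhiB BB0)).
    rewrite PhiK//; apply; exact: subset_trans B0' (@sub0set _ _).
  split.
  - by exists B0.
  - move=> P Q [B [hB Bx BP]] [D [hD Dx DQ]].
    have [_ oB _] := BBco hB; have [_ oD _] := BBco hD.
    have [E [hE Ex sE]] := BBbase Ux (openI oB oD) (conj Bx Dx).
    exists E; split=> // z Ez; split.
      by apply: BP; apply: (Phi_mono hE hB) Ez => t /sE[].
    by apply: DQ; apply: (Phi_mono hE hD) Ez => t /sE[].
  - by move=> P Q PQ [B [hB Bx BP]]; exists B; split=> //; exact: subset_trans PQ.
have [cP0 _ sP0] := BBco (PhiB hB0).
have [|y [Py clF]] := cP0 F FF; first by exists B0; split=> // t.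
have inP B : BB B -> B x -> Phi B y.
  move=> hB Bx; have [cP _ _] := BBco (PhiB hB).
  have clP : closed (Phi B) by exact: compact_closed.
  by apply: clP => V nV; apply: (clF (Phi B) V) => //; exists B; split=> // t.
exists y; split; first exact: sP0.
move=> B hB; split; first exact: inP.
(* If x is outside B, some basic E around x misses B; then [Phi E] and [Phi B] are disjoint although
   y lies in both. *)
move=> PBy; apply: contrapT => nBx.
have [cB _ _] := BBco hB.
have oC : open (~` B) by apply: closed_openC; exact: compact_closed.
have [E [hE Ex sE]] := BBbase Ux oC nBx.
have := @stone_disjoint E B hE hB.
have -> : E `&` B = set0 by apply/seteqP; split=> // t [/sE].
move=> /(_ erefl) e0; have : (Phi E `&` Phi B) y by split=> //; exact: inP.
by rewrite e0.
Qed.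

End Stone.

(** * Convolution *)

Section Convolution.
Variables (R : realType) (G : groupoid).
Hypotheses (hG : hausdorff_space G) (aG : ample G).
Local Notation C := (Cplx R).
Local Notation md := (@modulus R).
Implicit Types (f g : G -> C) (B K : set G).

(** A factorisation x = yz is determined by y in the range fibre of x, as z = y^-1 x. Any list
    containing the points of the fibre where f is non-zero will do, so several convolutions can
    share one list. *)
Lemma conv_seql f g x (Y : seq G) : uniq Y ->
  (forall y, y \in Y -> grng y = grng x) ->
  (forall y, grng y = grng x -> f y != 0 -> y \in Y) ->
  conv f g x = \sum_(y <- Y) f y * g (gmul (ginv y) x).
Proof.
move=> uY sY fY; rewrite /conv.
rewrite (@reindex_fsbig _ _ _ _ _ (fun y => (y, gmul (ginv y) x))
  (rng_fiber (grng x))); last first.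
  split.
  - move=> y /= ry; rewrite /rng_fiber /= in ry.
    have c : gsrc (ginv y) = grng x by rewrite gsrc_inv.
    rewrite grng_mul ?grng_inv//; split=> //.
    by rewrite gmulA ?grng_inv// gmul_inv ry gmul_rng.
  - by move=> y z _ _ [].
  - move=> [y z] /= [yz yzx]; exists y.
      by rewrite /rng_fiber /= -yzx grng_mul.
    by rewrite -yzx gmulKl.
rewrite (fsbigE Y)//=; last first.
  move=> y ry nyY; have [->|fy] := eqVneq (f y) 0; first by rewrite mul0r.
  by rewrite (fY y ry fy) in nyY.
rewrite big_seq_cond [RHS]big_seq; apply: eq_bigl => y.
by case: (boolP (y \in Y)) => //= yY; rewrite mem_set//; exact: sY.
Qed.

Lemma conv_seqr f g x (Y : seq G) : uniq Y ->
  (forall y, y \in Y -> gsrc y = gsrc x) ->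
  (forall y, gsrc y = gsrc x -> g y != 0 -> y \in Y) ->
  conv f g x = \sum_(y <- Y) f (gmul x (ginv y)) * g y.
Proof.
move=> uY sY gY; rewrite /conv.
rewrite (@reindex_fsbig _ _ _ _ _ (fun y => (gmul x (ginv y), y))
  (src_fiber (gsrc x))); last first.
  split.
  - move=> y /= sy; rewrite /src_fiber /= in sy.
    have c : gsrc x = grng (ginv y) by rewrite grng_inv.
    by rewrite gsrc_mul ?gsrc_inv//; split=> //; rewrite gmulVK.
  - by move=> y z _ _ [].
  - move=> [y z] /= [yz yzx]; exists z.
      by rewrite /src_fiber /= -yzx gsrc_mul.
    by rewrite -yzx gmulK.
rewrite (fsbigE Y)//=; last first.
  move=> y sy nyY; have [->|gy] := eqVneq (g y) 0; first by rewrite mulr0.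
  by rewrite (gY y sy gy) in nyY.
rewrite big_seq_cond [RHS]big_seq; apply: eq_bigl => y.
by case: (boolP (y \in Y)) => //= yY; rewrite mem_set//; exact: sY.
Qed.

Lemma lreg_seq u f (xi : G -> C) x (Y : seq G) : uniq Y ->
  (forall y, y \in Y -> gsrc y = u) ->
  (forall y, gsrc y = u -> f (gmul x (ginv y)) * xi y != 0 -> y \in Y) ->
  lreg u f xi x = \sum_(y <- Y) f (gmul x (ginv y)) * xi y.
Proof.
move=> uY sY gY; rewrite /lreg (fsbigE Y)//=; last first.
  move=> y sy nyY; apply/eqP/negPn/negP => h.
  by rewrite (gY y sy h) in nyY.
rewrite big_seq_cond [RHS]big_seq; apply: eq_bigl => y.
by case: (boolP (y \in Y)) => //= yY; rewrite mem_set//; exact: sY.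
Qed.

Lemma set_seq (A : set G) : finite_set A ->
  exists Y : seq G, uniq Y /\ forall y, y \in Y <-> A y.
Proof.
move=> fA; exists (finmap.enum_fset (fset_set A)); split; first exact: finmap.fset_uniq.
by move=> y; rewrite in_fset_set//; split; rewrite inE.
Qed.

Lemma Cc_rseq f u : is_Cc f -> exists Y : seq G,
  [/\ uniq Y, forall y, y \in Y -> grng y = u &
      forall y, grng y = u -> f y != 0 -> y \in Y].
Proof.
move=> cf; have [h _] := Cc_fin hG aG u cf.
have [Y [uY YP]] := set_seq h; exists Y; split=> // y; first by case/YP.
by move=> ry fy; apply/YP.
Qed.

Lemma Cc_sseq f u : is_Cc f -> exists Y : seq G,
  [/\ uniq Y, forall y, y \in Y -> gsrc y = u &
      forall y, gsrc y = u -> f y != 0 -> y \in Y].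
Proof.
move=> cf; have [_ h] := Cc_fin hG aG u cf.
have [Y [uY YP]] := set_seq h; exists Y; split=> // y; first by case/YP.
by move=> ry fy; apply/YP.
Qed.

Lemma lreg_Cc_seq f u x : is_Cc f -> gsrc x = u -> exists Y : seq G,
  [/\ uniq Y, forall y, y \in Y -> gsrc y = u &
      forall y, gsrc y = u -> f (gmul x (ginv y)) != 0 -> y \in Y].
Proof.
move=> cf sx; have [Y [uY sY fY]] := Cc_rseq (grng x) cf.
exists (undup [seq gmul (ginv z) x | z <- Y]); split; first exact: undup_uniq.
  move=> y; rewrite mem_undup => /mapP[z zY ->].
  by rewrite gsrc_mul// gsrc_inv; exact: sY.
move=> y sy h; rewrite mem_undup; apply/mapP.
have c : gsrc x = grng (ginv y) by rewrite grng_inv sx.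
exists (gmul x (ginv y)); first by apply: fY => //; rewrite grng_mul.
by rewrite ginv_mul// ginvK gmulVK// sx.
Qed.

Lemma conv_bisl B f g x b : cobisection B -> supp f `<=` B -> B b ->
  grng b = grng x -> conv f g x = f b * g (gmul (ginv b) x).
Proof.
move=> hB sB Bb rb; rewrite (@conv_seql _ _ _ [:: b])//.
- by rewrite big_seq1.
- by move=> y; rewrite inE => /eqP ->.
- move=> y ry /sB By; rewrite inE; apply/eqP.
  by apply: (cobis_injr hB) => //; rewrite ry.
Qed.

Lemma conv_bisl0 B f g x : supp f `<=` B -> (forall b, B b -> grng b <> grng x) ->
  conv f g x = 0.
Proof.
move=> sB h; rewrite (@conv_seql _ _ _ [::])// ?big_nil//.
by move=> y ry /sB By; case: (h y By).
Qed.

Lemma conv_bisr B f g x b : cobisection B -> supp g `<=` B -> B b ->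
  gsrc b = gsrc x -> conv f g x = f (gmul x (ginv b)) * g b.
Proof.
move=> hB sB Bb rb; rewrite (@conv_seqr _ _ _ [:: b])//.
- by rewrite big_seq1.
- by move=> y; rewrite inE => /eqP ->.
- move=> y ry /sB By; rewrite inE; apply/eqP.
  by apply: (cobis_injs hB) => //; rewrite ry.
Qed.

Lemma conv_bisr0 B f g x : supp g `<=` B -> (forall b, B b -> gsrc b <> gsrc x) ->
  conv f g x = 0.
Proof.
move=> sB h; rewrite (@conv_seqr _ _ _ [::])// ?big_nil//.
by move=> y ry /sB By; case: (h y By).
Qed.

Lemma convDl f f' g x : is_Cc f -> is_Cc f' ->
  conv (fun y => f y + f' y) g x = conv f g x + conv f' g x.
Proof.
move=> cf cf'; have [Y [uY sY fY]] := Cc_rseq (grng x) cf.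
have [Y' [uY' sY' fY']] := Cc_rseq (grng x) cf'.
pose Z := undup (Y ++ Y').
have uZ : uniq Z by exact: undup_uniq.
have sZ y : y \in Z -> grng y = grng x.
  by rewrite mem_undup mem_cat => /orP[/sY|/sY'].
have fZ y : grng y = grng x -> f y != 0 -> y \in Z.
  by move=> ry fy; rewrite mem_undup mem_cat fY.
have fZ' y : grng y = grng x -> f' y != 0 -> y \in Z.
  by move=> ry fy; rewrite mem_undup mem_cat fY' ?orbT.
rewrite !(@conv_seql _ _ _ Z)// -?big_split /=; last first.
  move=> y ry; have [->|fy _] := eqVneq (f y) 0; last exact: fZ.
  by rewrite add0r; exact: fZ'.
by apply: eq_bigr => y _; rewrite mulrDl.
Qed.

Definition rsec B x : G := xget x [set b | B b /\ grng b = grng x].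

Lemma rsecP B x : (grng @` B) (grng x) -> B (rsec B x) /\ grng (rsec B x) = grng x.
Proof.
by move=> [b Bb rb]; rewrite /rsec; case: xgetP => [y _ []//|/(_ b)[]].
Qed.

Lemma rsec_continuous B x : open B -> bisection B -> (grng @` B) (grng x) ->
  {for x, continuous (rsec B)}.
Proof.
move=> oB [ir _] rx V /=; rewrite nbhsE => -[W [oW Wbx] WV].
have [Bb rb] := rsecP rx.
have oS : open (grng @` (W `&` B) : set G).
  by apply: (grng_open_map aG); exact: openI.
have : nbhs x (grng @^-1` (grng @` (W `&` B) : set G)).
  apply: (@grng_continuous G x); apply: open_nbhs_nbhs; split => //.
  by exists (rsec B x).
apply: filterS => y [w [Ww Bw] ew] /=; apply: WV.
have [|By ey] := @rsecP B y; first by exists w.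
suff -> : rsec B y = w by [].
by apply: ir; rewrite ?inE// ey.
Qed.

(** Multiplication is continuous only on composable pairs, so composability has to hold on a whole
    neighbourhood of the point. *)
Lemma mul_continuous_at (h : G -> G) x (U : set G) : open U -> U x ->
  (forall y, U y -> gsrc (h y) = grng y) ->
  {for x, continuous h} -> {for x, continuous (fun y => gmul (h y) y)}.
Proof.
move=> oU Ux sh ch V /= nV.
have /subspace_continuousP/(_ (h x, x)) := @gmul_continuous G.
rewrite /= => /(_ (sh x Ux)).
move=> /(_ V nV); rewrite /within /= => nA.
have cb : (fun y => (h y, y)) @ x --> (h x, x).
  by apply: cvg_pair; [exact: ch|exact: cvg_id].
have n1 : nbhs x (fun y => gsrc (h y) = grng y -> V (gmul (h y) y)) by exact: (cb _ nA).
have n2 : nbhs x U by exact: open_nbhs_nbhs.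
by apply: filterS2 n1 n2 => y /= hy Uy; apply: hy; exact: sh.
Qed.

(** Where r(x) lies in r(B) the sum is the single term f(b) g(b^-1 x), with b = [rsec B x] depending
    continuously on x; elsewhere it is zero. The two regions are clopen. *)
Lemma conv_continuous_bis B f g : cobisection B -> supp f `<=` B ->
  is_Cc f -> is_Cc g -> continuous (conv f g).
Proof.
move=> hB sB [cf _] [cg _].
have hrB := cobis_rng aG hB.
apply: (@cont_clopen _ _ (grng @^-1` (grng @` B : set G))).
- by apply: open_comp => [x _|]; [exact: grng_continuous|case: hrB].
- apply: closed_comp => [x _|]; first exact: grng_continuous.
  exact: (cobis_closed hG).
- move=> x; rewrite inE /= => rx.
  set U := grng @^-1` (grng @` B : set G).
  have oU : open U.
    by apply: open_comp => [y _|]; [exact: grng_continuous|case: hrB].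
  have [_ oB bB] := hB; have cs := rsec_continuous oB bB rx.
  have csi : {for x, continuous (fun y => ginv (rsec B y))}.
    by apply: continuous_comp; [exact: cs|exact: ginv_continuous].
  have E y : U y -> conv f g y = f (rsec B y) * g (gmul (ginv (rsec B y)) y).
    by move=> Uy; have [Bb rb] := rsecP Uy; exact: (conv_bisl g hB).
  rewrite /prop_for /continuous_at E//.
  have c : {for x, continuous (fun y => f (rsec B y) * g (gmul (ginv (rsec B y)) y))}.
    apply: continuousM.
      by apply: (@continuous_comp _ _ _ (rsec B) f); [exact: cs|exact: cf].
    apply: (@continuous_comp _ _ _ (fun y => gmul (ginv (rsec B y)) y) g); last exact: cg.
    apply: (mul_continuous_at oU) => // y Uy.
    by have [_ rb] := rsecP Uy; rewrite gsrc_inv.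
  apply: cvg_trans c; apply: near_eq_cvg.
  have : nbhs x U by exact: open_nbhs_nbhs.
  by apply: filterS => y /E.
- move=> x /= nx; apply: (conv_bisl0 g sB) => b Bb rb.
  by apply: nx; exists b.
Qed.

Lemma set_gmul_compact K L : compact K -> compact L -> compact (set_gmul K L).
Proof.
move=> cK cL.
pose D := [set q : G * G | gsrc q.1 = grng q.2].
have clD : closed D.
  have -> : D = [set q : G * G | gsrc q.1 = grng q.2] by [].
  rewrite -openC openE => -[a b] /= ab.
  move: hG; rewrite open_hausdorff => /(_ (gsrc a) (grng b)).
  have ne : gsrc a != grng b by apply/eqP.
  move=> /(_ ne)[[U V] /=]; rewrite !inE => -[aU bV] [oU oV UV].
  exists (gsrc @^-1` U, grng @^-1` V) => /=.
    split.
      by apply: gsrc_continuous; exact: open_nbhs_nbhs.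
    by apply: grng_continuous; exact: open_nbhs_nbhs.
  move=> [x y] /= [Ux Vy] xy; have : (U `&` V) (gsrc x) by split=> //; rewrite xy.
  by rewrite UV.
have -> : set_gmul K L = (fun q : G * G => gmul q.1 q.2) @` ((K `*` L) `&` D).
  apply/seteqP; split => [z [a [b [Ka Lb ab ->]]]|_ [[a b] /= [[Ka Lb] ab] <-]].
    by exists (a, b).
  by exists a, b.
apply: continuous_compact.
  apply: continuous_subspaceW (@gmul_continuous G).
  exact: subIsetr.
apply: compact_closedI => //; exact: compact_setX.
Qed.

Lemma Cc_conv f g : is_Cc f -> is_Cc g -> is_Cc (conv f g).
Proof.
move=> cf cg; have [K [cK fK]] := Cc_bound cf; have [L [cL gL]] := Cc_bound cg.
apply: (@Cc_intro _ _ hG _ (set_gmul K L)); last 2 first.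
- exact: set_gmul_compact.
- move=> x; rewrite /supp /=.
  have [Y [uY sY fY]] := Cc_rseq (grng x) cf.
  rewrite (conv_seql g uY sY fY) => h.
  apply: contrapT => nx; move/eqP: h; apply; apply: big1_seq => y /= yY.
  have c : gsrc (ginv y) = grng x by rewrite gsrc_inv; exact: sY.
  have [->|fy] := eqVneq (f y) 0; first by rewrite mul0r.
  have [->|gy] := eqVneq (g (gmul (ginv y) x)) 0; first by rewrite mulr0.
  case: nx; exists y, (gmul (ginv y) x); split; [exact: fK|exact: gL| |].
    by rewrite grng_mul ?grng_inv.
  by rewrite gmulA ?grng_inv// gmul_inv -(gsrc_inv y) c gmul_rng.
move: f cf {K cK fK}; apply: (Cc_ind hG aG).
- have -> : conv (fun _ : G => 0 : C) g = fun=> 0.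
    apply/funext => x; apply: (@conv_bisl0 set0) => // y.
    by rewrite /supp /= eqxx.
  by move=> x; exact: cvg_cst.
- move=> f f' cf cf' c1 c2 x.
  have -> : conv (fun y => f y + f' y) g = fun y => conv f g y + conv f' g y.
    by apply/funext => y; exact: convDl.
  by apply: (@cplx_continuousD _ _ (conv f g)); [exact: c1|exact: c2].
- by move=> f B cf hB sB; exact: (conv_continuous_bis hB).
Qed.

End Convolution.

(** * Finite descriptions of the norms *)

Section PowerSums.
Variables (R : realType).
Local Notation C := (Cplx R).
Local Notation md := (@modulus R).

Lemma powR_cvg (p : R) (u : nat -> R) (l : R) : 0 < p -> (forall n, 0 <= u n) -> 0 <= l ->
  u @ \oo --> l -> (fun n => u n `^ p) @ \oo --> l `^ p.
Proof.
move=> p0 u0; rewrite le_eqVlt => /orP[/eqP <-|l0] ul; last first.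
  apply: (@continuous_cvg _ _ _ _ _ u (fun t => t `^ p)) => //.
  have /differentiable_continuous : differentiable (fun t : R => t `^ p) l.
    by apply/derivable1_diffP; apply: derivable_powR; rewrite in_itv /= l0.
  exact.
(* Differentiability of t^p is used only at positive limits; at the limit 0 the threshold e^(1/p)
   gives the estimate directly. *)
rewrite powR0 ?gt_eqF//; apply/cvgrPdist_lt => e e0.
have d0 : 0 < e `^ p^-1 by exact: powR_gt0.
move/cvgrPdist_lt: ul => /(_ _ d0); apply: filterS => n.
rewrite !sub0r !normrN !ger0_norm ?powR_ge0// => h.
have -> : e = (e `^ p^-1) `^ p by rewrite -powRrM mulVf ?gt_eqF// powRr1// ltW.
by apply: gt0_ltr_powR; rewrite ?nnegrE// ltW.
Qed.

Lemma cvg_sum_seq (I : Type) (s : seq I) (u : nat -> I -> R) (l : I -> R) :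
  (forall i, (fun n => u n i) @ \oo --> l i) ->
  (fun n => \sum_(i <- s) u n i) @ \oo --> \sum_(i <- s) l i.
Proof.
move=> ul; elim: s => [|i s ih].
  under eq_fun do rewrite big_nil; rewrite big_nil; exact: cvg_cst.
under eq_fun do rewrite big_cons; rewrite big_cons.
by apply: cvgD.
Qed.

Lemma sum_filter_le (I : eqType) (Z Y : seq I) (h : I -> R) : uniq Z -> uniq Y ->
  (forall i, 0 <= h i) ->
  \sum_(z <- Z | z \in Y) h z <= \sum_(y <- Y) h y.
Proof.
move=> uZ uY h0; have -> : \sum_(z <- Z | z \in Y) h z = \sum_(z <- Y | z \in Z) h z.
  rewrite -big_filter -[RHS]big_filter; apply: perm_big; apply: uniq_perm.
  - exact: filter_uniq.
  - exact: filter_uniq.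
  - by move=> z; rewrite !mem_filter andbC.
by rewrite big_mkcond; apply: ler_sum => z _; case: ifP.
Qed.

Lemma squeeze_dist0 (u v : nat -> R) (l : R) :
  (forall n, `|u n - l| <= v n) -> v @ \oo --> (0 : R) -> u @ \oo --> l.
Proof.
move=> uv /cvgrPdist_lt v0; apply/cvgrPdist_lt => e e0.
apply: filterS (v0 e e0) => n; rewrite sub0r normrN => h.
by rewrite distrC (le_lt_trans (uv n))// (le_lt_trans (ler_norm _)).
Qed.

Lemma mod_dist (x y : C) : `|md x - md y| <= md (x - y).
Proof.
rewrite ler_norml; apply/andP; split.
  by rewrite lerNl opprB lerBlDr -(modB y x) -[X in md X <= _](subrK x); exact: modD.
by rewrite lerBlDr -[X in md X <= _](subrK y); exact: modD.
Qed.

Lemma mod_cvg (z : nat -> C) w : (fun n => md (z n - w)) @ \oo --> (0 : R) ->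
  (fun n => md (z n)) @ \oo --> md w.
Proof. by apply: squeeze_dist0 => n; exact: mod_dist. Qed.

Lemma mod_lin_cvg (I : Type) (s : seq I) (a : nat -> I -> C) (b c : I -> C) :
  (forall i, (fun n => md (a n i - b i)) @ \oo --> (0 : R)) ->
  (fun n => md (\sum_(i <- s) a n i * c i)) @ \oo --> md (\sum_(i <- s) b i * c i).
Proof.
move=> ab; apply: mod_cvg.
apply: (@squeeze_dist0 _ (fun n => \sum_(i <- s) md (a n i - b i) * md (c i))).
  move=> n; rewrite subr0 ger0_norm ?mod_ge0// -sumrB.
  apply: le_trans (mod_sum _ _) _; apply: ler_sum => i _.
  by rewrite -mulrBl modM.
have := @cvg_sum_seq _ s (fun n i => md (a n i - b i) * md (c i))
  (fun i => 0 * md (c i)).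
have -> : \sum_(i <- s) (0 * md (c i)) = 0 :> R by rewrite big1// => i _; rewrite mul0r.
by apply=> i; apply: cvgM; [exact: ab|exact: cvg_cst].
Qed.

End PowerSums.

Section FiniteBounds.
Variables (R : realType) (G : groupoid).
Hypotheses (hG : hausdorff_space G) (aG : ample G).
Local Notation C := (Cplx R).
Local Notation md := (@modulus R).
Implicit Types (f g : G -> C) (B K : set G) (p c : R).

(* The left regular representation at any unit has norm at most [c], tested on
   finite sections of its matrix. *)
Definition lambda_bound p c f : Prop :=
  forall (u : G) (X Y : seq G) (xi : G -> C), uniq X -> uniq Y ->
    (forall x, x \in X -> gsrc x = u) -> (forall y, y \in Y -> gsrc y = u) ->
    \sum_(x <- X) md (\sum_(y <- Y) f (gmul x (ginv y)) * xi y) `^ p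
      <= c `^ p * \sum_(y <- Y) md (xi y) `^ p.

Definition I_bound c f : Prop :=
  forall (u : G) (X : seq G), uniq X ->
    ((forall x, x \in X -> gsrc x = u) -> \sum_(x <- X) md (f x) <= c) /\
    ((forall x, x \in X -> grng x = u) -> \sum_(x <- X) md (f x) <= c).

Definition kind_bound (k : algebra_kind R) c f : Prop :=
  match k with
  | alg_LI => I_bound c f
  | alg_Fp p => lambda_bound p c f
  | alg_Fpstar p => lambda_bound p c f /\ lambda_bound p c (star f)
  end.

Lemma esum_leP (D : set G) (h : G -> R) c :
  ((\esum_(x in D) (h x)%:E) <= c%:E)%E <->
  (forall X : seq G, uniq X -> (forall x, x \in X -> D x) -> \sum_(x <- X) h x <= c).
Proof.
split=> [le X uX XD|h0].
  rewrite -lee_fin -sumEFin fsbig_seq//; apply: le_trans le.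
  apply: ereal_sup_ubound; exists [set` X] => //; split; last by move=> x /XD.
  exact: finite_seq.
apply: ge_ereal_sup => _ [A [fA AD] <-].
have [Y [uY YA]] := set_seq fA.
have -> : A = [set` Y] by apply/seteqP; split => x /YA.
rewrite -fsbig_seq// sumEFin lee_fin; apply: h0 => // x /YA; exact: AD.
Qed.

Lemma poweR_invP p (E : \bar R) c : 0 < p -> 0 <= c -> (0 <= E)%E ->
  ((E `^ p^-1)%E <= c%:E)%E <-> (E <= (c `^ p)%:E)%E.
Proof.
move=> p0 c0; case: E => [e||] //; last first.
  by rewrite poweRyr ?invr_neq0 ?gt_eqF// !leye_eq.
rewrite poweR_EFin !lee_fin => e0; have ip : 0 < p^-1 by rewrite invr_gt0.
have E1 : e = (e `^ p^-1) `^ p by rewrite -powRrM mulVf ?gt_eqF// powRr1.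
have E2 : c = (c `^ p) `^ p^-1 by rewrite -powRrM mulfV ?gt_eqF// powRr1.
split=> h.
  rewrite E1; apply: ge0_ler_powR; rewrite ?nnegrE ?powR_ge0//; exact: ltW.
rewrite E2; apply: ge0_ler_powR; rewrite ?nnegrE ?powR_ge0//; exact: ltW.
Qed.

Lemma lpnorm_leP p D (xi : G -> C) c : 0 < p -> 0 <= c ->
  (lpnorm p D xi <= c%:E)%E <->
  (forall X : seq G, uniq X -> (forall x, x \in X -> D x) ->
     \sum_(x <- X) md (xi x) `^ p <= c `^ p).
Proof.
move=> p0 c0; rewrite /lpnorm poweR_invP//; last first.
  by apply: esum_ge0 => x _; rewrite lee_fin powR_ge0.
exact: (esum_leP D (fun x => md (xi x) `^ p)).
Qed.

Lemma sup0_le (S : set (\bar R)) c : 0 <= c ->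
  (sup0 S <= c%:E)%E <-> (forall s, S s -> (s <= c%:E)%E).
Proof.
move=> c0; split=> [le s Ss|h].
  by apply: le_trans le; apply: ereal_sup_ubound; right.
by apply: ge_ereal_sup => s [->|/h//]; rewrite lee_fin.
Qed.

Lemma Inorm_leP f c : 0 <= c -> (Inorm f <= c%:E)%E <-> I_bound c f.
Proof.
move=> c0; rewrite /Inorm ge_max; split.
  move=> /andP[/(sup0_le _ c0) h1 /(sup0_le _ c0) h2] u X uX.
  case: X uX => [|x X] uX; first by rewrite big_nil.
  split=> sX.
    have uu : units u by rewrite -(sX x (mem_head _ _)); exact: gsrc_unit.
    have /esum_leP : (\esum_(x in src_fiber u) (md (f x))%:E <= c%:E)%E.
      by apply: h1; exists u.
    by apply.
  have uu : units u by rewrite -(sX x (mem_head _ _)); exact: grng_unit.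
  have /esum_leP : (\esum_(x in rng_fiber u) (md (f x))%:E <= c%:E)%E.
    by apply: h2; exists u.
  by apply.
move=> h; apply/andP; split; apply/(sup0_le _ c0) => _ [u uu <-]; apply/esum_leP => X uX sX.
  by have [h1 _] := h u X uX; exact: h1.
by have [_ h1] := h u X uX; exact: h1.
Qed.

Lemma mod_scale (t : R) (z : C) : 0 <= t -> md (real_complex R t * z) = t * md z.
Proof. by move=> t0; rewrite modM mod_rC. Qed.

(** A function in C_c meets each fibre in finitely many points, so finitely many rows of its matrix
    involve finitely many columns. Conversely, a finitely supported vector can be normalised and
    tested against the operator norm. *)
Lemma Fpnorm_leP p f c : is_Cc f -> 1 <= p -> 0 <= c ->
  (Fpnorm p f <= c%:E)%E <-> lambda_bound p c f.
Proof.
move=> cf p1 c0; have p0 : 0 < p by lra.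
rewrite /Fpnorm sup0_le//; split; last first.
  move=> h _ [u uu <-]; apply: ge_ereal_sup => _ [xi /= xi1 <-].
  apply/lpnorm_leP => // X uX sX.
  have /choice[Z ZP] : forall x, exists Y : seq G, gsrc x = u ->
      [/\ uniq Y, forall y, y \in Y -> gsrc y = u &
      forall y, gsrc y = u -> f (gmul x (ginv y)) != 0 -> y \in Y].
    move=> x; have [sx|nsx] := pselect (gsrc x = u); last by exists [::].
    by have [Y YP] := lreg_Cc_seq hG aG cf sx; exists Y.
  pose Y := undup (flatten [seq Z x | x <- X]).
  have sY y : y \in Y -> gsrc y = u.
    rewrite mem_undup => /flattenP[_ /mapP[x xX ->]].
    by have [_ + _] := ZP x (sX x xX); exact.
  have -> : \sum_(x <- X) md (lreg u f xi x) `^ p =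
            \sum_(x <- X) md (\sum_(y <- Y) f (gmul x (ginv y)) * xi y) `^ p.
    rewrite big_seq [RHS]big_seq; apply: eq_bigr => x xX.
    rewrite (@lreg_seq _ _ _ _ _ _ Y) ?undup_uniq// => y sy.
    rewrite mulf_eq0 negb_or => /andP[fy _]; rewrite mem_undup.
    apply/flattenP; exists (Z x); first by apply/mapP; exists x.
    by have [_ _] := ZP x (sX x xX); apply.
  apply: le_trans (h u X Y xi uX (undup_uniq _) sX sY) _.
  rewrite -[leRHS]mulr1 ler_wpM2l ?powR_ge0//.
  have := xi1; rewrite (@lpnorm_leP _ _ _ 1)// powR1.
  by apply=> //; exact: undup_uniq.
move=> h u X Y xi uX uY sX sY.
have N0 : 0 <= \sum_(y <- Y) md (xi y) `^ p.
  by apply: sumr_ge0 => y _; exact: powR_ge0.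
(* With X empty nothing makes u a unit and the bound is trivial; a point of X shows that u is a
   source. *)
case: X uX sX => [|x0 X'] uX sX.
  by rewrite big_nil mulr_ge0// powR_ge0.
have uu : units u by rewrite -(sX x0 (mem_head _ _)); exact: gsrc_unit.
move: (x0 :: X') uX sX => {x0}{}X' uX sX.
set N := \sum_(y <- Y) _ in N0 *.
have [N00|Nn0] := eqVneq N 0.
  have xi0 y : y \in Y -> xi y = 0.
    move=> yY; have /eqP := N00; rewrite psumr_eq0; last by move=> *; exact: powR_ge0.
    by move/allP/(_ y yY); rewrite /= powR_eq0 mod_eq0 => /andP[/eqP].
  rewrite N00 mulr0 big1_seq// => x /= xX.
  rewrite big1_seq ?mod0 ?powR0 ?gt_eqF// => y /= yY.
  by rewrite xi0// mulr0.
have Np : 0 < N by rewrite lt0r Nn0.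
pose t := N `^ p^-1; have t0 : 0 < t by exact: powR_gt0.
have tp : t `^ p = N by rewrite -powRrM mulVf ?gt_eqF// powRr1.
(* The vector is cut off outside Y and divided by its l^p norm t, because [lreg] sums over the whole
   fibre and the test vectors lie in the unit ball. *)
pose eta y : C := if y \in Y then real_complex R t^-1 * xi y else 0.
have ti0 : 0 <= t^-1 by rewrite invr_ge0 ltW.
have eta1 : (lpnorm p (src_fiber u) eta <= 1)%E.
  apply/(@lpnorm_leP p _ _ 1) => // Z uZ _; rewrite powR1.
  have -> : \sum_(z <- Z) md (eta z) `^ p =
            t^-1 `^ p * \sum_(z <- Z | z \in Y) md (xi z) `^ p.
    rewrite mulr_sumr [RHS]big_mkcond; apply: eq_bigr => z _; rewrite /eta.
    case: ifP => _; last by rewrite mod0 powR0 ?gt_eqF.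
    by rewrite mod_scale// powRM.
  have -> : t^-1 `^ p = N^-1.
    have h1 : t^-1 `^ p * t `^ p = 1.
      by rewrite -powRM ?(ltW t0)// mulVf ?gt_eqF// powR1.
    by rewrite tp in h1; apply: (mulIf Nn0); rewrite h1 mulVf.
  rewrite mulrC ler_pdivrMr// mul1r; apply: sum_filter_le => // z.
  exact: powR_ge0.
have /lpnorm_leP : (lpnorm p (src_fiber u) (lreg u f eta) <= c%:E)%E.
  have : (lreg_opnorm p u f <= c%:E)%E by apply: h; exists u.
  by apply: le_trans; apply: ereal_sup_ubound; exists eta.
move=> /(_ p0 c0 X' uX sX).
have E x : lreg u f eta x = real_complex R t^-1 * \sum_(y <- Y) f (gmul x (ginv y)) * xi y.
  rewrite (@lreg_seq _ _ _ _ _ _ Y)//; last first.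
    by move=> y _; rewrite /eta; case: ifP => //; rewrite mulr0 eqxx.
  rewrite mulr_sumr big_seq [RHS]big_seq; apply: eq_bigr => y yY.
  by rewrite /eta yY mulrCA.
under eq_bigr do rewrite E mod_scale// powRM//.
rewrite -mulr_sumr => h2.
have h1 : t `^ p * t^-1 `^ p = 1.
  by rewrite -powRM ?(ltW t0)// mulfV ?gt_eqF// powR1.
rewrite -[leLHS]mul1r -h1 -mulrA tp [leRHS]mulrC.
by rewrite ler_wpM2l.
Qed.

End FiniteBounds.

(** * Stability of the finite bounds *)

Section BoundLemmas.
Variables (R : realType) (G : groupoid).
Hypotheses (hG : hausdorff_space G) (aG : ample G).
Local Notation C := (Cplx R).
Local Notation md := (@modulus R).
Implicit Types (f g : G -> C) (B K : set G) (p c : R).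

Lemma lambda_bound_conv p c g f u (X Y : seq G) : lambda_bound p c g ->
  uniq X -> (forall x, x \in X -> gsrc x = u) ->
  uniq Y -> (forall y, y \in Y -> gsrc y = u) ->
  (forall y, gsrc y = u -> f y != 0 -> y \in Y) ->
  \sum_(x <- X) md (conv g f x) `^ p <= c `^ p * \sum_(y <- Y) md (f y) `^ p.
Proof.
move=> gb uX sX uY sY fY; apply: le_trans (gb u X Y f uX uY sX sY).
rewrite big_seq [leRHS]big_seq le_eqVlt; apply/orP; left; apply/eqP.
apply: eq_bigr => x xX; rewrite (@conv_seqr _ _ _ _ _ Y)// => y.
  by move=> yY; rewrite (sX x xX) sY.
by rewrite (sX x xX); exact: fY.
Qed.

Lemma mul_inv_inj u x x' y : gsrc x = u -> gsrc x' = u -> gsrc y = u ->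
  gmul x (ginv y) = gmul x' (ginv y) -> x = x' :> G.
Proof.
move=> sx sx' sy e.
have c1 : gsrc x = gsrc y by rewrite sx sy.
have c2 : gsrc x' = gsrc y by rewrite sx' sy.
by rewrite -(gmulVK c1) -(gmulVK c2) e.
Qed.

Lemma mul_inv_injr u x y y' : gsrc x = u -> gsrc y = u -> gsrc y' = u ->
  gmul x (ginv y) = gmul x (ginv y') -> y = y' :> G.
Proof.
move=> sx sy sy' e.
have c1 : gsrc x = grng (ginv y) by rewrite grng_inv sx.
have c2 : gsrc x = grng (ginv y') by rewrite grng_inv sx.
by rewrite -[y]ginvK -[y']ginvK -(gmulKl c1) -(gmulKl c2) e.
Qed.

Lemma src_mul_inv u x y : gsrc x = u -> gsrc y = u -> gsrc (gmul x (ginv y)) = grng y :> G.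
Proof. by move=> sx sy; rewrite gsrc_mul ?gsrc_inv// grng_inv sx. Qed.

Lemma rng_mul_inv u x y : gsrc x = u -> gsrc y = u -> grng (gmul x (ginv y)) = grng x :> G.
Proof. by move=> sx sy; rewrite grng_mul// grng_inv sx. Qed.

(** On l^1 the operator norm is controlled by column sums. For fixed y the map x |-> xy^-1 is
    injective into the source fibre over r(y), so the source half of [I_bound] bounds each
    column. *)
Lemma I_bound_lambda c f : 0 <= c -> I_bound c f -> lambda_bound 1 c f.
Proof.
move=> c0 fb u X Y xi uX uY sX sY; rewrite powRr1//.
under eq_bigr do rewrite powRr1//.
under [in leRHS]eq_bigr do rewrite powRr1//.
apply: (@le_trans _ _ (\sum_(x <- X) \sum_(y <- Y) md (f (gmul x (ginv y))) * md (xi y))).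
  apply: ler_sum => x _; apply: le_trans (mod_sum _ _) _.
  by apply: ler_sum => y _; rewrite modM.
rewrite exchange_big mulr_sumr big_seq [leRHS]big_seq; apply: ler_sum => y yY.
rewrite -mulr_suml ler_wpM2r//.
have -> : \sum_(x <- X) md (f (gmul x (ginv y))) =
          \sum_(z <- [seq gmul x (ginv y) | x <- X]) md (f z) by rewrite big_map.
have [|+ _] := fb (grng y) [seq gmul x (ginv y) | x <- X].
  rewrite map_inj_in_uniq// => x x' xX x'X.
  by apply: (mul_inv_inj (sX x xX) (sX x' x'X) (sY y yY)).
apply=> _ /mapP[x xX ->]; exact: (src_mul_inv (sX x xX) (sY y yY)).
Qed.

Lemma sum_single (V : zmodType) (I : eqType) (s : seq I) (F : I -> V) i : uniq s ->
  i \in s -> (forall j, j \in s -> F j != 0 -> j = i) -> \sum_(j <- s) F j = F i.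
Proof.
move=> us is_ h; rewrite (bigD1_seq i)//= big1_seq ?addr0// => j /andP[ji js].
by apply/eqP/negPn/negP => /(h j js) e; rewrite e eqxx in ji.
Qed.

Lemma sum_single_le (I : eqType) (s : seq I) (h : I -> R) c : uniq s -> 0 <= c ->
  (forall i, h i <= c) ->
  (forall i j, i \in s -> j \in s -> h i != 0 -> h j != 0 -> i = j) ->
  \sum_(j <- s) h j <= c.
Proof.
move=> us c0 hc h1; have [[i [is_ hi]]|no] := pselect (exists i, i \in s /\ h i != 0).
  by rewrite (sum_single (i := i))// => j js hj; exact: h1.
rewrite big1_seq// => i /= is_; apply/eqP/negPn/negP => hi; apply: no.
by exists i.
Qed.

Lemma mod_sum_single (I : eqType) (s : seq I) (F : I -> C) p : 0 < p -> uniq s ->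
  (forall i j, i \in s -> j \in s -> F i != 0 -> F j != 0 -> i = j) ->
  md (\sum_(j <- s) F j) `^ p = \sum_(j <- s) md (F j) `^ p.
Proof.
move=> p0 us h1; have [[i [is_ hi]]|no] := pselect (exists i, i \in s /\ F i != 0).
  rewrite (sum_single (i := i))//; last by move=> j js hj; exact: h1.
  rewrite (sum_single (i := i))// => j js.
  by rewrite powR_eq0 negb_and mod_eq0 (gt_eqF p0) orbF => hj; exact: h1.
have F0 i : i \in s -> F i = 0.
  by move=> is_; apply/eqP/negPn/negP => hi; apply: no; exists i.
rewrite !big1_seq// ?mod0 ?powR0 ?gt_eqF// => i /= is_.
by rewrite F0// mod0 powR0// gt_eqF.
Qed.

(** Over a bisection the matrix f(xy^-1) has at most one non-zero entry in each row, by injectivity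
    of r, and in each column, by injectivity of s: it is a weighted partial permutation. *)
Lemma lambda_bound_bis p c f B : 1 <= p -> 0 <= c -> bisection B ->
  supp f `<=` B -> (forall x, md (f x) <= c) -> lambda_bound p c f.
Proof.
move=> p1 c0 [ir is_] sB fc u X Y xi uX uY sX sY.
have p0 : 0 < p by lra.
apply: (@le_trans _ _ (\sum_(x <- X) \sum_(y <- Y)
    md (f (gmul x (ginv y))) `^ p * md (xi y) `^ p)).
  rewrite big_seq [leRHS]big_seq; apply: ler_sum => x xX.
  rewrite mod_sum_single//.
    by apply: ler_sum => y _; rewrite modM powRM.
  move=> y y' yY y'Y; rewrite !mulf_eq0 !negb_or => /andP[fy _] /andP[fy' _].
  apply: (mul_inv_injr (sX x xX) (sY y yY) (sY y' y'Y)).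
  apply: ir; rewrite ?inE; [exact: sB|exact: sB|].
  by rewrite (rng_mul_inv (sX x xX) (sY y yY)) (rng_mul_inv (sX x xX) (sY y' y'Y)).
rewrite exchange_big mulr_sumr big_seq [leRHS]big_seq; apply: ler_sum => y yY.
rewrite -mulr_suml ler_wpM2r ?powR_ge0//.
have -> : \sum_(x <- X) md (f (gmul x (ginv y))) `^ p =
          \sum_(z <- [seq gmul x (ginv y) | x <- X]) md (f z) `^ p by rewrite big_map.
have p0' : p != 0 by rewrite gt_eqF.
apply: sum_single_le.
- rewrite map_inj_in_uniq// => x x' xX x'X.
  by apply: (mul_inv_inj (sX x xX) (sX x' x'X) (sY y yY)).
- exact: powR_ge0.
- by move=> z; apply: ge0_ler_powR; rewrite ?nnegrE// ltW.
- move=> _ _ /mapP[x xX ->] /mapP[x' x'X ->].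
  rewrite !powR_eq0 !negb_and !mod_eq0 p0' !orbF => fx fx'.
  apply: is_; rewrite ?inE; [exact: sB|exact: sB|].
  by rewrite (src_mul_inv (sX x xX) (sY y yY)) (src_mul_inv (sX x' x'X) (sY y yY)).
Qed.

Lemma I_bound_bis c f B : 0 <= c -> bisection B ->
  supp f `<=` B -> (forall x, md (f x) <= c) -> I_bound c f.
Proof.
move=> c0 [ir is_] sB fc u X uX; split=> sX.
  apply: sum_single_le => // x y xX yX; rewrite !mod_eq0 => fx fy.
  by apply: is_; rewrite ?inE; [exact: sB|exact: sB|rewrite !sX].
apply: sum_single_le => // x y xX yX; rewrite !mod_eq0 => fx fy.
by apply: ir; rewrite ?inE; [exact: sB|exact: sB|rewrite !sX].
Qed.

(** On the fibre over u the matrix of g is that of f between two diagonal contractions. The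
    diagonals may change with u, which is what cocycles require. *)
Lemma lambda_bound_weight p c f g : 1 <= p -> lambda_bound p c f ->
  (forall u, exists a b : G -> C,
     [/\ forall x, md (a x) <= 1, forall x, md (b x) <= 1 &
      forall x y, gsrc x = u -> gsrc y = u ->
        g (gmul x (ginv y)) = a x * f (gmul x (ginv y)) * b y]) ->
  lambda_bound p c g.
Proof.
move=> p1 fb gf u X Y xi uX uY sX sY.
have p0 : 0 <= p by lra.
have [a [b [a1 b1 gE]]] := gf u.
apply: (@le_trans _ _ (\sum_(x <- X) md (\sum_(y <- Y)
    f (gmul x (ginv y)) * (b y * xi y)) `^ p)).
  rewrite big_seq [leRHS]big_seq; apply: ler_sum => x xX.
  apply: ge0_ler_powR; rewrite ?nnegrE//.
  have -> : \sum_(y <- Y) g (gmul x (ginv y)) * xi y =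
            a x * \sum_(y <- Y) f (gmul x (ginv y)) * (b y * xi y).
    rewrite mulr_sumr big_seq [RHS]big_seq; apply: eq_bigr => y yY.
    by rewrite gE ?(sX x xX) ?(sY y yY)// -!mulrA.
  by rewrite modM ler_piMl.
apply: le_trans (fb u X Y (fun y => b y * xi y) uX uY sX sY) _.
rewrite ler_wpM2l ?powR_ge0//; apply: ler_sum => y _.
by apply: ge0_ler_powR; rewrite ?nnegrE// modM ler_piMl.
Qed.

Lemma I_bound_le c f g : I_bound c f -> (forall x, md (g x) <= md (f x)) -> I_bound c g.
Proof.
move=> fb gf u X uX; have [h1 h2] := fb u X uX; split=> sX.
  by apply: le_trans (h1 sX); exact: ler_sum.
by apply: le_trans (h2 sX); exact: ler_sum.
Qed.

(** Relabelling by phi carries the fibre over u to the fibre over phi(u) and the matrix of f o phi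
    to that of f. *)
Lemma lambda_bound_aut p c f (phi : gaut G) : lambda_bound p c f ->
  lambda_bound p c (f \o gaut_fun phi).
Proof.
move=> fb u X Y xi uX uY sX sY.
pose psi := gaut_fun (phi^-1)%g.
have := fb (gaut_fun phi u) (map (gaut_fun phi) X) (map (gaut_fun phi) Y) (xi \o psi).
rewrite !map_inj_uniq//; try exact: (@gaut_inj G phi).
rewrite !big_map /= => /(_ uX uY).
have -> : \sum_(y <- Y) md (xi (psi (gaut_fun phi y))) `^ p =
          \sum_(y <- Y) md (xi y) `^ p.
  by apply: eq_bigr => y _; rewrite /psi gaut_funVK.
move=> h; apply: le_trans (h _ _).
- rewrite le_eqVlt; apply/orP; left; apply/eqP; rewrite big_seq [RHS]big_seq.
  apply: eq_bigr => x xX; congr (md _ `^ p); rewrite big_map big_seq [RHS]big_seq.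
  apply: eq_bigr => y yY; rewrite /psi gaut_funVK gaut_mul ?gaut_inv//.
  by rewrite grng_inv (sX x xX) (sY y yY).
- by move=> _ /mapP[x xX ->]; rewrite gaut_src sX.
- by move=> _ /mapP[x xX ->]; rewrite gaut_src sY.
Qed.

Lemma I_bound_aut c f (phi : gaut G) : I_bound c f -> I_bound c (f \o gaut_fun phi).
Proof.
move=> fb u X uX.
have [|h1 h2] := fb (gaut_fun phi u) (map (gaut_fun phi) X).
  by rewrite map_inj_uniq//; exact: (@gaut_inj G phi).
rewrite big_map in h1; rewrite big_map in h2; split=> sX.
  by apply: h1 => _ /mapP[x xX ->]; rewrite gaut_src sX.
by apply: h2 => _ /mapP[x xX ->]; rewrite gaut_rng sX.
Qed.

(** Each instance is an inequality between finite sums, so pointwise convergence of the functions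
    suffices. Injectivity of the passage from [A] to functions rests on this. *)
Lemma lambda_bound_lim p (cn : nat -> R) c (fn : nat -> G -> C) f : 0 < p ->
  (forall n, 0 <= cn n) -> 0 <= c -> cn @ \oo --> c ->
  (forall x, (fun n => md (fn n x - f x)) @ \oo --> (0 : R)) ->
  (forall n, lambda_bound p (cn n) (fn n)) -> lambda_bound p c f.
Proof.
move=> p0 cn0 c0 cnc fnf fb u X Y xi uX uY sX sY.
have c1 : (fun n => \sum_(x <- X) md (\sum_(y <- Y) fn n (gmul x (ginv y)) * xi y) `^ p)
    @ \oo --> \sum_(x <- X) md (\sum_(y <- Y) f (gmul x (ginv y)) * xi y) `^ p.
  apply: (cvg_sum_seq (u := fun n x =>
    md (\sum_(y <- Y) fn n (gmul x (ginv y)) * xi y) `^ p)) => x.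
  apply: (powR_cvg (u := fun n => md (\sum_(y <- Y) fn n (gmul x (ginv y)) * xi y))) => //.
  exact: (mod_lin_cvg (a := fun n y => fn n (gmul x (ginv y)))).
have c2 : (fun n => cn n `^ p * \sum_(y <- Y) md (xi y) `^ p) @ \oo -->
    c `^ p * \sum_(y <- Y) md (xi y) `^ p.
  by apply: cvgM; [exact: powR_cvg|exact: cvg_cst].
apply: (ler_cvg_to c1 c2).
by apply: nearW => n; exact: (fb n u X Y xi uX uY sX sY).
Qed.

Lemma I_bound_lim (cn : nat -> R) c (fn : nat -> G -> C) f :
  cn @ \oo --> c ->
  (forall x, (fun n => md (fn n x - f x)) @ \oo --> (0 : R)) ->
  (forall n, I_bound (cn n) (fn n)) -> I_bound c f.
Proof.
move=> cnc fnf fb u X uX.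
have c1 : (fun n => \sum_(x <- X) md (fn n x)) @ \oo --> \sum_(x <- X) md (f x).
  apply: (cvg_sum_seq (u := fun n x => md (fn n x))) => x.
  by apply: mod_cvg; exact: fnf.
split=> sX; apply: (ler_cvg_to c1 cnc); apply: nearW => n.
  by have [h _] := fb n u X uX; exact: h.
by have [_ h] := fb n u X uX; exact: h.
Qed.

Lemma mod_star f x : md (star f x) = md (f (ginv x)).
Proof. exact: mod_conj. Qed.

Lemma kind_bound_bis k c f B : admissible k -> 0 <= c -> bisection B ->
  supp f `<=` B -> (forall x, md (f x) <= c) -> kind_bound k c f.
Proof.
case: k => [_|p [p1 _]|p [p1 _]] c0 bB sB fc /=.
- exact: (I_bound_bis c0 bB).
- exact: (lambda_bound_bis p1 c0 bB).
- split; first exact: (lambda_bound_bis p1 c0 bB).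
  apply: (lambda_bound_bis (B := ginv @^-1` B) p1 c0).
  + case: bB => ir is_; split=> x y; rewrite !inE => Bx By e.
      by rewrite -[x]ginvK -[y]ginvK; congr ginv; apply: is_; rewrite ?inE// !gsrc_inv.
    by rewrite -[x]ginvK -[y]ginvK; congr ginv; apply: ir; rewrite ?inE// !grng_inv.
  + by move=> x; rewrite /supp /= -mod_eq0 mod_star mod_eq0; exact: sB.
  + by move=> x; rewrite mod_star.
Qed.

Lemma kind_bound_weight k c f (d : G -> C) : admissible k ->
  (forall x, md (d x) <= 1) -> kind_bound k c f ->
  kind_bound k c (fun x => d (grng x) * f x).
Proof.
have one1 (x : G) : md (1 : C) <= 1 by rewrite mod1.
case: k => [_|p [p1 _]|p [p1 _]] d1 /=.
- move=> fb; apply: (I_bound_le fb) => x.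
  by rewrite modM ler_piMl.
- move=> fb; apply: (lambda_bound_weight p1 fb) => u.
  exists (fun x => d (grng x)), (fun=> 1); split=> // x y sx sy.
  by rewrite mulr1 (rng_mul_inv sx sy).
- move=> [fb fb']; split.
    apply: (lambda_bound_weight p1 fb) => u.
    exists (fun x => d (grng x)), (fun=> 1); split=> // x y sx sy.
    by rewrite mulr1 (rng_mul_inv sx sy).
  (* Under [star] a weight on the range becomes the conjugate weight on the source, so it now sits
     on the right of the matrix. *)
  apply: (lambda_bound_weight p1 fb') => u.
  exists (fun=> 1), (fun x => (d (grng x))^*); split=> // [x|x y sx sy].
    by rewrite mod_conj.
  by rewrite mul1r /star grng_inv (src_mul_inv sx sy) rmorphM mulrC.
Qed.

Lemma coc_unit (xi : cocycle R G) u : units u -> xi u = 1.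
Proof.
move=> uu; have [_ _ m] := cocP xi.
have uE : gmul u u = u by rewrite -{2}uu gmul_src.
have := m u u; rewrite uu unit_rng// uE => /(_ erefl) e.
by apply: (mulfI (coc_neq0 xi u)); rewrite -e mulr1.
Qed.

Lemma coc_inv (xi : cocycle R G) x : xi (ginv x) = (xi x)^*.
Proof.
have [_ n m] := cocP xi.
apply: (mulfI (coc_neq0 xi x)); rewrite -m ?grng_inv// gmul_inv coc_unit; last exact: grng_unit.
by rewrite -normCK n expr1n.
Qed.

Lemma star_coc (xi : cocycle R G) f x : star (fun x => xi x * f x) x = xi x * star f x.
Proof. by rewrite /star coc_inv rmorphM /= conjCK. Qed.

(** On a single source fibre a cocycle looks like a coboundary, xi(xy^-1) = xi(x) conj(xi(y)), so it
    acts by conjugation with a diagonal of modulus 1. *)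
Lemma kind_bound_coc k c f (xi : cocycle R G) : admissible k -> kind_bound k c f ->
  kind_bound k c (fun x => xi x * f x).
Proof.
have xi1 x : md (xi x) <= 1.
  by have [_ n _] := cocP xi; have /norm_mod1 -> := n x.
have W p g : 1 <= p -> lambda_bound p c g -> lambda_bound p c (fun x => xi x * g x).
  move=> p1 gb; apply: (lambda_bound_weight p1 gb) => u.
  exists xi, (fun y => (xi y)^*); split=> // [x|x y sx sy]; first by rewrite mod_conj.
  have [_ _ m] := cocP xi.
  by rewrite m ?grng_inv ?sx ?sy// coc_inv mulrAC.
case: k => [_|p [p1 _]|p [p1 _]] /=.
- move=> fb; apply: (I_bound_le fb) => x.
  by rewrite modM ler_piMl.
- exact: W.
- move=> [fb fb']; split; first exact: W.
  by rewrite (funext (star_coc xi f)); exact: W.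
Qed.

Lemma kind_bound_aut k c f (phi : gaut G) : kind_bound k c f ->
  kind_bound k c (f \o gaut_fun phi).
Proof.
case: k => [|p|p] /=; first exact: I_bound_aut; first exact: lambda_bound_aut.
move=> [fb fb']; split; first exact: lambda_bound_aut.
have -> : star (f \o gaut_fun phi) = star f \o gaut_fun phi.
  by apply/funext => x; rewrite /star /= gaut_inv.
exact: lambda_bound_aut.
Qed.

Lemma kind_bound_lim k (cn : nat -> R) c (fn : nat -> G -> C) f : admissible k ->
  (forall n, 0 <= cn n) -> 0 <= c -> cn @ \oo --> c ->
  (forall x, (fun n => md (fn n x - f x)) @ \oo --> (0 : R)) ->
  (forall n, kind_bound k (cn n) (fn n)) -> kind_bound k c f.
Proof.
move=> ak cn0 c0 cnc fnf; case: k ak => [_|p [p1 _]|p [p1 _]] /=.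
- exact: I_bound_lim.
- by apply: lambda_bound_lim => //; lra.
- move=> h; have p0 : 0 < p by lra.
  split.
    by apply: (lambda_bound_lim p0 cn0 c0 cnc fnf) => n; case: (h n).
  have fnf' x : (fun n => md (star (fn n) x - star f x)) @ \oo --> (0 : R).
    have E n : md (star (fn n) x - star f x) = md (fn n (ginv x) - f (ginv x)).
      by rewrite /star -rmorphB mod_conj.
    by rewrite (funext E).
  by apply: (lambda_bound_lim p0 cn0 c0 cnc fnf') => n; case: (h n).
Qed.

(* The I-norm dominates the operator norm on l^1. *)
Definition kind_exp (k : algebra_kind R) : R :=
  match k with alg_LI => 1 | alg_Fp p => p | alg_Fpstar p => p end.

Lemma kind_exp_ge1 k : admissible k -> 1 <= kind_exp k.
Proof. by case: k => //= p []. Qed.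
Lemma kind_exp_neq2 k : admissible k -> kind_exp k != 2.
Proof.
case: k => [_|p []|p []] //=.
by rewrite lt_eqF// ltr1n.
Qed.

Lemma kind_bound_lambda k c f : 0 <= c -> kind_bound k c f ->
  lambda_bound (kind_exp k) c f.
Proof. by case: k => [|p|p] c0 //=; [exact: I_bound_lambda|case]. Qed.

Lemma kind_norm_leP k c f : admissible k -> is_Cc f -> 0 <= c ->
  (kind_norm k f <= c%:E)%E <-> kind_bound k c f.
Proof.
case: k => [_|p [p1 _]|p [p1 _]] cf c0 /=.
- exact: Inorm_leP.
- exact: Fpnorm_leP.
- rewrite ge_max; split.
    move=> /andP[/(Fpnorm_leP hG aG cf p1 c0) h1].
    by move=> /(Fpnorm_leP hG aG (Cc_star hG cf) p1 c0).
  move=> [h1 h2]; apply/andP; split; first exact/(Fpnorm_leP hG aG cf p1 c0).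
  exact/(Fpnorm_leP hG aG (Cc_star hG cf) p1 c0).
Qed.

End BoundLemmas.

(** * The norm as a real number, and bilinearity of the product *)

Section Norm.
Variables (R : realType) (A : banachAlg (Cplx R)).
Local Notation C := (Cplx R).
Local Notation md := (@modulus R).
Local Notation "a ** b" := (ba_mul a b) (at level 40, left associativity).

Definition nrm (a : A) : R := complex.Re `|a|.

Lemma nrm_ge0 a : 0 <= nrm a.
Proof. by have := Re_le (normr_ge0 a). Qed.

Lemma nrmE a : `|a| = real_complex R (nrm a) :> C.
Proof. by apply: Re_eq; exact: normr_ge0. Qed.

Lemma nrmD a b : nrm (a + b) <= nrm a + nrm b.
Proof. by rewrite /nrm -ReD; apply: Re_le; exact: ler_normD. Qed.
Lemma nrmN a : nrm (- a) = nrm a. Proof. by rewrite /nrm normrN. Qed.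
Lemma nrmB a b : nrm (a - b) = nrm (b - a). Proof. by rewrite -nrmN opprB. Qed.
Lemma nrm0 : nrm 0 = 0. Proof. by rewrite /nrm normr0. Qed.
Lemma nrm_eq0 a : nrm a = 0 -> a = 0.
Proof. by move=> h; apply/eqP; rewrite -normr_eq0 nrmE h. Qed.
Lemma nrmZ c a : nrm (c *: a) = md c * nrm a.
Proof. by rewrite /nrm normrZ ReM_ge0. Qed.
Lemma nrmM a b : nrm (a ** b) <= nrm a * nrm b.
Proof. by rewrite /nrm -ReM_ge0//; apply: Re_le; exact: ba_norm_mul. Qed.
Lemma nrm_tri a b c : nrm (a - c) <= nrm (a - b) + nrm (b - c).
Proof. by apply: le_trans (nrmD _ _); rewrite addrA subrK. Qed.

Implicit Types (a b d : A).

Lemma ba_mulDl a b d : (a + b) ** d = a ** d + b ** d.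
Proof. by have := ba_mul_linearl 1 a b d; rewrite !scale1r. Qed.
Lemma ba_mulDr a b d : d ** (a + b) = d ** a + d ** b.
Proof. by have := ba_mul_linearr 1 a b d; rewrite !scale1r. Qed.
Lemma ba_mul0l d : (0 : A) ** d = 0.
Proof. by apply: (addrI (0 ** d)); rewrite -ba_mulDl !addr0. Qed.
Lemma ba_mul0r d : d ** (0 : A) = 0.
Proof. by apply: (addrI (d ** 0)); rewrite -ba_mulDr !addr0. Qed.
Lemma ba_mulZl c a d : (c *: a) ** d = c *: (a ** d).
Proof. by have := ba_mul_linearl c a 0 d; rewrite ba_mul0l !addr0. Qed.
Lemma ba_mulZr c a d : d ** (c *: a) = c *: (d ** a).
Proof. by have := ba_mul_linearr c a 0 d; rewrite ba_mul0r !addr0. Qed.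
Lemma ba_mulNl a d : (- a) ** d = - (a ** d).
Proof. by rewrite -scaleN1r ba_mulZl scaleN1r. Qed.
Lemma ba_mulNr a d : d ** (- a) = - (d ** a).
Proof. by rewrite -scaleN1r ba_mulZr scaleN1r. Qed.
Lemma ba_mulBl a b d : (a - b) ** d = a ** d - b ** d.
Proof. by rewrite ba_mulDl ba_mulNl. Qed.
Lemma ba_mulBr a b d : d ** (a - b) = d ** a - d ** b.
Proof. by rewrite ba_mulDr ba_mulNr. Qed.

End Norm.
#[global] Hint Extern 0 (is_true (@Order.le _ _ _ (nrm _))) => exact: nrm_ge0 : core.

(** * The algebra as an algebra of functions *)

Section Algebra.
Variables (R : realType) (G : groupoid).
Hypotheses (hG : hausdorff_space G) (aG : ample G).
Variables (k : algebra_kind R) (hk : admissible k).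
Variables (A : banachAlg (Cplx R)) (iota : (G -> Cplx R) -> A).
Hypothesis hA : is_completion k iota.
Local Notation C := (Cplx R).
Local Notation md := (@modulus R).
Local Notation "a ** b" := (ba_mul a b) (at level 40, left associativity).
Local Notation p := (kind_exp k).
Implicit Types (f g : G -> C) (a b : A) (B K : set G).

Lemma p_ge1 : 1 <= p. Proof. exact: kind_exp_ge1. Qed.
Lemma p_gt0 : 0 < p. Proof. exact: lt_le_trans p_ge1. Qed.
Lemma p_neq0 : p != 0. Proof. by rewrite gt_eqF// p_gt0. Qed.

Lemma iota_lin c f g : is_Cc f -> is_Cc g ->
  iota (fun x => c * f x + g x) = c *: iota f + iota g.
Proof. by case: hA => h _ _ _; exact: h. Qed.

Lemma iota_conv f g : is_Cc f -> is_Cc g -> iota (conv f g) = iota f ** iota g.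
Proof. by case: hA => _ h _ _; exact: h. Qed.

Lemma iotaD f g : is_Cc f -> is_Cc g -> iota (fun x => f x + g x) = iota f + iota g.
Proof.
move=> cf cg; have := iota_lin 1 cf cg; rewrite scale1r => <-.
by congr iota; apply/funext => x; rewrite mul1r.
Qed.

Lemma iota0 : iota (fun=> 0) = 0.
Proof.
have c0 := @Cc0 R G hG; have := iotaD c0 c0.
have -> : (fun x : G => (0 : C) + 0) = fun=> 0 by apply/funext => x; rewrite addr0.
by move=> h; apply: (addrI (iota (fun=> 0))); rewrite addr0 -h.
Qed.

Lemma CcB f g : is_Cc f -> is_Cc g -> is_Cc (fun x => f x - g x).
Proof.
move=> cf cg; have := Cc_lin hG (-1) cg cf.
by congr is_Cc; apply/funext => x; rewrite mulN1r addrC.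
Qed.

Lemma iotaB f g : is_Cc f -> is_Cc g -> iota (fun x => f x - g x) = iota f - iota g.
Proof.
move=> cf cg; have := iota_lin (-1) cg cf; rewrite scaleN1r addrC => <-.
by congr iota; apply/funext => x; rewrite mulN1r addrC.
Qed.

Lemma nrm_iota f c : is_Cc f -> 0 <= c -> (nrm (iota f) <= c) <-> kind_bound k c f.
Proof.
move=> cf c0; rewrite -(kind_norm_leP hG aG hk cf c0).
by case: hA => _ _ h _; rewrite -h// lee_fin.
Qed.

Lemma bound_iota f : is_Cc f -> kind_bound k (nrm (iota f)) f.
Proof. by move=> cf; apply/nrm_iota. Qed.

Lemma lambda_iota f : is_Cc f -> lambda_bound p (nrm (iota f)) f.
Proof. by move=> cf; apply: kind_bound_lambda => //; exact: bound_iota. Qed.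

Lemma iota_dense a (e : R) : 0 < e -> exists f, is_Cc f /\ nrm (iota f - a) < e.
Proof.
move=> e0; have [_ _ _ d] := hA.
have : closure (iota @` [set f | is_Cc f]) a by rewrite d.
move=> /(_ (ball a (real_complex R e))).
have e0' : 0 < real_complex R e :> C by rewrite -(rmorph0 (real_complex R)) ltcR.
case; first exact: nbhsx_ballx.
move=> _ [[f /= cf <-]]; rewrite -ball_normE /ball_ /= nrmE ltcR nrmB => h.
by exists f.
Qed.

Lemma iota_seq a : exists fn : nat -> G -> C,
  (forall n, is_Cc (fn n)) /\ (fun n => nrm (iota (fn n) - a)) @ \oo --> (0 : R).
Proof.
have /choice[fn fP] n : exists f, is_Cc f /\ nrm (iota f - a) < n.+1%:R^-1.
  by apply: iota_dense; rewrite invr_gt0 ltr0n.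
exists fn; split=> [n|]; first by case: (fP n).
apply: (@squeeze_dist0 _ _ (fun n => n.+1%:R^-1)); last exact: cvg_harmonic.
by move=> n; rewrite subr0 ger0_norm//; have [_ /ltW] := fP n.
Qed.

Lemma nrm_dist a b : `|nrm a - nrm b| <= nrm (a - b).
Proof.
rewrite ler_norml; apply/andP; split.
  by rewrite lerNl opprB lerBlDr -(nrmB b a) -[X in nrm X <= _](subrK a); exact: nrmD.
by rewrite lerBlDr -[X in nrm X <= _](subrK b); exact: nrmD.
Qed.

Lemma nrm_cvg (u : nat -> A) a : (fun n => nrm (u n - a)) @ \oo --> (0 : R) ->
  (fun n => nrm (u n)) @ \oo --> nrm a.
Proof. by apply: squeeze_dist0 => n; exact: nrm_dist. Qed.

Lemma ginv_unit (u : G) : units u -> ginv u = u.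
Proof. by move=> uu; rewrite -[LHS]gmul_src gsrc_inv unit_rng// gmul_invl. Qed.

(** The value f(x) is the matrix entry at row x and column s(x), so the one-by-one section of the
    matrix already bounds it. *)
Lemma mod_le_nrm f x : is_Cc f -> md (f x) <= nrm (iota f).
Proof.
move=> cf; have := lambda_iota cf (u := gsrc x) (X := [:: x]) (Y := [:: gsrc x]) (fun=> 1).
rewrite !big_seq1 mulr1 mod1 powR1 mulr1 => h.
have gs : ginv (gsrc x) = gsrc x.
  by apply: ginv_unit; exact: gsrc_unit.
rewrite gs gmul_src in h.
rewrite leNgt; apply/negP => lt.
have : nrm (iota f) `^ p < md (f x) `^ p by apply: gt0_ltr_powR; rewrite ?nnegrE// p_gt0.
rewrite ltNge h// => y; rewrite inE => /eqP ->//; exact: gsrc_src.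
Qed.

(** * Elements of the completion as functions on the groupoid *)

Fact jf_key : unit. Proof. exact: tt. Qed.

(* The limit of f x as iota f tends to a. *)
Definition jf : A -> G -> C := locked_with jf_key (fun a x =>
  xget 0 [set z : C | forall f, is_Cc f -> md (f x - z) <= nrm (iota f - a)]).

(** The lower bounds T(f(x)) - |f - a| never exceed the upper bounds T(g(x)) + |g - a|, so the
    supremum of the former lies in all the intervals. T will be the real and the imaginary part. *)
Lemma jf_part (T : C -> R) a x : (forall z w, T (z - w) = T z - T w) ->
  (forall z, `|T z| <= md z) ->
  exists r, forall f, is_Cc f -> `|T (f x) - r| <= nrm (iota f - a).
Proof.
move=> TB Tm; pose S := [set r | exists2 f, is_Cc f & r = T (f x) - nrm (iota f - a)].
have cross f g : is_Cc f -> is_Cc g ->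
    T (f x) - nrm (iota f - a) <= T (g x) + nrm (iota g - a).
  move=> cf cg; rewrite lerBlDr -addrA -lerBlDl -TB.
  apply: le_trans (ler_norm _) _; apply: le_trans (Tm _) _.
  have := mod_le_nrm x (CcB cf cg); rewrite (iotaB cf cg) => /le_trans; apply.
  by rewrite addrC (nrmB (iota g)); exact: nrm_tri.
have S0 : S !=set0.
  by exists (T 0 - nrm (iota (fun=> 0) - a)), (fun=> 0) => //; exact: Cc0.
have ub g : is_Cc g -> ubound S (T (g x) + nrm (iota g - a)).
  by move=> cg _ [f cf ->]; exact: cross.
have hS : has_sup S.
  by split=> //; exists (T 0 + nrm (iota (fun=> 0) - a)); apply: (ub (fun=> 0)); exact: Cc0.
exists (sup S) => f cf; rewrite ler_norml; apply/andP; split.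
  by rewrite lerNl opprB lerBlDl; apply: ge_sup => //; exact: ub.
rewrite lerBlDl -lerBlDr; apply: sup_upper_bound => //.
by exists f.
Qed.

Lemma jfP a x f : is_Cc f -> md (f x - jf a x) <= nrm (iota f - a).
Proof.
suff [z zP] : exists z : C, forall f, is_Cc f -> md (f x - z) <= nrm (iota f - a).
  by rewrite /jf unlock; case: xgetP => [w _ h|/(_ z)]; [exact: h|case].
have ReB (z w : C) : complex.Re (z - w) = complex.Re z - complex.Re w.
  by case: z w => [? ?] [? ?].
have ImB (z w : C) : complex.Im (z - w) = complex.Im z - complex.Im w.
  by case: z w => [? ?] [? ?].
have [r rP] := jf_part a x ReB (@Re_mod R).
have [s sP] := jf_part a x ImB (@Im_mod R).
exists (complex.Complex r s : C) => {}f cf.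
have h g : is_Cc g -> md (g x - (complex.Complex r s : C)) <= 2 * nrm (iota g - a).
  move=> cg; apply: le_trans (mod_Re_Im _) _; rewrite ReB ImB /=.
  by rewrite mulr_natl mulr2n lerD// ?rP ?sP.
(* Putting real and imaginary parts together cost a factor 2. It is harmless for a g within e/3 of
   a, and comparing f with this g restores the constant 1. *)
apply/ler_addgt0Pr => e e0; have e30 : 0 < e / 3 by lra.
have [g [cg ga]] := iota_dense a e30.
have h1 : md (f x - (complex.Complex r s : C)) <=
    md (f x - g x) + md (g x - (complex.Complex r s : C)).
  by apply: le_trans (modD _ _); rewrite addrA subrK.
have := mod_le_nrm x (CcB cf cg); rewrite (iotaB cf cg) => h2.
have h3 := nrm_tri (iota f) a (iota g).
have := h g cg; rewrite (nrmB a) in h3; lra.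
Qed.

Lemma jf_lip a b x : md (jf a x - jf b x) <= nrm (a - b).
Proof.
apply/ler_addgt0Pr => e e0; have e30 : 0 < e / 2 by lra.
have [g [cg ga]] := iota_dense a e30.
have h1 := jfP a x cg; have h2 := jfP b x cg.
have : md (jf a x - jf b x) <= md (jf a x - g x) + md (g x - jf b x).
  by apply: le_trans (modD _ _); rewrite addrA subrK.
have := nrm_tri (iota g) a b; rewrite (modB (jf a x) (g x)); lra.
Qed.

Lemma jf_iota f : is_Cc f -> jf (iota f) = f.
Proof.
move=> cf; apply/funext => x; apply/esym/eqP; rewrite -subr_eq0 -mod_eq0 eq_le.
by rewrite mod_ge0 andbT -(nrm0 A) -(subrr (iota f)); exact: jfP.
Qed.

Lemma mod_le_eq (z w : C) : (forall e : R, 0 < e -> md (z - w) <= e) -> z = w.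
Proof.
move=> h; apply/eqP; rewrite -subr_eq0 -mod_eq0 eq_le mod_ge0 andbT.
by apply/ler_addgt0Pr => e e0; rewrite add0r; exact: h.
Qed.

(** Two Lipschitz scalar functions on [A] that agree on the dense image of C_c are equal. This
    carries pointwise formulas from C_c to all of [A], one argument at a time. *)
Lemma dense_eq (T1 T2 : A -> C) (k1 k2 : R) : 0 <= k1 -> 0 <= k2 ->
  (forall a b, md (T1 a - T1 b) <= k1 * nrm (a - b)) ->
  (forall a b, md (T2 a - T2 b) <= k2 * nrm (a - b)) ->
  (forall f, is_Cc f -> T1 (iota f) = T2 (iota f)) -> forall a, T1 a = T2 a.
Proof.
move=> k10 k20 l1 l2 e12 a; apply: mod_le_eq => e e0.
have K0 : 0 < 1 + k1 + k2 by lra.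
have d0 : 0 < e / (1 + k1 + k2) by rewrite divr_gt0.
have [f [cf fa]] := iota_dense a d0.
have h : md (T1 a - T2 a) <= md (T1 a - T1 (iota f)) + md (T2 (iota f) - T2 a).
  by apply: le_trans (modD _ _); rewrite e12// addrA subrK.
apply: le_trans h _; apply: le_trans (lerD (l1 _ _) (l2 _ _)) _.
rewrite (nrmB a) -mulrDl; move: fa; rewrite ltr_pdivlMr// => fa.
apply: le_trans (ltW fa); rewrite mulrC ler_wpM2l//; lra.
Qed.

Lemma jf_lin c a b x : jf (c *: a + b) x = c * jf a x + jf b x.
Proof.
have h g : is_Cc g -> jf (c *: a + iota g) x = c * jf a x + jf (iota g) x.
  move=> cg; move: a; apply: (@dense_eq (fun a => jf (c *: a + iota g) x)
    (fun a => c * jf a x + jf (iota g) x) (md c) (md c)) => //.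
  - move=> a b'; apply: le_trans (jf_lip _ _ _) _.
    by rewrite opprD addrACA subrr addr0 -scalerBr nrmZ.
  - move=> a b'; rewrite opprD addrACA subrr addr0 -mulrBr modM.
    by rewrite ler_wpM2l//; exact: jf_lip.
  - move=> f cf; rewrite -iota_lin// !jf_iota//; exact: Cc_lin.
move: b; apply: (@dense_eq (fun b => jf (c *: a + b) x)
    (fun b => c * jf a x + jf b x) 1 1) => //.
- by move=> b b'; rewrite mul1r; apply: le_trans (jf_lip _ _ _) _;
    rewrite opprD addrACA subrr add0r.
- by move=> b b'; rewrite mul1r opprD addrACA subrr add0r; exact: jf_lip.
Qed.

Lemma jfD a b x : jf (a + b) x = jf a x + jf b x.
Proof. by have := jf_lin 1 a b x; rewrite scale1r mul1r. Qed.
Lemma jf0 x : jf 0 x = 0.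
Proof. by rewrite -iota0 jf_iota//; exact: Cc0. Qed.
Lemma jfZ c a x : jf (c *: a) x = c * jf a x.
Proof. by have := jf_lin c a 0 x; rewrite jf0 !addr0. Qed.
Lemma jfN a x : jf (- a) x = - jf a x.
Proof. by rewrite -scaleN1r jfZ mulN1r. Qed.
Lemma jfB a b x : jf (a - b) x = jf a x - jf b x.
Proof. by rewrite jfD jfN. Qed.

Lemma jf_le a x : md (jf a x) <= nrm a.
Proof. by have := jf_lip a 0 x; rewrite jf0 !subr0. Qed.

(** Let d have zero function and let g_n in C_c tend to d. For f in C_c, f - g_n tends pointwise to
    f while its norm tends to that of f - d; bounds pass to pointwise limits, so |f| <= |f - d|.
    Letting f approach d gives d = 0. *)
Lemma jf_inj : injective jf.
Proof.
move=> a b ab; apply/eqP; rewrite -subr_eq0; apply/eqP; apply: nrm_eq0.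
have d0 x : jf (a - b) x = 0 by rewrite jfB ab subrr.
move: (a - b) d0 => {a b ab} d d0.
have [gn [cg gd]] := iota_seq d.
have key f : is_Cc f -> nrm (iota f) <= nrm (iota f - d).
  move=> cf; apply/(nrm_iota cf) => //.
  apply: (@kind_bound_lim _ _ _ (fun n => nrm (iota f - iota (gn n))) _
    (fun n x => f x - gn n x)) => //.
  - apply: nrm_cvg; apply: squeeze_dist0 gd => n.
    by rewrite subr0 ger0_norm// opprB [_ + (d - _)]addrC addrA subrK nrmB.
  - move=> x; apply: squeeze_dist0 gd => n.
    rewrite subr0 ger0_norm// addrAC subrr add0r modN -[gn n x]subr0 -(d0 x).
    exact: jfP.
  - by move=> n; rewrite -iotaB//; apply: bound_iota; exact: CcB.
apply/eqP; rewrite eq_le nrm_ge0 andbT; apply/ler_addgt0Pr => e e0.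
have e30 : 0 < e / 2 by lra.
have [f [cf fd]] := iota_dense d e30.
have := key f cf; have := nrmD (d - iota f) (iota f); rewrite subrK (nrmB d); lra.
Qed.

Lemma jf_continuous a : continuous (jf a).
Proof.
move=> x; apply/cvgrPdist_lt => e e0.
have [r r0 er] : exists2 r : R, 0 < r & e = real_complex R r.
  have eE := Re_eq (ltW e0); exists (complex.Re e) => //.
  by move: e0; rewrite eE -(rmorph0 (real_complex R)) ltcR.
have r30 : 0 < r / 3 by lra.
have [f [cf fa]] := iota_dense a r30.
have [cf' _] := cf.
have e30 : 0 < real_complex R (r / 3) :> C by rewrite -(rmorph0 (real_complex R)) ltcR.
have := @cvgr_dist_lt _ _ _ _ (nbhs_filter x) f (f x) (cf' x) _ e30.
apply: filterS => y; rewrite er !modE !ltcR => h.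
have h1 := jfP a x cf; have h2 := jfP a y cf.
have h3 : md (jf a x - jf a y) <= md (jf a x - f x) + md (f x - jf a y).
  by apply: le_trans (modD _ _); rewrite addrA subrK.
have h4 : md (f x - jf a y) <= md (f x - f y) + md (f y - jf a y).
  by apply: le_trans (modD _ _); rewrite addrA subrK.
rewrite (modB (jf a x) (f x)) in h3; lra.
Qed.

Lemma jf_C0 a : is_C0 (jf a).
Proof.
split; first exact: jf_continuous.
move=> e e0; have [f [cf fa]] := iota_dense a e0.
have [K [cK fK]] := Cc_bound cf; exists K; split=> // x nK.
have fx0 : f x = 0 by apply/eqP/negPn/negP => /fK.
have := jfP a x cf; rewrite fx0 sub0r modN => /le_lt_trans; exact.
Qed.

Lemma jf_inclusion : is_C0_inclusion iota jf.
Proof.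
split.
- exact: jf_lin.
- exact: jf_C0.
- by move=> a x; rewrite modE nrmE lecR jf_le.
- exact: jf_inj.
- exact: jf_iota.
Qed.

(** Products in [A] are not given by a sum, but when one factor is carried by a bisection the
    one-term formula is Lipschitz in the other factor and extends by density. *)
Lemma jmulL B f a (x b : G) : cobisection B -> is_Cc f -> supp f `<=` B -> B b ->
  grng b = grng x -> jf (iota f ** a) x = f b * jf a (gmul (ginv b) x).
Proof.
move=> hB cf sB Bb rb; move: a.
apply: (@dense_eq (fun a => jf (iota f ** a) x) (fun a => f b * jf a (gmul (ginv b) x))
  (nrm (iota f)) (md (f b))) => //.
- move=> a c; apply: le_trans (jf_lip _ _ _) _; rewrite -ba_mulBr; exact: nrmM.
- by move=> a c; rewrite -mulrBr modM ler_wpM2l//; exact: jf_lip.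
- move=> g cg; rewrite -iota_conv// !jf_iota//; last exact: Cc_conv.
  exact: (conv_bisl g hB).
Qed.

Lemma jmulL0 B f a (x : G) : is_Cc f -> supp f `<=` B -> (forall b : G, B b -> grng b <> grng x) ->
  jf (iota f ** a) x = 0.
Proof.
move=> cf sB h; move: a.
apply: (@dense_eq (fun a => jf (iota f ** a) x) (fun a => 0) (nrm (iota f)) 0) => //.
- move=> a c; apply: le_trans (jf_lip _ _ _) _; rewrite -ba_mulBr; exact: nrmM.
- by move=> a c; rewrite subrr mod0 mul0r.
- move=> g cg; rewrite -iota_conv// jf_iota//; last exact: Cc_conv.
  exact: (conv_bisl0 g sB).
Qed.

Lemma jmulR B f a (x b : G) : cobisection B -> is_Cc f -> supp f `<=` B -> B b ->
  gsrc b = gsrc x -> jf (a ** iota f) x = jf a (gmul x (ginv b)) * f b.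
Proof.
move=> hB cf sB Bb rb; move: a.
apply: (@dense_eq (fun a => jf (a ** iota f) x) (fun a => jf a (gmul x (ginv b)) * f b)
  (nrm (iota f)) (md (f b))) => //.
- move=> a c; apply: le_trans (jf_lip _ _ _) _; rewrite -ba_mulBl mulrC; exact: nrmM.
- by move=> a c; rewrite -mulrBl modM mulrC ler_wpM2l//; exact: jf_lip.
- move=> g cg; rewrite -iota_conv// !jf_iota//; last exact: Cc_conv.
  exact: (conv_bisr g hB).
Qed.

Lemma jmulR0 B f a (x : G) : is_Cc f -> supp f `<=` B -> (forall b : G, B b -> gsrc b <> gsrc x) ->
  jf (a ** iota f) x = 0.
Proof.
move=> cf sB h; move: a.
apply: (@dense_eq (fun a => jf (a ** iota f) x) (fun a => 0) (nrm (iota f)) 0) => //.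
- move=> a c; apply: le_trans (jf_lip _ _ _) _; rewrite -ba_mulBl mulrC; exact: nrmM.
- by move=> a c; rewrite subrr mod0 mul0r.
- move=> g cg; rewrite -iota_conv// jf_iota//; last exact: Cc_conv.
  exact: (conv_bisr0 g sB).
Qed.

Lemma diagL d K a x : compact K -> open K -> K `<=` @units G -> is_Cc d -> supp d `<=` K ->
  jf (iota d ** a) x = d (grng x) * jf a x.
Proof.
move=> cK oK sK cd sd; have hK := cobis_units cK oK sK.
have [Kx|nKx] := pselect (K (grng x)).
  rewrite (@jmulL K _ _ _ (grng x))// ?grng_rng//.
  by rewrite ginv_unit ?gmul_rng//; exact: grng_unit.
rewrite (@jmulL0 K)//; last by move=> b Kb rb; apply: nKx; rewrite -rb unit_rng//; exact: sK.
suff -> : d (grng x) = 0 by rewrite mul0r.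
by apply/eqP/negPn/negP => /sd.
Qed.

Lemma diagR d K a x : compact K -> open K -> K `<=` @units G -> is_Cc d -> supp d `<=` K ->
  jf (a ** iota d) x = jf a x * d (gsrc x).
Proof.
move=> cK oK sK cd sd; have hK := cobis_units cK oK sK.
have [Kx|nKx] := pselect (K (gsrc x)).
  rewrite (@jmulR K _ _ _ (gsrc x))// ?gsrc_src//.
  by rewrite ginv_unit ?gmul_src//; exact: gsrc_unit.
rewrite (@jmulR0 K)//; last by move=> b Kb rb; apply: nKx; rewrite -rb (sK b).
suff -> : d (gsrc x) = 0 by rewrite mulr0.
by apply/eqP/negPn/negP => /sd.
Qed.

(** * Compact open sets of units and local units *)

Definition cou K := [/\ compact K, open K & K `<=` @units G].

Lemma cou_cobis K : cou K -> cobisection K.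
Proof. by case; exact: cobis_units. Qed.
Lemma cou_Cc K : cou K -> is_Cc (\1_K : G -> C).
Proof. by case=> cK oK _; exact: Cc_indic. Qed.
Lemma cou_rng B : cobisection B -> cou (grng @` B : set G).
Proof.
move=> hB; have [c o _] := cobis_rng aG hB; split=> // _ [x _ <-]; exact: grng_unit.
Qed.
Lemma cou_src B : cobisection B -> cou (gsrc @` B : set G).
Proof.
move=> hB; have [c o _] := cobis_src aG hB; split=> // _ [x _ <-]; exact: gsrc_unit.
Qed.
Lemma cou_ex (u : G) U : units u -> open U -> U u -> exists K, [/\ cou K, K u & K `<=` U].
Proof.
move=> uu oU Uu; have [||B [hB Bu sB]] := @cobis_ex G aG u (U `&` @units G).
- by apply: openI => //; apply: units_open; case: aG.
- by split.
exists B; split=> //; last by move=> x /sB[].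
by case: hB => cB oB _; split=> // x /sB[].
Qed.

Local Notation one_ K := (iota (\1_K)).

Lemma oneL K a x : cou K -> jf (one_ K ** a) x = \1_K (grng x) * jf a x.
Proof.
move=> hK; have [cK oK sK] := hK; rewrite (@diagL _ K)//; first exact: cou_Cc.
by rewrite supp_indic.
Qed.
Lemma oneR K a x : cou K -> jf (a ** one_ K) x = jf a x * \1_K (gsrc x).
Proof.
move=> hK; have [cK oK sK] := hK; rewrite (@diagR _ K)//; first exact: cou_Cc.
by rewrite supp_indic.
Qed.
Lemma jone K : cobisection K -> jf (one_ K) = \1_K.
Proof. by move=> hK; apply: jf_iota; exact: Cc_cobis. Qed.

Lemma nrm_bis f B (c : R) : is_Cc f -> 0 <= c -> bisection B -> supp f `<=` B ->
  (forall x, md (f x) <= c) -> nrm (iota f) <= c.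
Proof. by move=> cf c0 bB sB fc; apply/nrm_iota => //; exact: (@kind_bound_bis _ _ _ _ _ B). Qed.

Lemma mod_indic K x : md (\1_K x) <= 1.
Proof. by rewrite cindicE; case: asboolP => _; rewrite ?mod1 ?mod0. Qed.

Lemma nrm_one B : cobisection B -> nrm (one_ B) <= 1.
Proof.
move=> hB; apply: (@nrm_bis _ B) => //; first exact: Cc_cobis.
- by case: hB.
- by rewrite supp_indic.
- exact: mod_indic.
Qed.

(** The unit space may fail to be compact, so the indicators of compact open sets of ranges replace
    a unit; these sets are closed under finite unions. *)
Lemma Cc_lunit f : is_Cc f -> exists M, cou M /\ forall x, f x != 0 -> M (grng x).
Proof.
move: f; apply: (Cc_ind hG aG).
- exists set0; split; last by move=> x; rewrite eqxx.
  by split; [exact: compact0|exact: open0|].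
- move=> f g _ _ [M [[cM oM sM] fM]] [N [[cN oN sN] gN]].
  exists (M `|` N); split.
    split; [exact: compactU|exact: openU|].
    by move=> x [/sM|/sN].
  move=> x; have [->|fx _] := eqVneq (f x) 0; last by left; exact: fM.
  by rewrite add0r => gx; right; exact: gN.
- move=> f B cf hB sB; exists (grng @` B); split; first exact: cou_rng.
  by move=> x /sB Bx; exists x.
Qed.

Lemma one_lunit M f : cou M -> is_Cc f -> (forall x, f x != 0 -> M (grng x)) ->
  one_ M ** iota f = iota f.
Proof.
move=> hM cf fM; apply: jf_inj; apply/funext => x; rewrite oneL// jf_iota//.
have [->|fx] := eqVneq (f x) 0; first by rewrite mulr0.
by rewrite indic1 ?mul1r//; exact: fM.
Qed.

(** * Elements of the algebra as vectors on one source fibre *)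

Fact fsum_key : unit. Proof. exact: tt. Qed.

(* The p-th power of the norm of lambda_u(a) applied to the point mass at u. *)
Definition fsum : G -> A -> \bar R := locked_with fsum_key
  (fun u a => (\esum_(x in src_fiber u) (md (jf a x) `^ p)%:E)%E).

Lemma fsumE u a : fsum u a = (\esum_(x in src_fiber u) (md (jf a x) `^ p)%:E)%E.
Proof. by rewrite /fsum unlock. Qed.

Arguments fsum u a%_ring_scope.

Lemma fsum_leP u a (c : R) : (fsum u a <= c%:E)%E <->
  (forall X : seq G, uniq X -> (forall x, x \in X -> gsrc x = u) ->
     \sum_(x <- X) md (jf a x) `^ p <= c).
Proof. by rewrite fsumE; exact: (esum_leP (src_fiber u) (fun x => md (jf a x) `^ p)). Qed.

Lemma fsum_ge0 u a : (0 <= fsum u a)%E.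
Proof. by rewrite fsumE; apply: esum_ge0 => x _; rewrite lee_fin powR_ge0. Qed.

Lemma powr_mod_cvg (an : nat -> A) a x : (fun n => nrm (an n - a)) @ \oo --> (0 : R) ->
  (fun n => md (jf (an n) x) `^ p) @ \oo --> md (jf a x) `^ p.
Proof.
move=> h; apply: (powR_cvg (u := fun n => md (jf (an n) x))) => //; first exact: p_gt0.
apply: (mod_cvg (z := fun n => jf (an n) x)); apply: squeeze_dist0 h => n.
by rewrite subr0 ger0_norm//; exact: jf_lip.
Qed.

Lemma sum_mod_cvg (an : nat -> A) a (X : seq G) :
  (fun n => nrm (an n - a)) @ \oo --> (0 : R) ->
  (fun n => \sum_(x <- X) md (jf (an n) x) `^ p) @ \oo --> \sum_(x <- X) md (jf a x) `^ p.
Proof.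
move=> h; apply: (cvg_sum_seq (u := fun n x => md (jf (an n) x) `^ p)) => x.
exact: powr_mod_cvg.
Qed.

(** For approximants g_n of a in C_c this is the matrix bound applied to the finite column of f;
    both sides converge. *)
Lemma fsum_mul_Cc u a f (c : R) : is_Cc f ->
  (fsum u (iota f) <= c%:E)%E -> (fsum u (a ** iota f) <= (nrm a `^ p * c)%:E)%E.
Proof.
move=> cf fc; apply/fsum_leP => X uX sX.
have [gn [cg ga]] := iota_seq a.
have [Y [uY sY fY]] := Cc_sseq hG aG u cf.
have Yc : \sum_(y <- Y) md (f y) `^ p <= c.
  by have := (fsum_leP u (iota f) c).1 fc Y uY sY; rewrite jf_iota.
have c1 : (fun n => \sum_(x <- X) md (jf (iota (gn n) ** iota f) x) `^ p) @ \oo -->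
    \sum_(x <- X) md (jf (a ** iota f) x) `^ p.
  apply: sum_mod_cvg; apply: (@squeeze_dist0 _ _ (fun n => nrm (iota (gn n) - a) * nrm (iota f))).
    by move=> n; rewrite subr0 ger0_norm// -ba_mulBl; exact: nrmM.
  by rewrite -(mul0r (nrm (iota f))); apply: cvgM; [exact: ga|exact: cvg_cst].
have c2 : (fun n => nrm (iota (gn n)) `^ p * c) @ \oo --> nrm a `^ p * c.
  apply: cvgM; last exact: cvg_cst.
  apply: (powR_cvg (u := fun n => nrm (iota (gn n)))) => //; first exact: p_gt0.
  exact: nrm_cvg.
apply: (ler_cvg_to c1 c2); apply: nearW => n.
rewrite -iota_conv// jf_iota; last exact: Cc_conv.
apply: le_trans (lambda_bound_conv (lambda_iota (cg n)) uX sX uY sY fY) _.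
by rewrite ler_wpM2l ?powR_ge0.
Qed.

Lemma powRp_le1 (t : R) : 0 <= t -> t <= 1 -> t `^ p <= 1.
Proof.
move=> t0 t1; have : t `^ p <= 1 `^ p by apply: ge0_ler_powR; rewrite ?nnegrE ?(ltW p_gt0).
by rewrite powR1.
Qed.

Lemma src_mul_unit u K x : cou K -> K u -> gsrc x = u -> (\1_K (gsrc x) : C) = 1.
Proof. by move=> hK Ku ->; rewrite indic1. Qed.

(** If K is a compact open set of units around u, its indicator is the point mass at u on the fibre
    over u, and multiplying a by it on the right leaves that fibre unchanged. *)
Lemma fsum_le_nrm u a : units u -> (fsum u a <= (nrm a `^ p)%:E)%E.
Proof.
move=> uu; have [K [hK Ku _]] := cou_ex uu (@openT G) I.
have h1 : (fsum u (one_ K) <= 1%:E)%E.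
  apply/fsum_leP => X uX sX; apply: sum_single_le => // [x|x y xX yX].
    rewrite jone; last exact: cou_cobis.
    by apply: powRp_le1 => //; exact: mod_indic.
  rewrite !powR_eq0 !p_neq0 !andbT !mod_eq0 jone; last exact: cou_cobis.
  rewrite !cindicE; do 2![case: asboolP; rewrite ?eqxx//] => Ky Kx _ _.
  have [_ _ sK] := hK.
  by rewrite -(sK x Kx) -(sK y Ky) !sX.
have := fsum_mul_Cc a (cou_Cc hK) h1; rewrite mulr1.
move=> /fsum_leP h; apply/fsum_leP => X uX sX; apply: le_trans (h X uX sX).
rewrite big_seq [leRHS]big_seq; apply: ler_sum => x xX.
by rewrite oneR// (src_mul_unit hK Ku) ?mulr1// sX.
Qed.

Lemma fsum_fin u a : units u -> fsum u a \is a fin_num.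
Proof.
move=> uu; rewrite ge0_fin_numE ?fsum_ge0//.
by apply: le_lt_trans (fsum_le_nrm a uu) _; rewrite ltry.
Qed.

(** A termwise substitute for Minkowski's inequality, from convexity at s/r and t/(1-r) with weights
    r and 1-r. The coefficient of s^p is exactly 1; the price is a factor r^p, which tends to 1, and
    a large coefficient on t^p, which will tend to 0. *)
Lemma weak_minkowski (r s t : R) : 0 < r -> r < 1 -> 0 <= s -> 0 <= t ->
  r `^ p * (s + t) `^ p <= s `^ p + (1 - r)^-1 `^ p * t `^ p.
Proof.
move=> r0 r1 s0 t0; have r'0 : 0 < 1 - r by lra.
have e1 : r * (s / r) = s by rewrite mulrCA mulfV ?gt_eqF// mulr1.
have e2 : (1 - r) * (t / (1 - r)) = t by rewrite mulrCA mulfV ?gt_eqF// mulr1.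
have h' := powR_convex p_ge1 r0 r1 (divr_ge0 s0 (ltW r0)) (divr_ge0 t0 (ltW r'0)).
rewrite e1 e2 in h'.
apply: (@le_trans _ _ (r `^ p * (r * (s / r) `^ p + (1 - r) * (t / (1 - r)) `^ p))).
  by rewrite ler_wpM2l ?powR_ge0.
rewrite mulrDr; apply: lerD.
  have -> : s `^ p = r `^ p * (s / r) `^ p.
    by rewrite -powRM ?divr_ge0 ?(ltW r0)// e1.
  by rewrite ler_wpM2l ?powR_ge0// ler_piMl ?powR_ge0// ltW.
rewrite powRM ?invr_ge0 ?(ltW r'0)//.
rewrite [t `^ p * _]mulrC mulrA; apply: ler_piMl; first by rewrite mulr_ge0 ?powR_ge0.
by rewrite mulr_ile1 ?powR_ge0 ?(ltW r'0)// ?powRp_le1 ?(ltW r0) ?(ltW r1)//; lra.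
Qed.

(** An approximant g_n of b satisfies the bound with c replaced by (c + (1-r)^-p |g_n - b|^p) / r^p.
    First n tends to infinity, then r to 1. *)
Lemma fsum_ext u (T : A -> A) (L kap : R) : units u -> 0 <= kap -> 0 <= L ->
  (forall a b, nrm (T a - T b) <= L * nrm (a - b)) ->
  (forall f (c : R), is_Cc f -> (fsum u (iota f) <= c%:E)%E ->
     (fsum u (T (iota f)) <= (kap * c)%:E)%E) ->
  forall b (c : R), (fsum u b <= c%:E)%E -> (fsum u (T b) <= (kap * c)%:E)%E.
Proof.
move=> uu k0 L0 TL TC b c bc; apply/fsum_leP => X uX sX.
have [gn [cg gb]] := iota_seq b.
have c1 : (fun n => \sum_(x <- X) md (jf (T (iota (gn n))) x) `^ p) @ \oo -->
    \sum_(x <- X) md (jf (T b) x) `^ p.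
  apply: sum_mod_cvg; apply: (@squeeze_dist0 _ _ (fun n => L * nrm (iota (gn n) - b))).
    by move=> n; rewrite subr0 ger0_norm.
  by rewrite -(mulr0 L); apply: cvgM; [exact: cvg_cst|exact: gb].
have key r : 0 < r -> r < 1 ->
    r `^ p * \sum_(x <- X) md (jf (T b) x) `^ p <= kap * c.
  move=> r0 r1.
  have c2 : (fun n => r `^ p * \sum_(x <- X) md (jf (T (iota (gn n))) x) `^ p) @ \oo -->
      r `^ p * \sum_(x <- X) md (jf (T b) x) `^ p.
    by apply: cvgM; [exact: cvg_cst|exact: c1].
  have c3 : (fun n => kap * (c + (1 - r)^-1 `^ p * nrm (iota (gn n) - b) `^ p)) @ \oo -->
      kap * (c + (1 - r)^-1 `^ p * 0).
    apply: cvgM; first exact: cvg_cst.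
    apply: cvgD; first exact: cvg_cst.
    apply: cvgM; first exact: cvg_cst.
    rewrite -(powR0 p_neq0).
    by apply: (powR_cvg (u := fun n => nrm (iota (gn n) - b))) => //; exact: p_gt0.
  rewrite mulr0 addr0 in c3.
  apply: (ler_cvg_to c2 c3); apply: nearW => n.
  set c' := c + _.
  have rp : 0 < r `^ p by exact: powR_gt0.
  have h : (fsum u (iota (gn n)) <= (c' / r `^ p)%:E)%E.
    apply/fsum_leP => Z uZ sZ; rewrite ler_pdivlMr// mulrC.
    rewrite mulr_sumr /c'.
    apply: (@le_trans _ _ (\sum_(x <- Z) (md (jf b x) `^ p +
        (1 - r)^-1 `^ p * md (jf (iota (gn n) - b) x) `^ p))).
      apply: ler_sum => x _; apply: le_trans (weak_minkowski r0 r1 _ _) => //.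
      rewrite ler_wpM2l ?powR_ge0//; apply: ge0_ler_powR; rewrite ?nnegrE ?addr_ge0 ?(ltW p_gt0)//.
      by rewrite jfB; apply: le_trans (modD _ _); rewrite addrC subrK.
    rewrite big_split /= -mulr_sumr; apply: lerD.
      exact: ((fsum_leP u b c).1 bc).
    rewrite ler_wpM2l ?powR_ge0//.
    exact: ((fsum_leP u _ _).1 (fsum_le_nrm (iota (gn n) - b) uu)).
  have := TC (gn n) _ (cg n) h => /fsum_leP/(_ X uX sX).
  by rewrite mulrA ler_pdivlMr// mulrC.
(* The shift by 2 keeps r strictly between 0 and 1 already at n = 0. *)
pose rn n : R := 1 - n.+2%:R^-1.
have rnc : rn @ \oo --> (1 : R).
  rewrite /rn -[X in _ --> X]subr0; apply: cvgB; first exact: cvg_cst.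
  have := @cvg_harmonic R; rewrite -(cvg_shiftS (@harmonic R)); exact.
have c4 : (fun n => rn n `^ p * \sum_(x <- X) md (jf (T b) x) `^ p) @ \oo -->
    1 `^ p * \sum_(x <- X) md (jf (T b) x) `^ p.
  apply: cvgM; last exact: cvg_cst.
  apply: powR_cvg => //; first exact: p_gt0.
  by move=> n; rewrite /rn subr_ge0 invf_le1 ?ltr0n// ler1n.
rewrite powR1 mul1r in c4.
apply: (ler_cvg_to c4 (@cvg_cst _ (kap * c) _ _ _)); apply: nearW => n; apply: key.
  by rewrite /rn subr_gt0 invf_lt1 ?ltr0n// ltr1n.
by rewrite /rn ltrBlDr ltrDl invr_gt0 ltr0n.
Qed.

Lemma fsum_mul u a b (c : R) : units u ->
  (fsum u b <= c%:E)%E -> (fsum u (a ** b) <= (nrm a `^ p * c)%:E)%E.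
Proof.
move=> uu; apply: (@fsum_ext u (fun b => a ** b) (nrm a)) => //; first exact: powR_ge0.
  by move=> x y; rewrite -ba_mulBr; exact: nrmM.
by move=> f d cf; exact: fsum_mul_Cc.
Qed.

Lemma fsum_contr u a b : units u -> nrm a <= 1 -> (fsum u (a ** b) <= fsum u b)%E.
Proof.
move=> uu a1; have fb := fsum_fin b uu; rewrite -(fineK fb).
apply: le_trans (fsum_mul (c := fine (fsum u b)) a uu _) _; first by rewrite fineK.
rewrite lee_fin ler_piMl ?fine_ge0 ?fsum_ge0//.
exact: powRp_le1.
Qed.

(** * Isometries and supports *)

Lemma esum_eq_le (D : set G) (P Q : G -> R) :
  (forall x, 0 <= P x) -> (forall x, P x <= Q x) ->
  (\esum_(x in D) (Q x)%:E)%E \is a fin_num ->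
  (\esum_(x in D) (P x)%:E = \esum_(x in D) (Q x)%:E)%E ->
  forall x, D x -> P x = Q x.
Proof.
move=> P0 PQ Qf PQe x Dx.
have E : (\esum_(x in D) (Q x)%:E = \esum_(x in D) (P x)%:E + \esum_(x in D) (Q x - P x)%:E)%E.
  rewrite -esumD//.
  - by apply: eq_esum => y _; rewrite -EFinD addrC subrK.
  - by move=> y _; rewrite lee_fin.
  - by move=> y _; rewrite lee_fin subr_ge0.
have h0 : (\esum_(x in D) (Q x - P x)%:E = 0)%E.
  have Pf : (\esum_(x in D) (P x)%:E)%E \is a fin_num by rewrite PQe.
  by rewrite -[LHS](addeK _ Pf) addeC [X in (_ + X)%E]addeC -E -PQe addeC subee.
have h1 : ((Q x - P x)%:E <= \esum_(x in D) (Q x - P x)%:E)%E.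
  apply: esum_ge; exists [set x]; last by rewrite fsbig_set1.
  by split; [exact: finite_set1|move=> y ->].
rewrite h0 lee_fin subr_le0 in h1.
by apply/eqP; rewrite eq_le PQ.
Qed.

Lemma fsum_pair u a b :
  (fsum u (a + b) + fsum u (a - b) =
   \esum_(x in src_fiber u) (md (jf a x + jf b x) `^ p + md (jf a x - jf b x) `^ p)%:E)%E.
Proof.
rewrite !fsumE -esumD//; try by move=> x _; rewrite lee_fin powR_ge0.
by apply: eq_esum => x _; rewrite jfD jfB EFinD.
Qed.

Lemma fsum_dbl u a b : units u ->
  (fsum u a + fsum u b + (fsum u a + fsum u b) =
   \esum_(x in src_fiber u) (2 * (md (jf a x) `^ p + md (jf b x) `^ p))%:E)%E.
Proof.
move=> uu; rewrite !fsumE -!esumD//; try by move=> x _; rewrite -?EFinD lee_fin ?addr_ge0 ?powR_ge0.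
by apply: eq_esum => x _; rewrite -!EFinD mulr_natl mulr2n.
Qed.

Lemma fsum_dbl_fin u a b : units u ->
  (\esum_(x in src_fiber u) (2 * (md (jf a x) `^ p + md (jf b x) `^ p))%:E)%E \is a fin_num.
Proof.
move=> uu; apply: (eq_ind _ (fun t => t \is a fin_num) _ _ (fsum_dbl a b uu)).
by rewrite !fin_numD !fsum_fin.
Qed.

Lemma disjoint_clarkson u a b : units u ->
  (forall x, gsrc x = u -> jf a x * jf b x = 0) ->
  (fsum u (a + b) + fsum u (a - b) = fsum u a + fsum u b + (fsum u a + fsum u b))%E.
Proof.
move=> uu h; apply: (etrans (fsum_pair u a b)).
apply: (etrans _ (esym (fsum_dbl a b uu))); apply: eq_esum => x sx; congr EFin.
have /eqP := h x sx; rewrite mulf_eq0 => /orP[]/eqP ->.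
  by rewrite add0r sub0r modN mod0 powR0 ?p_neq0// add0r mulr_natl mulr2n.
by rewrite addr0 subr0 mod0 powR0 ?p_neq0// addr0 mulr_natl mulr2n.
Qed.

(** Clarkson's inequality holds term by term in one direction, so equality of the two finite sums
    forces equality in every term. The directions for p < 2 and p > 2 are opposite. *)
Lemma clarkson_disjoint u a b : units u ->
  (fsum u (a + b) + fsum u (a - b) = fsum u a + fsum u b + (fsum u a + fsum u b))%E ->
  forall x, gsrc x = u -> jf a x * jf b x = 0.
Proof.
move=> uu /(etrans (esym (fsum_pair u a b))) E x sx.
have {}E := etrans E (fsum_dbl a b uu).
have := kind_exp_neq2 hk; rewrite neq_lt => /orP[p2|p2].
  have [_ h] := mod_clarkson_lt (jf a x) (jf b x) p_gt0 p2; apply: h.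
  apply: (esum_eq_le (D := src_fiber u)
    (P := fun x => md (jf a x + jf b x) `^ p + md (jf a x - jf b x) `^ p)
    (Q := fun x => 2 * (md (jf a x) `^ p + md (jf b x) `^ p))) => //.
  - by move=> y; rewrite addr_ge0// powR_ge0.
  - by move=> y; have [] := mod_clarkson_lt (jf a y) (jf b y) p_gt0 p2.
  - exact: fsum_dbl_fin.
have [_ h] := mod_clarkson (jf a x) (jf b x) p2; apply: h.
apply: (esum_eq_le (D := src_fiber u)
  (Q := fun x => md (jf a x + jf b x) `^ p + md (jf a x - jf b x) `^ p)
  (P := fun x => 2 * (md (jf a x) `^ p + md (jf b x) `^ p))) => //.
- by move=> y; rewrite mulr_ge0 ?addr_ge0// powR_ge0.
- by move=> y; have [] := mod_clarkson (jf a y) (jf b y) p2.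
- by rewrite E; exact: fsum_dbl_fin.
Qed.

(* Since p is not 2, the equality case of Clarkson's inequality detects
   disjointness of supports, so isometries preserve it (Lamperti). *)
Lemma disjoint_image u (T : A -> A) a b : units u ->
  (forall x y, T (x + y) = T x + T y) -> (forall x y, T (x - y) = T x - T y) ->
  fsum u (T a) = fsum u a -> fsum u (T b) = fsum u b ->
  fsum u (T (a + b)) = fsum u (a + b) -> fsum u (T (a - b)) = fsum u (a - b) ->
  (forall x, gsrc x = u -> jf a x * jf b x = 0) ->
  forall x, gsrc x = u -> jf (T a) x * jf (T b) x = 0.
Proof.
move=> uu TD TB Ta Tb Tab Tab' h; apply: clarkson_disjoint => //.
by rewrite -TD -TB Ta Tb Tab Tab'; exact: disjoint_clarkson.
Qed.

(** Point masses enter here: restricted to the fibre over s(x), the indicator of a bisection through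
    x is the point mass at x. *)
Lemma jbis B x y : cobisection B -> B x -> gsrc y = gsrc x ->
  jf (one_ B) y = if y == x then 1 else 0.
Proof.
move=> hB Bx sy; rewrite jone// cindicE; case: asboolP => By.
  by rewrite (cobis_injs hB By Bx sy) eqxx.
by case: eqP => // yx; case: By; rewrite yx.
Qed.

Lemma mul_delta a B x t : cobisection B -> B x -> gsrc t = gsrc x ->
  jf (a ** one_ B) t = jf a (gmul t (ginv x)).
Proof.
move=> hB Bx st; rewrite (@jmulR B _ _ _ x)//.
- by rewrite indic1// mulr1.
- exact: Cc_cobis.
- by rewrite supp_indic.
Qed.

Lemma fsum_single u a x : gsrc x = u -> (forall y, gsrc y = u -> y <> x -> jf a y = 0) ->
  fsum u a = (md (jf a x) `^ p)%:E.
Proof.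
move=> sx h; rewrite fsumE (esumID [set x])//; last by move=> y _; rewrite lee_fin powR_ge0.
have -> : src_fiber u `&` [set x] = [set x].
  by apply/seteqP; split=> [y []//|y /= ->]; split.
rewrite esum_set1; last by rewrite lee_fin powR_ge0.
rewrite esum1 ?adde0// => y [/= sy yx].
by rewrite h// mod0 powR0// p_neq0.
Qed.

Lemma fsum_ge u a x : gsrc x = u -> ((md (jf a x) `^ p)%:E <= fsum u a)%E.
Proof.
move=> sx; rewrite fsumE; apply: esum_ge; exists [set x]; last by rewrite fsbig_set1.
by split; [exact: finite_set1|move=> y ->].
Qed.

(* The images of the point masses at x and at u = s(x) under 1 + (z - 1) e are
   disjoint; at x this reads (1 + (z - 1) e(r(x))) (z - 1) e(x) = 0, and the
   choices z = -1 and z = i are incompatible unless e(x) = 0. *)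
Lemma herm_units e : e ** e = e ->
  (forall (z : C) b, `|z| = 1 -> nrm (b + (z - 1) *: (e ** b)) <= nrm b) ->
  supp (jf e) `<=` @units G.
Proof.
move=> ee eh x; rewrite /supp /=; apply: contraPP => nux; apply/negP/negPn/eqP.
pose U (z : C) b := b + (z - 1) *: (e ** b).
have UD z a b : U z (a + b) = U z a + U z b.
  by rewrite /U ba_mulDr scalerDr addrACA.
have UB z a b : U z (a - b) = U z a - U z b.
  by rewrite /U ba_mulBr scalerBr opprD addrACA.
set u := gsrc x; have uu : units u by exact: gsrc_unit.
(* Without a unit, 1 + (z - 1) e is not an element of [A]. On a function in C_c with left unit 1_M
   it acts as the contraction v = 1_M + (z - 1) e 1_M, and [fsum_ext] passes to the completion. *)
have contr z b : `|z| = 1 -> (fsum u (U z b) <= fsum u b)%E.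
  move=> z1; rewrite -(fineK (fsum_fin b uu)) -[X in (_ <= X%:E)%E]mul1r.
  apply: (fsum_ext (L := 1) uu) => //; last by rewrite fineK// fsum_fin.
    by move=> a a'; rewrite mul1r -UB; exact: eh.
  move=> f c cf fc; rewrite mul1r.
  have [M [hM fM]] := Cc_lunit cf.
  pose v := one_ M + (z - 1) *: (e ** one_ M).
  have -> : U z (iota f) = v ** iota f.
    by rewrite /U /v ba_mulDl ba_mulZl -ba_mulA (one_lunit hM cf fM).
  apply: le_trans fc; apply: fsum_contr => //.
  by apply: le_trans (eh _ _ z1) _; apply: nrm_one; exact: cou_cobis.
have UK (z : C) b : `|z| = 1 -> U z^* (U z b) = b.
  move=> z1; rewrite /U ba_mulDr ba_mulZr ba_mulA ee.
  rewrite scalerDr scalerA -addrA -!scalerDl.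
  rewrite (_ : z - 1 + _ = z * z^* - 1); last by ring.
  by rewrite -normCK z1 expr1n subrr scale0r addr0.
have iso z b : `|z| = 1 -> fsum u (U z b) = fsum u b.
  move=> z1; apply/eqP; rewrite eq_le contr//= -{1}(UK z b z1).
  by apply: contr; rewrite norm_conjC.
have [B [hB Bx]] := cobis_exT aG x.
have [K [hK Ku _]] := cou_ex uu (@openT G) I.
have hK' := cou_cobis hK.
have su : gsrc u = u by exact: gsrc_src.
have xu : x != u by apply: contra_not_neq nux => ->.
have prod z : `|z| = 1 -> jf (U z (one_ B)) x * jf (U z (one_ K)) x = 0.
  move=> z1; apply: (disjoint_image (u := u) (T := U z)) => //; try exact: iso.
  move=> y sy; rewrite (jbis hB Bx sy) (jbis (x := u) hK' Ku) ?su//.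
  by case: (y =P x) => [->|_]; rewrite ?mul0r// (negbTE xu) mulr0.
have E1 z : jf (U z (one_ B)) x = 1 + (z - 1) * jf e (grng x).
  by rewrite /U jfD jfZ (jbis hB Bx)// eqxx (mul_delta _ hB Bx)// gmul_inv.
have E2 z : jf (U z (one_ K)) x = (z - 1) * jf e x.
  rewrite /U jfD jfZ (jbis (x := u) hK' Ku)// ?su// (negbTE xu) add0r.
  rewrite (mul_delta (x := u) _ hK' Ku) ?su// ginv_unit//.
  by rewrite gmul_src.
apply/eqP/negPn/negP => b0.
have root (z : C) : `|z| = 1 -> z != 1 -> 1 + (z - 1) * jf e (grng x) = 0.
  move=> z1 zn1; have /eqP := prod z z1; rewrite E1 E2 !mulf_eq0.
  by rewrite (negbTE b0) orbF subr_eq0 (negbTE zn1) orbF => /eqP.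
have h1 : 1 + (-1 - 1) * jf e (grng x) = 0.
  apply: root; first by rewrite normrN1.
  by rewrite eq_sym -subr_eq0 opprK -mulr2n pnatr_eq0.
have h2 : 1 + ('i - 1) * jf e (grng x) = 0.
  apply: root; first by rewrite normCi.
  apply/eqP => i1; have := sqrCi C; rewrite i1 expr1n => /eqP.
  by rewrite -subr_eq0 opprK -mulr2n pnatr_eq0.
have : ('i + 1) * jf e (grng x) = 0 :> C.
  have -> : ('i + 1) * jf e (grng x) =
    (1 + ('i - 1) * jf e (grng x)) - (1 + (-1 - 1) * jf e (grng x)) by ring.
  by rewrite h1 h2 subrr.
move/eqP; rewrite mulf_eq0 => /orP[/eqP i1|/eqP e0].
  have := sqrCi C; rewrite (_ : 'i = -1); last by apply/eqP; rewrite -addr_eq0 i1.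
  by rewrite sqrrN expr1n => /eqP; rewrite -subr_eq0 opprK -mulr2n pnatr_eq0.
by move: h1; rewrite e0 mulr0 addr0 => /eqP; rewrite oner_eq0.
Qed.

(* Mutually inverse partial isometries between 1_L A and 1_K A. *)
Record ipair (v w : A) (K L : set G) : Prop := IPair {
  ip_K : cou K; ip_L : cou L;
  ip_v1 : nrm v <= 1; ip_w1 : nrm w <= 1;
  ip_vw : v ** w = one_ K; ip_wv : w ** v = one_ L;
  ip_Kv : one_ K ** v = v; ip_vL : v ** one_ L = v;
  ip_Lw : one_ L ** w = w; ip_wK : w ** one_ K = w }.

Lemma ipair_sym v w K L : ipair v w K L -> ipair w v L K.
Proof. by case; split. Qed.

(** As b = w(vb), the contractions v and w give the two inequalities. *)
Lemma ipair_iso v w K L u b : units u -> ipair v w K L -> one_ L ** b = b ->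
  fsum u (v ** b) = fsum u b.
Proof.
move=> uu ip Lb; apply/eqP; rewrite eq_le fsum_contr ?(ip_v1 ip)//=.
rewrite -{1}Lb -(ip_wv ip) -ba_mulA.
by apply: fsum_contr => //; exact: ip_w1 ip.
Qed.

Lemma ipair_src0 v w K L t : ipair v w K L -> ~ L (gsrc t) -> jf v t = 0.
Proof.
by move=> ip nL; rewrite -(ip_vL ip) (oneR _ _ (ip_L ip)) indic0// mulr0.
Qed.

Lemma ipair_rng0 v w K L t : ipair v w K L -> ~ K (grng t) -> jf v t = 0.
Proof.
by move=> ip nL; rewrite -(ip_Kv ip) (oneL _ _ (ip_K ip)) indic0// mul0r.
Qed.

(* Split v applied to the point mass at l into one of its entries and the rest:
   w sends both parts to disjoint vectors whose sum is that point mass, so one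
   of the parts vanishes. *)
Lemma ipair_src v w K L l : ipair v w K L -> L l ->
  exists t, [/\ gsrc t = l, md (jf v t) = 1 & forall t', gsrc t' = l -> jf v t' != 0 -> t' = t].
Proof.
move=> ip Ll; have hL := ip_L ip; have hK := ip_K ip; have [_ _ sL] := hL.
have ul : units l by exact: sL.
have sl : gsrc l = l by exact: ul.
have cL := cou_cobis hL.
pose b := one_ L; pose c := v ** b.
have bl y : gsrc y = l -> jf b y = if y == l then 1 else 0.
  by move=> sy; apply: (jbis (x := l) cL Ll); rewrite sy sl.
have Lb : one_ L ** b = b.
  apply: (one_lunit hL (cou_Cc hL)) => x; rewrite cindicE.
  by case: asboolP => [Lx _|]; rewrite ?eqxx// unit_rng//; exact: sL.
have cE t : gsrc t = l -> jf c t = jf v t.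
  by move=> st; rewrite /c (ip_vL ip).
have cs : fsum l c = 1%E.
  rewrite (ipair_iso ul ip Lb) (@fsum_single l b l)//.
    by rewrite bl// eqxx mod1 powR1.
  by move=> y sy /eqP yl; rewrite bl// (negbTE yl).
have [[t1 [st1 ct1]]|no] := pselect (exists t, gsrc t = l /\ jf c t != 0); last first.
  have : fsum l c = 0%E.
    rewrite (@fsum_single l c l)//; last first.
      by move=> y sy _; apply/eqP/negPn/negP => h; apply: no; exists y.
    have -> : jf c l = 0 by apply/eqP/negPn/negP => h; apply: no; exists l.
    by rewrite mod0 powR0// p_neq0.
  by rewrite cs => /eqP; rewrite eqe oner_eq0.
have uniq t2 : gsrc t2 = l -> jf c t2 != 0 -> t2 = t1.
  move=> st2 ct2; apply/eqP/negPn/negP => t21.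
  have Kt1 : K (grng t1).
    by apply: contrapT => nK; move: ct1; rewrite cE// (ipair_rng0 ip nK) eqxx.
  have [B0 [hB0 B0t]] := cobis_exT aG t1.
  (* Cutting the bisection down to ranges in K places the single entry [b1] in 1_K A, the part on
     which w is isometric. *)
  have hB := cobis_preim hG hB0 (cou_cobis hK) (@grng_continuous G).
  set B := B0 `&` _ in hB.
  have Bt : B t1 by [].
  pose b1 := jf c t1 *: one_ B; pose c' := c - b1.
  have Kb1 : one_ K ** b1 = b1.
    rewrite /b1 ba_mulZr (one_lunit hK (Cc_cobis _ hG hB))// => x.
    by rewrite cindicE; case: asboolP => [[]//|]; rewrite eqxx.
  have Kc : one_ K ** c = c by rewrite /c ba_mulA (ip_Kv ip).
  have Kc' : one_ K ** c' = c' by rewrite /c' ba_mulBr Kc Kb1.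
  have b1E y : gsrc y = l -> jf b1 y = if y == t1 then jf c t1 else 0.
    move=> sy; rewrite /b1 jfZ (jbis hB Bt) ?sy//.
    by case: ifP; rewrite ?mulr1 ?mulr0.
  have ipw := ipair_sym ip.
  have disj : forall x, gsrc x = l -> jf (w ** b1) x * jf (w ** c') x = 0.
    apply: (disjoint_image (u := l) (T := fun a => w ** a)) => //.
    - by move=> x y; rewrite ba_mulDr.
    - by move=> x y; rewrite ba_mulBr.
    - exact: ipair_iso ipw Kb1.
    - exact: ipair_iso ipw Kc'.
    - by apply: ipair_iso ipw _ => //; rewrite ba_mulDr Kb1 Kc'.
    - by apply: ipair_iso ipw _ => //; rewrite ba_mulBr Kb1 Kc'.
    - move=> x sx; rewrite /c' jfB b1E//.
      by case: (x =P t1) => [->|_]; rewrite ?mul0r// subrr mulr0.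
  have sumE x : jf (w ** b1) x + jf (w ** c') x = jf b x.
    by rewrite -jfD -ba_mulDr /c' addrC subrK /c ba_mulA (ip_wv ip) Lb.
  have z1 x : gsrc x = l -> x != l -> jf (w ** b1) x = 0 /\ jf (w ** c') x = 0.
    move=> sx xl; have := sumE x; have := disj x sx; rewrite bl// (negbTE xl).
    move=> /eqP; rewrite mulf_eq0 => /orP[]/eqP ->.
      by rewrite add0r.
    by rewrite addr0.
  (* An isometry cannot annihilate a part with a non-zero entry on the fibre; this rules out either
     part having zero image there. *)
  have nz a x : gsrc x = l -> one_ K ** a = a -> jf a x != 0 ->
      (forall y, gsrc y = l -> jf (w ** a) y = 0) -> False.
    move=> sx Ka ax h; have := fsum_ge a sx; rewrite -(ipair_iso ul ipw Ka).
    rewrite (@fsum_single l (w ** a) l)//; last by move=> y sy _; exact: h.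
    rewrite h// mod0 powR0 ?p_neq0// lee_fin leNgt powR_gt0//.
    by rewrite mod_gt0.
  have /eqP := disj l sl; rewrite mulf_eq0 => /orP[]/eqP h0.
    apply: (nz b1 t1) => //; first by rewrite b1E// eqxx.
    move=> y sy; have [->//|yl] := eqVneq y l.
    by have [] := z1 y sy yl.
  apply: (nz c' t2) => //; first by rewrite /c' jfB b1E// (negbTE t21) subr0.
  move=> y sy; have [->//|yl] := eqVneq y l.
  by have [] := z1 y sy yl.
exists t1; split=> // [|t' st']; last by rewrite -cE//; exact: uniq.
have : fsum l c = (md (jf c t1) `^ p)%:E.
  apply: fsum_single => // y sy /eqP yt; apply/eqP/negPn/negP => h.
  by rewrite (uniq y sy h) eqxx in yt.
rewrite cs => -[] /esym/eqP; rewrite powR_eq1 (negbTE p_neq0) orbF cE//.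
by rewrite ltNge mod_ge0 orbF => /eqP.
Qed.

(** With u the common range, the point masses at g^-1 and h^-1 are disjoint on the fibre over u, so
    their images under v are disjoint. At the point u these images take the values v(g) and v(h),
    which cannot both be non-zero. *)
Lemma ipair_injr v w K L (g h : G) : ipair v w K L -> jf v g != 0 -> jf v h != 0 ->
  grng g = grng h -> g = h.
Proof.
move=> ip vg vh gh; apply/eqP/negPn/negP => ngh.
have hL := ip_L ip.
have Lg : L (gsrc g) by apply: contrapT => nL; move: vg; rewrite (ipair_src0 ip nL) eqxx.
have Lh : L (gsrc h) by apply: contrapT => nL; move: vh; rewrite (ipair_src0 ip nL) eqxx.
set u := grng g; have uu : units u by exact: grng_unit.
have mkB x : L (grng x) -> exists B, [/\ cobisection B, B x & one_ L ** one_ B = one_ B].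
  move=> Lx; have [B0 [hB0 B0t]] := cobis_exT aG x.
  have hB := cobis_preim hG hB0 (cou_cobis hL) (@grng_continuous G).
  exists (B0 `&` grng @^-1` L); split=> //.
  apply: (one_lunit hL (Cc_cobis _ hG hB)) => y.
  by rewrite cindicE; case: asboolP => [[]//|]; rewrite eqxx.
have [|B [hB Bg LB]] := mkB (ginv g); first by rewrite grng_inv.
have [|D [hD Dh LD]] := mkB (ginv h); first by rewrite grng_inv.
have sg : gsrc (ginv g) = u by rewrite gsrc_inv.
have sh : gsrc (ginv h) = u by rewrite gsrc_inv /u gh.
have su : gsrc u = u by exact: uu.
have disj : forall x, gsrc x = u -> jf (v ** one_ B) x * jf (v ** one_ D) x = 0.
  apply: (disjoint_image (u := u) (T := fun a => v ** a)) => //.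
  - by move=> x y; rewrite ba_mulDr.
  - by move=> x y; rewrite ba_mulBr.
  - exact: ipair_iso ip LB.
  - exact: ipair_iso ip LD.
  - by apply: ipair_iso ip _ => //; rewrite ba_mulDr LB LD.
  - by apply: ipair_iso ip _ => //; rewrite ba_mulBr LB LD.
  - move=> x sx; rewrite (jbis hB Bg) ?sx// (jbis hD Dh) ?sx//.
    case: (x =P ginv g) => [->|_]; last by rewrite mul0r.
    case: eqP => [e|_]; last by rewrite mulr0.
    by move: ngh; rewrite -(ginvK g) e ginvK eqxx.
have := disj u su; rewrite (mul_delta _ hB Bg) ?su// (mul_delta _ hD Dh) ?su//.
rewrite !ginvK gmul_rng /u gh gmul_rng => /eqP.
by rewrite mulf_eq0 (negbTE vg) (negbTE vh).
Qed.

Lemma ipair_mod1 v w K L t : ipair v w K L -> jf v t != 0 -> md (jf v t) = 1.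
Proof.
move=> ip vt.
have Lt : L (gsrc t) by apply: contrapT => nL; move: vt; rewrite (ipair_src0 ip nL) eqxx.
have [s [_ m u]] := ipair_src ip Lt.
by rewrite (u t erefl vt).
Qed.

(** Values at distance less than 1 cannot be one zero and the other of modulus 1, so continuity
    makes the support clopen; vanishing at infinity makes it compact. *)
Lemma supp01_cou a : (forall t, jf a t != 0 -> md (jf a t) = 1) ->
  compact (supp (jf a)) /\ open (supp (jf a)).
Proof.
move=> m1; have near_eq x : exists U : set G, [/\ open U, U x &
    forall y, U y -> md (jf a x - jf a y) < 1].
  have e0 : (0 : C) < 1 by exact: ltr01.
  have := @cvgr_dist_lt _ _ _ _ (nbhs_filter x) (jf a) (jf a x) (@jf_continuous a x) _ e0.
  rewrite nbhsE => -[U [oU Ux] sU]; exists U; split=> // y /sU /=.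
  by rewrite modE -(rmorph1 (real_complex R)) ltcR.
have oS : open (supp (jf a)).
  rewrite openE => x ax; have [U [oU Ux dU]] := near_eq x.
  have nU : nbhs x U by exact: open_nbhs_nbhs.
  apply: filterS nU => y /dU; rewrite /supp /=; have [->|//] := eqVneq (jf a y) 0.
  by rewrite subr0 m1// ltxx.
have cS : closed (supp (jf a)).
  rewrite -openC openE => x /= /negP/negPn/eqP ax; have [U [oU Ux dU]] := near_eq x.
  have nU : nbhs x U by exact: open_nbhs_nbhs.
  apply: filterS nU => y /dU; rewrite /supp /= ax sub0r modN => h ay.
  by rewrite m1// ltxx in h.
split=> //; have [_ h] := jf_C0 a.
have [|Q [cQ hQ]] := h 1; first exact: ltr01.
apply: (subclosed_compact cS cQ) => x ax; apply: contrapT => /hQ.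
by rewrite m1// ltxx.
Qed.

Lemma ipair_supp v w K L : ipair v w K L ->
  [/\ cobisection (supp (jf v)), forall x, jf v x != 0 -> md (jf v x) = 1,
   gsrc @` supp (jf v) = L & grng @` supp (jf v) `<=` K].
Proof.
move=> ip; have m1 t := @ipair_mod1 v w K L t ip.
have [cS oS] := supp01_cou m1.
split=> //.
- split=> //; split=> x y; rewrite !inE => vx vy e; first exact: (ipair_injr ip).
  have Lx : L (gsrc x) by apply: contrapT => nL; move: vx; rewrite /supp /= (ipair_src0 ip nL) eqxx.
  have [s [_ _ us]] := ipair_src ip Lx.
  by rewrite (us x erefl vx) (us y (esym e) vy).
- apply/seteqP; split=> [_ [x vx <-]|l Ll].
    by apply: contrapT => nL; move: vx; rewrite /supp /= (ipair_src0 ip nL) eqxx.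
  have [s [sl m _]] := ipair_src ip Ll; exists s => //.
  by rewrite /supp /= -mod_eq0 m oner_eq0.
- move=> _ [x vx <-]; apply: contrapT => nK; move: vx.
  by rewrite /supp /= (ipair_rng0 ip nK) eqxx.
Qed.

Lemma supp_Cc a : cobisection (supp (jf a)) -> is_Cc (jf a).
Proof.
by case=> cS _ _; apply: (@Cc_intro _ _ hG _ (supp (jf a))) => //; exact: jf_continuous.
Qed.

Lemma iotaK a : is_Cc (jf a) -> iota (jf a) = a.
Proof. by move=> ca; apply: jf_inj; rewrite jf_iota. Qed.

(** * The groupoid automorphism of an algebra automorphism *)

Definition al (alpha : baut A) : A -> A := baut_fun alpha.

Lemma al_lin alpha c a b : al alpha (c *: a + b) = c *: al alpha a + al alpha b.
Proof. by have [h _ _] := subg_mem alpha; exact: h. Qed.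
Lemma al_mul alpha a b : al alpha (a ** b) = al alpha a ** al alpha b.
Proof. by have [_ h _] := subg_mem alpha; exact: h. Qed.
Lemma nrm_al alpha a : nrm (al alpha a) = nrm a.
Proof. by rewrite /nrm; have [_ _ h] := subg_mem alpha; rewrite /al /baut_fun h. Qed.
Lemma alK alpha : cancel (al alpha) (al (alpha^-1)%g).
Proof. exact: symK. Qed.
Lemma alVK alpha : cancel (al (alpha^-1)%g) (al alpha).
Proof. exact: symVK. Qed.
Lemma alD alpha a b : al alpha (a + b) = al alpha a + al alpha b.
Proof. by have := al_lin alpha 1 a b; rewrite !scale1r. Qed.
Lemma al0 alpha : al alpha 0 = 0.
Proof. by apply: (addrI (al alpha 0)); rewrite -alD !addr0. Qed.
Lemma alZ alpha c a : al alpha (c *: a) = c *: al alpha a.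
Proof. by have := al_lin alpha c a 0; rewrite al0 !addr0. Qed.
Lemma alB alpha a b : al alpha (a - b) = al alpha a - al alpha b.
Proof. by rewrite alD -scaleN1r alZ scaleN1r. Qed.

Lemma one_idem K : cou K -> one_ K ** one_ K = one_ K.
Proof.
move=> hK; have [_ _ sK] := hK; apply: (one_lunit hK (cou_Cc hK)) => x.
by rewrite cindicE; case: asboolP => [Kx _|]; rewrite ?eqxx// unit_rng//; exact: sK.
Qed.

(** On C_c the operator multiplies by d(r(x)), where d is z on K and 1 elsewhere, so it is a
    diagonal contraction; a Lipschitz estimate extends this to [A]. *)
Lemma nrm_weight K (z : C) b : cou K -> `|z| = 1 ->
  nrm (b + (z - 1) *: (one_ K ** b)) <= nrm b.
Proof.
move=> hK z1; pose U b := b + (z - 1) *: (one_ K ** b).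
pose d x : C := 1 + (z - 1) * \1_K x.
have dc : continuous (fun x => d (grng x)).
  have [c1 _] := cou_Cc hK => x.
  apply: (@cplx_continuousD _ _ (fun=> 1) (fun x => (z - 1) * \1_K (grng x))).
    exact: cst_continuous.
  apply: continuousM; first exact: cst_continuous.
  apply: (@continuous_comp _ _ _ grng (\1_K : G -> C)); last exact: c1.
  exact: grng_continuous.
have d1 x : md (d x) <= 1.
  rewrite /d cindicE; case: asboolP => _; last by rewrite mulr0 addr0 mod1.
  by rewrite mulr1 addrC subrK; have /norm_mod1 -> := z1.
have h f : is_Cc f -> nrm (U (iota f)) <= nrm (iota f).
  move=> cf; have cdf := Cc_mul hG cf dc.
  have -> : U (iota f) = iota (fun x => d (grng x) * f x).
    apply: jf_inj; apply/funext => x; rewrite /U jfD jfZ oneL// !jf_iota//.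
    by rewrite /d [RHS]mulrDl mul1r mulrA.
  by apply/nrm_iota => //; apply: kind_bound_weight => //; exact: bound_iota.
apply/ler_addgt0Pr => e e0.
pose L := 1 + md (z - 1) * nrm (one_ K).
have L0 : 0 < L + 1.
  have : 0 <= md (z - 1) * nrm (one_ K) by rewrite mulr_ge0.
  rewrite /L; lra.
have d0 : 0 < e / (L + 1) by rewrite divr_gt0.
have [f [cf fb]] := iota_dense b d0.
have Lip : nrm (U b - U (iota f)) <= L * nrm (b - iota f).
  have -> : U b - U (iota f) = (b - iota f) + (z - 1) *: (one_ K ** (b - iota f)).
    by rewrite /U ba_mulBr scalerBr opprD addrACA.
  apply: le_trans (nrmD _ _) _; rewrite nrmZ mulrDl mul1r lerD2l -mulrA.
  by rewrite ler_wpM2l//; exact: nrmM.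
have h1 := nrmD (U b - U (iota f)) (U (iota f)); rewrite subrK in h1.
have h2 := h f cf; have h3 := nrmD (iota f - b) b; rewrite subrK in h3.
rewrite ltr_pdivlMr// in fb; rewrite (nrmB b) in Lip.
rewrite -/(U b); nra.
Qed.

(** The hypotheses of [herm_units] speak only of sums, products and norms, so the isometric
    automorphism transports them from 1_K to its image. *)
Lemma al_units alpha K : cou K -> supp (jf (al alpha (one_ K))) `<=` @units G.
Proof.
move=> hK; apply: herm_units; first by rewrite -al_mul one_idem.
move=> z b z1; rewrite -[b](alVK alpha); move: (al (alpha^-1)%g b) => {}b.
rewrite -al_mul -alZ -alD !nrm_al.
exact: nrm_weight.
Qed.

Local Notation PhiA alpha B := (supp (jf (al alpha (one_ B)))).

(** Once the image e is supported on units, e e = e can be evaluated pointwise after cutting e down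
    to a compact neighbourhood of the unit in question. Its values are then 0 or 1. *)
Lemma al_one alpha K : cou K ->
  cou (PhiA alpha K) /\ al alpha (one_ K) = one_ (PhiA alpha K).
Proof.
move=> hK; set e := al alpha (one_ K).
have ee : e ** e = e by rewrite /e -al_mul one_idem.
have su : supp (jf e) `<=` @units G by exact: al_units.
have sq u : units u -> jf e u = jf e u * jf e u.
  move=> uu; have [M [hM Mu _]] := cou_ex uu (@openT G) I.
  have [cM oM sM] := hM.
  pose d := jf (e ** one_ M).
  have sd : supp d `<=` M.
    move=> x; rewrite /supp /d /= oneR// => h.
    have ux : units x by apply: su; rewrite /supp /=; apply: contra_neq h => ->; rewrite mul0r.
    move: h; rewrite ux cindicE; case: asboolP => //.
    by rewrite mulr0 eqxx.
  have cd : is_Cc d by apply: (@Cc_intro _ _ hG _ M) => //; exact: jf_continuous.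
  have dE : d u = jf e u by rewrite /d oneR// uu indic1// mulr1.
  have : jf (e ** iota d) u = jf e u * d u by rewrite (diagR _ _ cM oM sM cd sd) uu.
  by rewrite iotaK// ba_mulA ee oneR// uu indic1// mulr1 dE.
have v01 t : jf e t != 0 -> jf e t = 1.
  move=> et; have := sq t (su t et); rewrite -[LHS]mulr1 => h.
  by rewrite -(mulfI et h).
have [|cS oS] := @supp01_cou e; first by move=> t /v01 ->; rewrite mod1.
have hS : cou (supp (jf e)) by [].
split=> //; apply: jf_inj; apply/funext => x; rewrite jone; last exact: cou_cobis.
rewrite cindicE; case: asboolP => [/v01//|nx].
by apply/eqP/negPn/negP => h; apply: nx.
Qed.

Lemma al_ipair alpha v w K L : ipair v w K L ->
  ipair (al alpha v) (al alpha w) (PhiA alpha K) (PhiA alpha L).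
Proof.
move=> [hK hL v1 w1 vw wv Kv vL Lw wK].
have [hK' eK] := al_one alpha hK; have [hL' eL] := al_one alpha hL.
by split; rewrite ?nrm_al// -?eK -?eL -?al_mul ?vw ?wv ?Kv ?vL ?Lw ?wK.
Qed.

Lemma starK f : star (star f) = f.
Proof. by apply/funext => x; rewrite /star ginvK conjCK. Qed.

Lemma supp_star f : supp (star f) = set_ginv (supp f).
Proof.
have E x : (star f x == 0) = (f (ginv x) == 0) by rewrite -mod_eq0 mod_star mod_eq0.
by rewrite set_ginvE; apply/seteqP; split=> x; rewrite /supp /= E.
Qed.

Lemma jmul_supp f a (x b : G) : cobisection (supp f) -> is_Cc f -> f b != 0 -> grng b = grng x ->
  jf (iota f ** a) x = f b * jf a (gmul (ginv b) x).
Proof. by move=> hf cf fb rb; exact: (jmulL _ hf). Qed.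

Lemma jmul_supp0 f a (x : G) : is_Cc f -> (forall b : G, f b != 0 -> grng b <> grng x) ->
  jf (iota f ** a) x = 0.
Proof. by move=> cf h; apply: (@jmulL0 (supp f)). Qed.

Lemma mul_star f : is_Cc f -> cobisection (supp f) -> (forall x, f x != 0 -> md (f x) = 1) ->
  iota f ** iota (star f) = one_ (grng @` supp f).
Proof.
move=> cf hf m1; have hr := cou_cobis (cou_rng hf).
apply: jf_inj; apply/funext => x; rewrite jone// cindicE.
have csf := Cc_star hG cf.
have [[b [fb rb]]|no] := pselect (exists b : G, f b != 0 /\ grng b = grng x); last first.
  rewrite jmul_supp0//; last by move=> b fb rb; apply: no; exists b.
  case: asboolP => // -[b fb bx]; case: no; exists b; split=> //.
  by rewrite -bx grng_rng.
rewrite (jmul_supp _ hf cf fb rb) jf_iota// /star.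
have c : gsrc (ginv b) = grng x by rewrite gsrc_inv.
rewrite ginv_mul// ginvK.
case: asboolP => [[b' fb' bx]|nx].
  have ux : units x by rewrite -bx; exact: grng_unit.
  rewrite ginv_unit// gmul_unitl//; last by rewrite ux rb unit_rng.
  by rewrite -normCK; have /norm_mod1 -> := m1 b fb; rewrite expr1n.
have [->|h] := eqVneq (f (gmul (ginv x) b)) 0; first by rewrite rmorph0 mulr0.
case: nx; exists b => //; rewrite rb.
have e : gmul (ginv x) b = b.
  by apply: (cobis_injs hf) => //; rewrite gsrc_mul// gsrc_inv.
have : gmul (gmul (ginv x) b) (ginv b) = ginv x by apply: gmulK; rewrite gsrc_inv.
rewrite e gmul_inv => e2.
by rewrite -[in RHS](ginvK x) -e2 rb ginv_unit//; exact: grng_unit.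
Qed.

Lemma tbis_ipair f : is_Cc f -> cobisection (supp f) -> (forall x, f x != 0 -> md (f x) = 1) ->
  ipair (iota f) (iota (star f)) (grng @` supp f) (gsrc @` supp f).
Proof.
move=> cf hf m1; have csf := Cc_star hG cf.
have hsf : cobisection (supp (star f)) by rewrite supp_star; exact: cobis_inv.
have sm1 x : star f x != 0 -> md (star f x) = 1.
  by rewrite -mod_eq0 mod_star mod_eq0; exact: m1.
have rsf : grng @` supp (star f) = gsrc @` supp f.
  rewrite supp_star; apply/seteqP; split=> [_ [_ [x fx <-] <-]|_ [x fx <-]].
    by exists x => //; rewrite grng_inv.
  by exists (ginv x); [exists x|rewrite grng_inv].
have ssf : gsrc @` supp (star f) = grng @` supp f.
  rewrite supp_star; apply/seteqP; split=> [_ [_ [x fx <-] <-]|_ [x fx <-]].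
    by exists x => //; rewrite gsrc_inv.
  by exists (ginv x); [exists x|rewrite gsrc_inv].
have n1 g : is_Cc g -> cobisection (supp g) -> (forall x, g x != 0 -> md (g x) = 1) ->
    nrm (iota g) <= 1.
  move=> cg [_ _ bg] mg; apply: (@nrm_bis _ (supp g)) => // x.
  by have [->|/mg ->] := eqVneq (g x) 0; rewrite ?mod0.
have lu g : is_Cc g -> cobisection (supp g) ->
    one_ (grng @` supp g) ** iota g = iota g.
  by move=> cg hg; apply: (one_lunit (cou_rng hg) cg) => x gx; exists x.
have ru g : is_Cc g -> cobisection (supp g) ->
    iota g ** one_ (gsrc @` supp g) = iota g.
  move=> cg hg; apply: jf_inj; apply/funext => x; rewrite oneR; last exact: cou_src.
  rewrite jf_iota//; have [->|gx] := eqVneq (g x) 0; first by rewrite mul0r.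
  by rewrite indic1 ?mulr1//; exists x.
split.
- exact: cou_rng.
- exact: cou_src.
- exact: n1.
- exact: n1.
- exact: mul_star.
- by rewrite -{2}[f]starK mul_star// rsf.
- exact: lu.
- exact: ru.
- by rewrite -rsf; exact: lu.
- by rewrite -ssf; exact: ru.
Qed.

Lemma one_ipair B : cobisection B ->
  ipair (one_ B) (iota (star \1_B)) (grng @` B) (gsrc @` B).
Proof.
move=> hB; have sB := supp_indic R B; rewrite -{3 4}sB; apply: tbis_ipair.
- exact: Cc_cobis.
- by rewrite sB.
- by move=> x; rewrite cindicE; case: asboolP; rewrite ?eqxx// mod1.
Qed.

Lemma Phi_bis alpha B : cobisection B ->
  [/\ cobisection (PhiA alpha B),
      forall x, jf (al alpha (one_ B)) x != 0 -> md (jf (al alpha (one_ B)) x) = 1,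
      gsrc @` PhiA alpha B = PhiA alpha (gsrc @` B) &
      grng @` PhiA alpha B `<=` PhiA alpha (grng @` B)].
Proof. by move=> hB; exact: (ipair_supp (al_ipair alpha (one_ipair hB))). Qed.

Lemma supp_mul_sub f B a : is_Cc f -> cobisection B -> supp f `<=` B ->
  supp (jf (iota f ** a)) `<=` set_gmul B (supp (jf a)).
Proof.
move=> cf hB sB x.
have [[b [Bb rb]]|no] := pselect (exists b : G, B b /\ grng b = grng x); last first.
  by rewrite /supp /= (jmulL0 _ cf sB) ?eqxx// => b Bb rb; apply: no; exists b.
rewrite /supp /= (jmulL _ hB cf sB Bb rb) mulf_eq0 negb_or => /andP[_ h].
have c : gsrc (ginv b) = grng x by rewrite gsrc_inv.
exists b, (gmul (ginv b) x); split=> //; first by rewrite grng_mul// grng_inv.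
by rewrite gmulA ?grng_inv// gmul_inv rb gmul_rng.
Qed.

Lemma supp_mul f a : is_Cc f -> cobisection (supp f) ->
  supp (jf (iota f ** a)) = set_gmul (supp f) (supp (jf a)).
Proof.
move=> cf hf; apply/seteqP; split=> x; first exact: supp_mul_sub.
move=> [b [y [fb ay by_ ->]]]; rewrite /supp /=.
rewrite (jmul_supp (b := b) _ hf cf fb) ?grng_mul// gmulKl//.
by rewrite mulf_eq0 negb_or fb.
Qed.

Definition tbis a : Prop :=
  cobisection (supp (jf a)) /\ forall x, jf a x != 0 -> md (jf a x) = 1.

Lemma tbis_star a : tbis a -> ipair a (iota (star (jf a)))
  (grng @` supp (jf a)) (gsrc @` supp (jf a)).
Proof.
move=> [ha ma]; have ca := supp_Cc ha.
by rewrite -{1}(iotaK ca); exact: tbis_ipair.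
Qed.

Lemma tbis_one B : cobisection B -> tbis (one_ B).
Proof.
move=> hB; rewrite /tbis jone// supp_indic; split=> // x.
by rewrite cindicE; case: asboolP; rewrite ?eqxx// mod1.
Qed.

(** Two elements b, c of one bisection with equal source coincide, so bc^-1 is a unit and n m^* is
    diagonal. As m^* m is the indicator of s(supp m), multiplying by m gives back n. *)
Lemma supp_tbis_diag n m : is_Cc (jf n) -> tbis m -> supp (jf n) `<=` supp (jf m) ->
  supp (jf (n ** iota (star (jf m)))) `<=` @units G /\
  n ** iota (star (jf m)) ** m = n.
Proof.
move=> cn [hm mm] nm; have cm := supp_Cc hm.
split.
  move=> x; rewrite -{1}(iotaK cn) => /(supp_mul_sub cn hm nm)[b [y [mb my by_ ->]]].
  move: my; rewrite jf_iota; last exact: Cc_star.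
  rewrite supp_star => -[c mc cy]; rewrite -cy grng_inv in by_.
  have -> : b = c by exact: (cobis_injs hm).
  by rewrite -cy gmul_inv; exact: grng_unit.
rewrite -ba_mulA (ip_wv (tbis_star (conj hm mm))).
apply: jf_inj; apply/funext => x; rewrite oneR; last exact: cou_src.
have [->|nx] := eqVneq (jf n x) 0; first by rewrite mul0r.
by rewrite indic1 ?mulr1//; exists x => //; exact: nm.
Qed.

(** Inclusion of sets of units is the algebraic relation 1_K 1_L = 1_K, which alpha preserves. *)
Lemma Phi_cou_mono alpha K L : cou K -> cou L -> K `<=` L -> PhiA alpha K `<=` PhiA alpha L.
Proof.
move=> hK hL KL; have [hK' eK'] := al_one alpha hK; have [hL' eL'] := al_one alpha hL.
have KLe : one_ K ** one_ L = one_ K.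
  apply: jf_inj; apply/funext => x; rewrite oneR// jone; last exact: cou_cobis.
  rewrite !cindicE; case: asboolP => Kx; last by rewrite mul0r.
  have [_ _ sK] := hK; rewrite (sK x Kx); case: asboolP => [_|[]]; first by rewrite mulr1.
  exact: KL.
move=> x Kx; have [_ _ sK'] := hK'; have ux := sK' x Kx.
have : jf (al alpha (one_ K)) x = jf (al alpha (one_ K)) x * \1_(PhiA alpha L) (gsrc x).
  by rewrite -{1}KLe al_mul {1}eL' oneR.
move: Kx; rewrite /supp /= => h0 h1; move: h0; rewrite h1 ux cindicE; case: asboolP => [hx _|_]; [exact: hx|].
by rewrite mulr0 eqxx.
Qed.

Lemma Phi_couK alpha K : cou K -> PhiA (alpha^-1)%g (PhiA alpha K) = K.
Proof.
move=> hK; have [hK' <-] := al_one alpha hK.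
by rewrite alK jone ?supp_indic//; exact: cou_cobis.
Qed.

Lemma Phi_couVK alpha K : cou K -> PhiA alpha (PhiA (alpha^-1)%g K) = K.
Proof. by move=> /(Phi_couK (alpha^-1)%g); rewrite invgK. Qed.

Lemma cou0 : cou (set0 : set G).
Proof. by split; [exact: compact0|exact: open0|]. Qed.

(** The point v is the preimage of u under the homeomorphism of the unit space induced by alpha;
    hence Stone duality is applied with the inverse of alpha in the forward role. *)
Lemma unit_point alpha (u : G) : units u -> exists v, units v /\
  forall K, cou K -> (K v <-> PhiA alpha K u).
Proof.
move=> uu; have [v [uv h]] := @stone_point G hG cou (@units G)
  (fun K => PhiA (alpha^-1)%g K) (fun K => PhiA alpha K) cou0
  (fun B hB => hB) (fun x U ux oU Ux => cou_ex ux oU Ux)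
  (fun K hK => (al_one (alpha^-1)%g hK).1) (fun K hK => (al_one alpha hK).1)
  (Phi_couVK alpha) (Phi_couK alpha)
  (@Phi_cou_mono (alpha^-1)%g) (@Phi_cou_mono alpha) u uu.
exists v; split=> // K hK.
by have := h _ (al_one alpha hK).1; rewrite Phi_couK// => ->.
Qed.

(** Near v the function a is within e of the constant a(v), so g = 1_K a - a(v) 1_K has norm at most
    e for small K around v. Evaluating alpha(g) at x, where alpha(1_K) is 1 on the range, compares
    alpha(a)(x) with a(v). *)
Lemma al_diag alpha a (x v : G) : supp (jf a) `<=` @units G -> units v ->
  (forall K, cou K -> (K v <-> PhiA alpha K (grng x))) ->
  jf (al alpha a) x = \1_(@units G) x * jf a v.
Proof.
move=> su uv h; apply: mod_le_eq => e e0.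
have e0' : 0 < real_complex R e :> C by rewrite -(rmorph0 (real_complex R)) ltcR.
have := @cvgr_dist_lt _ _ _ _ (nbhs_filter v) (jf a) (jf a v) (@jf_continuous a v) _ e0'.
rewrite nbhsE => -[U [oU Uv] sU].
have [K [hK Kv KU]] := cou_ex uv oU Uv.
have dK w : K w -> md (jf a w - jf a v) <= e.
  by move=> /KU/sU /=; rewrite modE ltcR modB => /ltW.
have [cK oK sK] := hK; have [hK' eK'] := al_one alpha hK.
pose g := one_ K ** a - jf a v *: one_ K.
have gE w : jf g w = \1_K w * (jf a w - jf a v).
  rewrite /g jfB jfZ oneL// jone; last exact: cou_cobis.
  have [uw|nuw] := pselect (units w); first by rewrite unit_rng// mulrBr mulrC (mulrC (jf a v)) mulrC.
  have -> : jf a w = 0 by apply/eqP/negPn/negP => /su.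
  by rewrite mulr0 !indic0 ?mulr0 ?mul0r ?subrr// => /sK.
have sg : supp (jf g) `<=` K.
  move=> w; rewrite /supp /= gE cindicE; case: asboolP => //.
  by rewrite mul0r eqxx.
have cg : is_Cc (jf g).
  by apply: (@Cc_intro _ _ hG _ K) => //; exact: jf_continuous.
have ng : nrm g <= e.
  rewrite -(iotaK cg); apply: (@nrm_bis _ K) => //; first exact: ltW.
    by have [_ _] := cou_cobis hK.
  move=> w; rewrite gE cindicE; case: asboolP => [Kw|_].
    by rewrite mul1r; exact: dK.
  by rewrite mul0r mod0 ltW.
apply: le_trans ng; rewrite -(nrm_al alpha); apply: le_trans (jf_le _ x).
rewrite /g alB alZ al_mul eK' jfB jfZ oneL// jone; last exact: cou_cobis.
have Kr : PhiA alpha K (grng x) by exact: (h K hK).1.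
rewrite (indic1 _ Kr) mul1r mulrC.
suff -> : \1_(PhiA alpha K) x = \1_(@units G) x :> C by [].
have [ux|nux] := pselect (units x); last first.
  by rewrite !indic0//; have [_ _ sK'] := hK' => /sK'.
by rewrite !indic1// -(unit_rng ux).
Qed.

Lemma al_diag_units alpha a : supp (jf a) `<=` @units G ->
  supp (jf (al alpha a)) `<=` @units G.
Proof.
move=> su x; have [v [uv h]] := unit_point alpha (grng_unit x).
rewrite /supp /= (al_diag su uv h) cindicE; case: asboolP => //.
by rewrite mul0r eqxx.
Qed.

(* If supp n is contained in supp m then n = d m with d in C_0(units), which
   alpha preserves. *)
Lemma supp_al_sub alpha n m : tbis n -> tbis m -> supp (jf n) `<=` supp (jf m) ->
  supp (jf (al alpha n)) `<=` supp (jf (al alpha m)).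
Proof.
move=> tn tm nm; have [du dm] := supp_tbis_diag (supp_Cc tn.1) tm nm.
set d := n ** iota (star (jf m)) in du dm.
pose K : set G := grng @` supp (jf n).
have hK : cou K by apply: cou_rng; case: tn.
have dK : one_ K ** d = d by rewrite /d ba_mulA (ip_Kv (tbis_star tn)).
have sdK : supp (jf d) `<=` K.
  move=> x dx; have ux := du x dx; move: dx; rewrite /supp /= -dK oneL// unit_rng//.
  by rewrite cindicE; case: asboolP => //; rewrite mul0r eqxx.
have au := @al_diag_units alpha _ du.
have [hK' eK'] := al_one alpha hK.
have [cK' oK' sK'] := hK'.
have sad : supp (jf (al alpha d)) `<=` PhiA alpha K.
  move=> x dx; have ux := au x dx.
  have h1 : jf (al alpha d) x = \1_(PhiA alpha K) (grng x) * jf (al alpha d) x.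
    by rewrite -{1}dK al_mul {1}eK' oneL.
  move: dx; rewrite {1}/supp /= h1 unit_rng//.
  by rewrite cindicE; case: asboolP => //; rewrite mul0r eqxx.
have cad : is_Cc (jf (al alpha d)).
  by apply: (@Cc_intro _ _ hG _ (PhiA alpha K)) => //; exact: jf_continuous.
move=> x; rewrite /supp /= -dm al_mul -(iotaK cad) (diagL _ _ cK' oK' sK')//.
by rewrite mulf_eq0 negb_or => /andP[].
Qed.


(** The element beta(1_B) may differ from the indicator of its support by values in the circle. By
    [supp_al_sub] the support of the image under alpha depends on the support alone. *)
Lemma Phi_comp alpha beta B : cobisection B ->
  PhiA alpha (PhiA beta B) = PhiA (alpha * beta)%g B.
Proof.
move=> hB; have [hB' m1 _ _] := Phi_bis beta hB.
have t1 : tbis (al beta (one_ B)) by [].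
have t2 := tbis_one hB'.
have e : supp (jf (one_ (PhiA beta B))) = PhiA beta B by rewrite jone// supp_indic.
rewrite -[al (alpha * beta)%g (one_ B)]/(al alpha (al beta (one_ B))).
by apply/seteqP; split; apply: supp_al_sub => //; rewrite e.
Qed.

Lemma Phi1 B : cobisection B -> PhiA 1%g B = B.
Proof.
move=> hB; rewrite -[al 1%g (one_ B)]/(one_ B).
by rewrite jone// supp_indic.
Qed.

Lemma Phi_mono alpha B D : cobisection B -> cobisection D -> B `<=` D ->
  PhiA alpha B `<=` PhiA alpha D.
Proof.
move=> hB hD BD; apply: supp_al_sub; [exact: tbis_one|exact: tbis_one|].
by rewrite !jone// !supp_indic.
Qed.

Lemma Phi_cobis alpha B : cobisection B -> cobisection (PhiA alpha B).
Proof. by case/(Phi_bis alpha). Qed.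

Lemma PhiVK alpha B : cobisection B -> PhiA alpha (PhiA (alpha^-1)%g B) = B.
Proof. by move=> hB; rewrite Phi_comp// mulgV Phi1. Qed.
Lemma PhiK alpha B : cobisection B -> PhiA (alpha^-1)%g (PhiA alpha B) = B.
Proof. by move=> hB; rewrite Phi_comp// mulVg Phi1. Qed.

(** * The groupoid automorphism from Stone duality on bisections *)

Lemma om_ex alpha x : exists y, forall B, cobisection B -> (B x <-> PhiA alpha B y).
Proof.
have [y [_ h]] := @stone_point G hG (@cobisection G) setT
  (fun K => PhiA alpha K) (fun K => PhiA (alpha^-1)%g K) (@cobis0 G)
  (fun B hB => And3 (cobis_compact hB) (cobis_open hB) (@subsetT _ B))
  (fun x U _ oU Ux => cobis_ex aG oU Ux)
  (Phi_cobis alpha) (Phi_cobis (alpha^-1)%g) (PhiK alpha) (PhiVK alpha)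
  (@Phi_mono alpha) (@Phi_mono (alpha^-1)%g) x I.
by exists y.
Qed.

Definition om alpha : G -> G := projT1 (choice (om_ex alpha)).

Lemma omP alpha B x : cobisection B -> (B x <-> PhiA alpha B (om alpha x)).
Proof. by move=> hB; rewrite /om; case: choice => f /= /(_ x)/(_ B hB). Qed.

Lemma cobis_sep (x y : G) : (forall B, cobisection B -> B x -> B y) -> x = y.
Proof.
move=> h; apply: contrapT => xy; move: hG; rewrite open_hausdorff => /(_ x y).
have ne : x != y by apply/eqP.
move=> /(_ ne)[[U V] /=]; rewrite !inE => -[xU yV] [oU oV UV].
have [B [hB Bx BU]] := cobis_ex aG oU xU.
have : (U `&` V) y by split=> //; apply: BU; exact: h.
by rewrite UV.
Qed.

(** One implication suffices because bisections separate points; each later identity for [om] is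
    checked through this criterion. *)
Lemma om_uniq alpha x y : (forall B, cobisection B -> B x -> PhiA alpha B y) -> y = om alpha x.
Proof.
move=> h; apply/esym/cobis_sep => B hB Bo.
rewrite -(PhiVK alpha hB); apply: h; first exact: Phi_cobis.
by apply/(omP alpha); [exact: Phi_cobis|rewrite PhiVK].
Qed.

Lemma om_comp alpha beta x : om (alpha * beta)%g x = om alpha (om beta x).
Proof.
apply/esym; apply: om_uniq => B hB Bx; rewrite -Phi_comp//.
exact: (omP alpha _ (Phi_cobis beta hB)).1 ((omP beta x hB).1 Bx).
Qed.

Lemma om1 x : om 1%g x = x.
Proof. by apply/esym; apply: om_uniq => B hB; rewrite Phi1. Qed.

Lemma omK alpha : cancel (om alpha) (om (alpha^-1)%g).
Proof. by move=> x; rewrite -om_comp mulVg om1. Qed.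
Lemma omVK alpha : cancel (om (alpha^-1)%g) (om alpha).
Proof. by move=> x; rewrite -om_comp mulgV om1. Qed.

Lemma om_continuous alpha : continuous (om alpha).
Proof.
move=> x V /=; rewrite nbhsE => -[U [oU Ux] UV].
have [B [hB Bx BU]] := cobis_ex aG oU Ux.
have [_ oP _] := Phi_cobis (alpha^-1)%g hB.
have : nbhs x (PhiA (alpha^-1)%g B).
  apply: open_nbhs_nbhs; split=> //.
  by have /(omP (alpha^-1)%g (om alpha x) hB) := Bx; rewrite omK.
apply: filterS => y h /=; apply: UV; apply: BU.
by apply/(omP (alpha^-1)%g _ hB); rewrite omK.
Qed.

Lemma one_mul B D : cobisection B -> cobisection D ->
  cobisection (set_gmul B D) /\ one_ B ** one_ D = one_ (set_gmul B D).
Proof.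
move=> hB hD; have sB := supp_indic R B; have cB := Cc_cobis R hG hB.
have cD := Cc_cobis R hG hD.
have S : supp (jf (one_ B ** one_ D)) = set_gmul B D.
  by rewrite supp_mul ?sB// jone// supp_indic.
have v01 t : jf (one_ B ** one_ D) t != 0 -> jf (one_ B ** one_ D) t = 1.
  move=> h; have : set_gmul B D t by rewrite -S.
  move=> [b [d [Bb Dd bd tE]]].
  have fb : \1_B b != 0 :> C by rewrite indic1// oner_neq0.
  rewrite tE (jmul_supp (b := b) _ _ cB fb) ?sB ?grng_mul// gmulKl//.
  by rewrite jone// !indic1// mulr1.
have [|cS oS] := @supp01_cou (one_ B ** one_ D); first by move=> t /v01 ->; rewrite mod1.
rewrite S in cS oS; split.
  split=> //; split=> z z'.
    rewrite !inE => -[a [b [Ba Db ab ->]]] [a' [b' [Ba' Db' ab' ->]]].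
    rewrite !grng_mul// => /(cobis_injr hB Ba Ba') ea; subst a'.
    by rewrite (cobis_injr hD Db Db' (etrans (esym ab) ab')).
  rewrite !inE => -[a [b [Ba Db ab ->]]] [a' [b' [Ba' Db' ab' ->]]].
  rewrite !gsrc_mul// => /(cobis_injs hD Db Db') eb; subst b'.
  by rewrite (cobis_injs hB Ba Ba' (etrans ab (esym ab'))).
apply: jf_inj; apply/funext => x; rewrite jf_iota; last exact: Cc_indic.
rewrite cindicE -S; case: asboolP => [/v01//|nx].
by apply/eqP/negPn/negP => h; apply: nx.
Qed.

Lemma Phi_mul alpha B D : cobisection B -> cobisection D ->
  PhiA alpha (set_gmul B D) = set_gmul (PhiA alpha B) (PhiA alpha D).
Proof.
move=> hB hD; have [_ <-] := one_mul hB hD; rewrite al_mul.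
have hB' := Phi_cobis alpha hB; have cB := supp_Cc hB'.
by rewrite -{1}(iotaK cB) supp_mul.
Qed.

(** The image of xy lies in Phi(B) Phi(D), so it factors as bd. Shrinking B to its intersection with
    another bisection through x keeps the range, hence keeps b inside Phi(B); so b lies in Phi(E)
    for every E around x and is the image of x. The same holds for d, with sources. *)
Lemma om_hom alpha : groupoid_hom (om alpha).
Proof.
move=> x y xy; have [B [hB Bx]] := cobis_exT aG x; have [D [hD Dy]] := cobis_exT aG y.
have key B' D' : cobisection B' -> cobisection D' -> B' x -> D' y ->
    set_gmul (PhiA alpha B') (PhiA alpha D') (om alpha (gmul x y)).
  move=> hB' hD' B'x D'y; rewrite -Phi_mul//; have [hM _] := one_mul hB' hD'.
  by apply: (omP alpha _ hM).1; exists x, y.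
have [b [d [Pb Pd bd zE]]] := key B D hB hD Bx Dy.
have hPB := Phi_cobis alpha hB; have hPD := Phi_cobis alpha hD.
have eb : b = om alpha x.
  apply: om_uniq => E hE Ex; have hEB := cobisI hG hE hB.
  have [b' [d' [Pb' Pd' bd' zE']]] := key (E `&` B) D hEB hD (conj Ex Bx) Dy.
  suff -> : b = b' by apply: (Phi_mono hEB hE) Pb' => t [].
  apply: (cobis_injr hPB) => //; first by apply: (Phi_mono hEB hB) Pb' => t [].
  by rewrite -(grng_mul bd) -(grng_mul bd') -zE -zE'.
have ed : d = om alpha y.
  apply: om_uniq => E hE Ey; have hED := cobisI hG hE hD.
  have [b' [d' [Pb' Pd' bd' zE']]] := key B (E `&` D) hB hED Bx (conj Ey Dy).
  suff -> : d = d' by apply: (Phi_mono hED hE) Pd' => t [].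
  apply: (cobis_injs hPD) => //; first by apply: (Phi_mono hED hD) Pd' => t [].
  by rewrite -(gsrc_mul bd) -(gsrc_mul bd') -zE -zE'.
by rewrite -eb -ed.
Qed.

Definition om_sym alpha : sym G := Sym (omK alpha) (omVK alpha).

Lemma om_gaut alpha : gaut_set (om_sym alpha).
Proof. by split; [exact: om_hom|exact: om_continuous|exact: om_continuous]. Qed.

Definition Omega alpha : gaut G := @Subg _ (gaut_subgroup G) (om_sym alpha) (om_gaut alpha).

Lemma OmegaE alpha x : gaut_fun (Omega alpha) x = om alpha x. Proof. by []. Qed.

Lemma OmegaM alpha beta : Omega (alpha * beta)%g = (Omega alpha * Omega beta)%g.
Proof. by apply: subg_inj; apply: sym_inj => x; exact: om_comp. Qed.

Lemma om_units alpha x : units (om alpha x) <-> units x.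
Proof. exact: (gaut_units (Omega alpha)). Qed.

Lemma al_diag_om alpha a x : supp (jf a) `<=` @units G ->
  jf (al alpha a) x = \1_(@units G) x * jf a (om (alpha^-1)%g (grng x)).
Proof.
move=> su; apply: (al_diag su); first by apply/om_units; exact: grng_unit.
by move=> K /cou_cobis hK; rewrite (omP alpha _ hK) omVK.
Qed.

Lemma Omega_is_Omega : is_Omega iota jf Omega.
Proof.
move=> alpha; exists (om alpha); split; last first.
  move=> x B hB Bx y; rewrite OmegaE; split=> [[Py sy]|->].
    have Po := (omP alpha x hB).1 Bx.
    apply: (cobis_injs (Phi_cobis alpha hB)) => //.
    by rewrite sy -OmegaE -gaut_src.
  split; first exact: ((omP alpha x hB).1 Bx).
  by rewrite -OmegaE gaut_src.
exists (om (alpha^-1)%g); split.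
  split.
  - by move=> u uu; split; [apply/om_units|rewrite omK].
  - by move=> u uu; split; [apply/om_units|rewrite omVK].
  - by apply: continuous_subspaceT; exact: om_continuous.
  - by apply: continuous_subspaceT; exact: om_continuous.
move=> a su; split; first exact: al_diag_units.
by move=> u uu; rewrite -[baut_fun alpha a]/(al alpha a) al_diag_om// indic1// mul1r unit_rng.
Qed.

(** * The automorphisms given by cocycles and by groupoid automorphisms *)

Lemma nrm_complete (u : nat -> A) :
  (forall e : R, 0 < e -> exists N, forall m n, (N <= m)%N -> (N <= n)%N ->
     nrm (u m - u n) < e) ->
  exists l, (fun n => nrm (u n - l)) @ \oo --> (0 : R).
Proof.
move=> cu; have : cauchy (u @ \oo).
  apply: cauchy_exP => e e0.
  have eE := Re_eq (ltW e0).
  have r0 : 0 < complex.Re e by move: e0; rewrite {1}eE -(rmorph0 (real_complex R)) ltcR.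
  have [N hN] := cu _ r0; exists (u N); exists N => // n /= Nn.
  by rewrite -ball_normE /ball_ /= nrmE eE ltcR; apply: hN.
move=> /cauchy_cvgP; set l := lim (u @ \oo) => ul; exists l.
apply/cvgrPdist_lt => e e0.
have e0' : 0 < real_complex R e :> C by rewrite -(rmorph0 (real_complex R)) ltcR.
have /cvgrPdist_lt/(_ _ e0') := ul; apply: filterS => n.
by rewrite nrmE ltcR sub0r normrN ger0_norm// nrmB.
Qed.

(** Both families of automorphisms come from this one operation: phi = 1 gives [Gamma] and xi = 1
    gives [Sigma]. *)
Definition twist (xi : cocycle R G) (phi : gaut G) f : G -> C :=
  fun x => xi x * f (gaut_fun (phi^-1)%g x).

Lemma Cc_twist xi phi f : is_Cc f -> is_Cc (twist xi phi f).
Proof.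
move=> cf; have [cxi _ _] := cocP xi; have [_ c1 c2] := subg_mem phi.
have := @Cc_comp _ _ hG f (gaut_fun (phi^-1)%g) (gaut_fun phi) cf c2 c1 (gaut_funK phi).
by move=> h; exact: (Cc_mul hG h cxi).
Qed.

Lemma nrm_twist xi phi f : is_Cc f -> nrm (iota (twist xi phi f)) <= nrm (iota f).
Proof.
move=> cf; apply/(nrm_iota (Cc_twist xi phi cf)) => //.
apply: kind_bound_coc => //; apply: kind_bound_aut; exact: bound_iota.
Qed.

Lemma twistB xi phi f g : is_Cc f -> is_Cc g ->
  iota (twist xi phi f) - iota (twist xi phi g) = iota (twist xi phi (fun x => f x - g x)).
Proof.
move=> cf cg; rewrite -iotaB; try exact: Cc_twist.
by congr iota; apply/funext => x; rewrite /twist mulrBr.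
Qed.

Lemma coc_mod1 (xi : cocycle R G) x : md (xi x) = 1.
Proof. by have [_ n _] := cocP xi; apply/norm_mod1. Qed.

(** Twisting is contractive on C_c, so it sends an approximating sequence to a Cauchy sequence; the
    function of the limit is found pointwise. *)
Lemma tw_ex xi phi a : exists b, nrm b <= nrm a /\ jf b = twist xi phi (jf a).
Proof.
have [fn [cf fa]] := iota_seq a.
have lip m n : nrm (iota (twist xi phi (fn m)) - iota (twist xi phi (fn n))) <=
    nrm (iota (fn m) - a) + nrm (iota (fn n) - a).
  rewrite twistB//; apply: le_trans (nrm_twist _ _ (CcB (cf m) (cf n))) _.
  by rewrite iotaB// (nrmB (iota (fn n)) a); exact: nrm_tri.
have [|b ub] := @nrm_complete (fun n => iota (twist xi phi (fn n))).
  move=> e e0; have e20 : 0 < e / 2 by lra.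
  have /cvgrPdist_lt/(_ _ e20)[N _ hN] := fa; exists N => m n Nm Nn.
  have := hN m Nm; have := hN n Nn; rewrite /= !sub0r !normrN !ger0_norm//.
  have := lip m n; lra.
exists b; split.
  apply: (ler_cvg_to (nrm_cvg ub) (nrm_cvg fa)); apply: nearW => n; exact: nrm_twist.
apply/funext => x; apply: mod_le_eq => e e0; have e20 : 0 < e / 2 by lra.
have /cvgrPdist_lt/(_ _ e20) h1 := fa; have /cvgrPdist_lt/(_ _ e20) h2 := ub.
have [n [h1n h2n]] : exists n, `|0 - nrm (iota (fn n) - a)| < e / 2 /\
    `|0 - nrm (iota (twist xi phi (fn n)) - b)| < e / 2.
  have [N _ hN] := h1; have [M _ hM] := h2; exists (maxn N M).
  by split; [apply: hN; exact: leq_maxl|apply: hM; exact: leq_maxr].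
move: h1n h2n; rewrite !sub0r !normrN !ger0_norm// => h1n h2n.
have i1 := jfP b x (Cc_twist xi phi (cf n)).
have i2 := jfP a (gaut_fun (phi^-1)%g x) (cf n).
have i3 : md (twist xi phi (fn n) x - twist xi phi (jf a) x) =
    md (fn n (gaut_fun (phi^-1)%g x) - jf a (gaut_fun (phi^-1)%g x)).
  by rewrite /twist -mulrBr modM coc_mod1 mul1r.
have : md (jf b x - twist xi phi (jf a) x) <= md (jf b x - twist xi phi (fn n) x) +
    md (twist xi phi (fn n) x - twist xi phi (jf a) x).
  by apply: le_trans (modD _ _); rewrite addrA subrK.
rewrite i3 (modB (jf b x) (twist xi phi (fn n) x)); lra.
Qed.

Definition tw xi phi a : A := projT1 (cid (tw_ex xi phi a)).

Lemma jf_tw xi phi a x : jf (tw xi phi a) x = xi x * jf a (gaut_fun (phi^-1)%g x).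
Proof. by rewrite /tw; case: cid => b /= [_ ->]. Qed.

Lemma nrm_tw xi phi a : nrm (tw xi phi a) <= nrm a.
Proof. by rewrite /tw; case: cid => b /= []. Qed.

Lemma tw_lin xi phi c a b : tw xi phi (c *: a + b) = c *: tw xi phi a + tw xi phi b.
Proof.
by apply: jf_inj; apply/funext => x; rewrite jf_tw !jf_lin !jf_tw mulrDr mulrCA.
Qed.

Lemma tw_iota xi phi f : is_Cc f -> tw xi phi (iota f) = iota (twist xi phi f).
Proof.
move=> cf; apply: jf_inj; apply/funext => x; rewrite jf_tw !jf_iota//.
exact: Cc_twist.
Qed.

Lemma twD xi phi a b : tw xi phi (a + b) = tw xi phi a + tw xi phi b.
Proof. by have := tw_lin xi phi 1 a b; rewrite !scale1r. Qed.

Lemma tw0 xi phi : tw xi phi 0 = 0.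
Proof. by apply: (addrI (tw xi phi 0)); rewrite -twD !addr0. Qed.

Lemma cobis_gaut (phi : gaut G) B : cobisection B -> cobisection (gaut_fun phi @` B).
Proof.
move=> hB; have [_ c1 c2] := subg_mem phi; split.
- apply: continuous_compact; last by case: hB.
  exact: continuous_subspaceT.
- have -> : gaut_fun phi @` B = gaut_fun (phi^-1)%g @^-1` B.
    apply/seteqP; split => [_ [b Bb <-]|x Bx] /=; first by rewrite gaut_funVK.
    by exists (gaut_fun (phi^-1)%g x) => //; exact: gaut_funK.
  by apply: open_comp => [x _|]; [exact: c2|case: hB].
- split => x y; rewrite !inE => -[a Ba <-] [b Bb <-].
    by rewrite !gaut_rng => /gaut_inj ab; rewrite (cobis_injr hB Ba Bb ab).
  by rewrite !gaut_src => /gaut_inj ab; rewrite (cobis_injs hB Ba Bb ab).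
Qed.

(** For a first factor carried by a bisection both products have one term, and the identity is
    multiplicativity of xi along x = phi(d) (phi(d)^-1 x). [Cc_ind] and density then free the first
    factor, the second being arbitrary from the start. *)
Lemma tw_mul xi phi a b : tw xi phi (a ** b) = tw xi phi a ** tw xi phi b.
Proof.
have [_ _ mxi] := cocP xi; pose psi := gaut_fun (phi^-1)%g.
have bis f B : is_Cc f -> cobisection B -> supp f `<=` B ->
    tw xi phi (iota f ** b) = tw xi phi (iota f) ** tw xi phi b.
  move=> cf hB sB; apply: jf_inj; apply/funext => x; rewrite jf_tw tw_iota//.
  have hB' := cobis_gaut phi hB; have ct := Cc_twist xi phi cf.
  have sB' : supp (twist xi phi f) `<=` gaut_fun phi @` B.
    move=> y; rewrite /supp /= /twist mulf_eq0 negb_or => /andP[_ h].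
    by exists (psi y); [exact: sB|exact: gaut_funK].
  have [[d [Bd rd]]|no] := pselect (exists d : G, B d /\ grng d = grng (psi x)).
    have rd' : grng (gaut_fun phi d) = grng x.
      by rewrite gaut_rng rd -gaut_rng gaut_funK.
    have Bd' : (gaut_fun phi @` B) (gaut_fun phi d) by exists d.
    rewrite (jmulL _ hB cf sB Bd rd) (jmulL _ hB' ct sB' Bd' rd').
    rewrite jf_tw /twist gaut_funVK.
    have c : gsrc (ginv (gaut_fun phi d)) = grng x by rewrite gsrc_inv.
    have -> : gaut_fun (phi^-1)%g (gmul (ginv (gaut_fun phi d)) x) = gmul (ginv d) (psi x).
      by rewrite gaut_mul// gaut_inv gaut_funVK.
    have -> : xi x = xi (gaut_fun phi d) * xi (gmul (ginv (gaut_fun phi d)) x).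
      rewrite -mxi; last by rewrite grng_mul// grng_inv.
      by rewrite gmulA ?grng_inv// gmul_inv rd' gmul_rng.
    by rewrite -!mulrA; congr (_ * _); rewrite mulrCA.
  rewrite (jmulL0 _ cf sB); last by move=> d Bd rd; apply: no; exists d.
  rewrite mulr0 (jmulL0 _ ct sB')// => _ [d Bd <-] rd; apply: no; exists d; split=> //.
  by rewrite /psi gaut_rng -rd gaut_rng gaut_funVK.
have Ccf f : is_Cc f -> tw xi phi (iota f ** b) = tw xi phi (iota f) ** tw xi phi b.
  move: f; apply: (Cc_ind hG aG).
  - by rewrite iota0 ba_mul0l tw0 ba_mul0l.
  - by move=> f g cf cg ef eg; rewrite iotaD// ba_mulDl !twD ba_mulDl ef eg.
  - exact: bis.
apply: jf_inj; apply/funext => x; move: a.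
have L0 : 0 <= nrm b by [].
have twB a c : tw xi phi a - tw xi phi c = tw xi phi (a - c).
  have -> : a - c = (-1) *: c + a by rewrite scaleN1r addrC.
  by rewrite tw_lin scaleN1r addrC.
apply: (@dense_eq (fun a => jf (tw xi phi (a ** b)) x)
  (fun a => jf (tw xi phi a ** tw xi phi b) x) (nrm b) (nrm b)) => //.
- move=> a c; apply: le_trans (jf_lip _ _ _) _; rewrite twB -ba_mulBl.
  by apply: le_trans (nrm_tw _ _ _) _; rewrite mulrC; exact: nrmM.
- move=> a c; apply: le_trans (jf_lip _ _ _) _; rewrite -ba_mulBl twB.
  apply: le_trans (nrmM _ _) _; rewrite mulrC.
  by apply: ler_pM => //; exact: nrm_tw.
- by move=> f cf; rewrite Ccf.
Qed.

Section TwistAut.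
Variables (xi xi' : cocycle R G) (phi phi' : gaut G).
Hypotheses (twK : cancel (tw xi phi) (tw xi' phi')) (twVK : cancel (tw xi' phi') (tw xi phi)).

Lemma tw_baut_set : baut_set (Sym twK twVK).
Proof.
split => [c a b|a b|a] /=; [exact: tw_lin|exact: tw_mul|].
rewrite !nrmE; congr (real_complex R _); apply/eqP; rewrite eq_le nrm_tw /=.
by rewrite -{1}(twK a); exact: nrm_tw.
Qed.

Definition tw_baut : baut A := @Subg _ (baut_subgroup A) (Sym twK twVK) tw_baut_set.
End TwistAut.

Lemma baut_ext (alpha beta : baut A) : (forall a x, jf (al alpha a) x = jf (al beta a) x) ->
  alpha = beta.
Proof.
move=> h; apply: subg_inj; apply: sym_inj => a; apply: jf_inj; apply/funext => x.
exact: h.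
Qed.

Lemma gaut_ext (phi psi : gaut G) : (forall x, gaut_fun phi x = gaut_fun psi x) -> phi = psi.
Proof. by move=> h; apply: subg_inj; apply: sym_inj. Qed.

Lemma tw_cocK (xi : cocycle R G) : cancel (tw xi 1%g) (tw (xi^-1)%g 1%g).
Proof.
move=> a; apply: jf_inj; apply/funext => x; rewrite !jf_tw.
have E y : gaut_fun (1^-1)%g y = y :> G by [].
by rewrite !E -[(xi^-1)%g x]/((xi x)^-1) mulKf// coc_neq0.
Qed.

Lemma tw_autK (phi : gaut G) : cancel (tw 1%g phi) (tw 1%g (phi^-1)%g).
Proof.
move=> a; apply: jf_inj; apply/funext => x; rewrite !jf_tw.
have E y : (1%g : cocycle R G) y = 1 by [].
by rewrite !E !mul1r invgK gaut_funVK.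
Qed.

Lemma tw_cocVK (xi : cocycle R G) : cancel (tw (xi^-1)%g 1%g) (tw xi 1%g).
Proof. by rewrite -{2}[xi]invgK; exact: tw_cocK. Qed.
Lemma tw_autVK (phi : gaut G) : cancel (tw 1%g (phi^-1)%g) (tw 1%g phi).
Proof. by rewrite -{2}[phi]invgK; exact: tw_autK. Qed.

Definition Gamma (xi : cocycle R G) : baut A := tw_baut (@tw_cocK xi) (@tw_cocVK xi).
Definition Sigma (phi : gaut G) : baut A := tw_baut (@tw_autK phi) (@tw_autVK phi).

Lemma jf_Gamma xi a x : jf (al (Gamma xi) a) x = xi x * jf a x.
Proof. by rewrite -[al (Gamma xi) a]/(tw xi 1%g a) jf_tw. Qed.

Lemma jf_Sigma phi a x : jf (al (Sigma phi) a) x = jf a (gaut_fun (phi^-1)%g x).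
Proof. by rewrite -[al (Sigma phi) a]/(tw 1%g phi a) jf_tw mul1r. Qed.

Lemma GammaM xi eta : Gamma (xi * eta)%g = (Gamma xi * Gamma eta)%g.
Proof.
apply: baut_ext => a x; rewrite jf_Gamma.
rewrite -[al (Gamma xi * Gamma eta)%g a]/(al (Gamma xi) (al (Gamma eta) a)).
by rewrite !jf_Gamma mulrA.
Qed.

Lemma SigmaM phi psi : Sigma (phi * psi)%g = (Sigma phi * Sigma psi)%g.
Proof.
apply: baut_ext => a x; rewrite jf_Sigma.
rewrite -[al (Sigma phi * Sigma psi)%g a]/(al (Sigma phi) (al (Sigma psi) a)).
by rewrite !jf_Sigma invgM.
Qed.

Lemma Gamma_is_Gamma : is_Gamma iota Gamma.
Proof.
move=> xi f cf; apply: jf_inj; apply/funext => x.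
rewrite -[baut_fun (Gamma xi) (iota f)]/(al (Gamma xi) (iota f)) jf_Gamma !jf_iota//.
by have [c _ _] := cocP xi; exact: (Cc_mul hG cf c).
Qed.

Lemma Gamma_inj : injective Gamma.
Proof.
move=> xi eta e; apply: coc_inj => x; have [B [hB Bx]] := cobis_exT aG x.
have := jf_Gamma xi (one_ B) x; rewrite e jf_Gamma jone// indic1// !mulr1.
by move=> ->.
Qed.

Lemma Omega_Sigma phi : Omega (Sigma phi) = phi.
Proof.
apply: gaut_ext => x; rewrite OmegaE; apply/esym; apply: om_uniq => B hB Bx.
by rewrite /supp /= jf_Sigma gaut_funVK jone// indic1// oner_neq0.
Qed.

Lemma Omega_Gamma xi : Omega (Gamma xi) = 1%g.
Proof.
apply: gaut_ext => x; rewrite OmegaE; apply/esym; apply: om_uniq => B hB Bx.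
by rewrite /supp /= jf_Gamma jone// indic1// mulr1 coc_neq0.
Qed.

Lemma one_restrict B D : cobisection B -> cobisection D -> D `<=` B ->
  one_ B ** one_ (gsrc @` D) = one_ D.
Proof.
move=> hB hD DB; apply: jf_inj; apply/funext => x.
rewrite oneR; last exact: cou_src.
rewrite !jone//; have [Dx|nDx] := pselect (D x).
  have Bx := DB x Dx; by rewrite !indic1 ?mulr1//; exists x.
rewrite (indic0 _ nDx); have [Bx|nBx] := pselect (B x); last by rewrite indic0// mul0r.
rewrite [X in _ * X]indic0 ?mulr0// => -[d Dd sd]; apply: nDx.
by rewrite (cobis_injs hB Bx (DB d Dd) (esym sd)).
Qed.

(** * Automorphisms inducing the identity on the groupoid *)

Section Kernel.
Variable alpha : baut A.
Hypothesis om_id : forall x, om alpha x = x.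

Lemma ker_Phi B : cobisection B -> PhiA alpha B = B.
Proof.
move=> hB; apply/seteqP; split=> x; have := omP alpha x hB; rewrite om_id => h.
  exact: h.2.
exact: h.1.
Qed.

Lemma ker_one K : cou K -> al alpha (one_ K) = one_ K.
Proof.
by move=> hK; have [_ ->] := al_one alpha hK; rewrite ker_Phi//; exact: cou_cobis.
Qed.

Lemma ker_diag a : supp (jf a) `<=` @units G -> al alpha a = a.
Proof.
move=> su; apply: jf_inj; apply/funext => x; rewrite (al_diag_om alpha x su).
have -> : om (alpha^-1)%g (grng x) = grng x by rewrite -[RHS](omK alpha) om_id.
have [ux|nux] := pselect (units x); first by rewrite indic1// mul1r unit_rng.
rewrite indic0// mul0r; apply/esym/eqP/negPn/negP => h; apply: nux; exact: su.
Qed.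

Definition kerv x : C := jf (al alpha (one_ (projT1 (cid (cobis_exT aG x))))) x.

(** Two bisections through x are compared with their intersection, which is either one times the
    indicator of a set of units; alpha fixes that indicator. *)
Lemma kerv_loc B x : cobisection B -> B x -> jf (al alpha (one_ B)) x = kerv x.
Proof.
move=> hB Bx; rewrite /kerv; case: cid => B' /= [hB' B'x].
have hD := cobisI hG hB hB'.
have E E0 : cobisection E0 -> B `&` B' `<=` E0 ->
    jf (al alpha (one_ E0)) x = jf (al alpha (one_ (B `&` B'))) x.
  move=> hE sE; rewrite -[in RHS](one_restrict hE hD sE) al_mul (ker_one (cou_src hD)).
  rewrite oneR; last exact: cou_src.
  by rewrite indic1 ?mulr1//; exists x.
by rewrite !E// => t [].
Qed.

Lemma kerv_cocycle : is_cocycle kerv.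
Proof.
split.
- move=> x; have [B [hB Bx]] := cobis_exT aG x.
  have c : jf (al alpha (one_ B)) y @[y --> x] --> kerv x.
    by rewrite -(kerv_loc hB Bx); exact: jf_continuous.
  apply: cvg_trans c; apply: near_eq_cvg.
  have nB : nbhs x B by apply: open_nbhs_nbhs; split=> //; exact: cobis_open.
  by apply: filterS nB => y By; rewrite (kerv_loc hB By).
- move=> x; have [B [hB Bx]] := cobis_exT aG x.
  rewrite -(kerv_loc hB Bx); apply/norm_mod1.
  have [_ m1 _ _] := Phi_bis alpha hB; apply: m1.
  have : PhiA alpha B x by rewrite ker_Phi.
  exact.
- move=> x y xy; have [B [hB Bx]] := cobis_exT aG x; have [D [hD Dy]] := cobis_exT aG y.
  have [hM eM] := one_mul hB hD.
  have Mxy : set_gmul B D (gmul x y) by exists x, y.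
  rewrite -(kerv_loc hM Mxy) -eM al_mul -(kerv_loc hB Bx) -(kerv_loc hD Dy).
  have hP := Phi_cobis alpha hB; have cP := supp_Cc hP.
  have Px : jf (al alpha (one_ B)) x != 0.
    have : PhiA alpha B x by rewrite ker_Phi.
    exact.
  rewrite -{1}(iotaK cP) (jmul_supp (b := x) _ hP cP Px) ?grng_mul//.
  by rewrite gmulKl.
Qed.

Definition kerc : cocycle R G := Cocycle kerv_cocycle.

(** A function carried by a bisection B is d 1_B with d diagonal. As alpha fixes d, only alpha(1_B)
    remains, and its values are those of the cocycle. *)
Lemma ker_jf a x : jf (al alpha a) x = kerv x * jf a x.
Proof.
move: a; apply: (@dense_eq (fun a => jf (al alpha a) x) (fun a => kerv x * jf a x) 1 1) => //.
- by move=> a b; rewrite mul1r; apply: le_trans (jf_lip _ _ _) _; rewrite -alB nrm_al.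
- move=> a b; rewrite mul1r -mulrBr modM (coc_mod1 kerc) mul1r; exact: jf_lip.
apply: (Cc_ind hG aG).
- by rewrite iota0 al0 jf0 mulr0.
- by move=> f g cf cg ef eg; rewrite iotaD// alD !jfD ef eg mulrDr.
- move=> f B cf hB sB.
  have jB : supp (jf (one_ B)) = B by rewrite jone// supp_indic.
  have jfE : jf (iota f) = f by exact: jf_iota.
  have [|||du dm] := @supp_tbis_diag (iota f) (one_ B).
  - by rewrite jfE.
  - exact: tbis_one.
  - by rewrite jB jfE.
  set d := iota f ** _ in du dm.
  have hr := cou_rng hB; have [cr or sr] := hr.
  have dK : one_ (grng @` B) ** d = d.
    rewrite /d ba_mulA (one_lunit hr cf)// => y fy; exists y => //; exact: sB.
  clearbody d; have sdK : supp (jf d) `<=` grng @` B.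
    move=> y dy; have uy := du y dy; move: dy.
    rewrite /supp /= -dK oneL// unit_rng// cindicE.
    by case: asboolP => //; rewrite mul0r eqxx.
  have cd : is_Cc (jf d).
    by apply: (@Cc_intro _ _ hG _ (grng @` B)) => //; exact: jf_continuous.
  rewrite -dm al_mul (ker_diag du) -(iotaK cd) !(diagL _ _ cr or sr)//.
  rewrite mulrCA; congr (_ * _).
  have [Bx|nBx] := pselect (B x).
    by rewrite (kerv_loc hB Bx) jone// indic1// mulr1.
  rewrite jone// indic0// mulr0; apply/eqP/negPn/negP => h.
  have : PhiA alpha B x by [].
  by rewrite ker_Phi.
Qed.

Lemma Gamma_kerc : Gamma kerc = alpha.
Proof. by apply: baut_ext => a x; rewrite jf_Gamma ker_jf. Qed.

End Kernel.

Lemma Omega_ker alpha : Omega alpha = 1%g <-> exists xi, Gamma xi = alpha.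
Proof.
split=> [h|[xi <-]]; last exact: Omega_Gamma.
have om_id x : om alpha x = x by rewrite -OmegaE h.
by exists (kerc om_id); exact: Gamma_kerc.
Qed.

(** * Inner automorphisms and the full group *)

Lemma ad_formula u a (x b c : G) : tbis u -> jf u b != 0 -> jf u c != 0 ->
  grng b = grng x -> grng c = gsrc x ->
  jf (u ** a ** iota (star (jf u))) x =
  jf u b * jf a (gmul (gmul (ginv b) x) c) * (jf u c)^*.
Proof.
move=> [hu _] ub uc rb rc; have cu := supp_Cc hu.
have hs := cobis_inv hu; have cs := Cc_star hG cu.
have c1 : gsrc (ginv b) = grng x by rewrite gsrc_inv.
rewrite -ba_mulA -{1}(iotaK cu) (jmul_supp _ hu cu ub rb) -mulrA; congr (_ * _).
rewrite (@jmulR _ _ _ _ (ginv c) hs cs).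
- by rewrite ginvK /star ginvK.
- by rewrite supp_star.
- by exists c.
- by rewrite gsrc_inv rc gsrc_mul.
Qed.

Lemma implements_rng (B : set G) phi (b : G) : implements B phi -> B b -> gaut_fun phi (gsrc b) = grng b.
Proof.
move=> Bphi Bb; have : [set gaut_fun phi (gsrc b)] (grng b); last by move=> /= ->.
rewrite -Bphi; exists b, (ginv b); split.
- by exists b, (gsrc b); rewrite grng_src gmul_src.
- by exists b.
- by rewrite grng_inv.
- by rewrite gmul_inv.
Qed.

(** If D and D' implement the same phi, D'^-1 D is open and consists of arrows with equal range and
    source, so effectiveness puts it in the units. Elements of D and D' with the same range then
    coincide. *)
Lemma implements_uniq (B B' : full_group (proj1 aG)) phi : effective G ->
  implements (fg_set B) phi -> implements (fg_set B') phi -> B = B'.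
Proof.
move=> eff.
have half (D D' : full_group (proj1 aG)) : implements (fg_set D) phi ->
    implements (fg_set D') phi -> fg_set D `<=` fg_set D'.
  move=> h h' b Db; set M := set_gmul (set_ginv (fg_set D')) (fg_set D).
  have oM : open M.
    apply: (set_gmul_open (proj1 aG)); [|exact: fg_open|exact: fg_bisection|exact: fg_src].
    by apply: set_ginv_open; exact: fg_open.
  have Miso : M `<=` @iso_bundle G.
    move=> _ [_ [d [[d' Dd' <-] Dd dd ->]]]; rewrite /iso_bundle /=.
    rewrite grng_mul// gsrc_mul// grng_inv; rewrite gsrc_inv in dd.
    apply: (@gaut_inj G phi); rewrite (implements_rng h Dd) (implements_rng h' Dd').
    by rewrite dd.
  have Mu : M `<=` @units G.
    by rewrite -eff /interior -open_subsetE.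
  have : @units G (grng b) by exact: grng_unit.
  rewrite -(fg_rng D') => -[b' Db' rb'].
  have c : gsrc (ginv b') = grng b by rewrite gsrc_inv.
  have ub : units (gmul (ginv b') b) by apply: Mu; exists (ginv b'), b; split=> //; exists b'.
  suff -> : b = b' by [].
  have e : gmul b' (gmul (ginv b') b) = b.
    by rewrite gmulA ?grng_inv// gmul_inv rb' gmul_rng.
  by rewrite -e gmul_unitr// grng_mul// grng_inv.
by move=> h h'; apply: fg_inj; apply/seteqP; split; exact: half.
Qed.

Lemma implements_fun (B : set G) phi psi : implements B phi -> implements B psi -> phi = psi.
Proof.
move=> h h'; apply: gaut_ext => x.
have : [set gaut_fun phi x] (gaut_fun phi x) by [].
by rewrite -h h'.
Qed.

Lemma implementsM (B D : full_group (proj1 aG)) phi psi :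
  implements (fg_set B) phi -> implements (fg_set D) psi ->
  implements (fg_set (B * D)%g) (phi * psi)%g.
Proof.
move=> hB hD x.
have -> : fg_set (B * D : full_group (proj1 aG))%g = set_gmul (fg_set B) (fg_set D) by [].
by have := hB (gaut_fun psi x); rewrite -hD set_ginv_mul !set_gmulA => ->.
Qed.

Lemma implements1 : implements (fg_set (1%g : full_group (proj1 aG))) (1%g : gaut G).
Proof.
move=> x; rewrite set_gmul1.
have -> : set_ginv (fg_set (1%g : full_group (proj1 aG))) = @units G.
  by have := congr1 (@fg_set _) (@invg1 (full_group (proj1 aG))).
by rewrite set_gmulr1.
Qed.

Lemma implements_mem (B : full_group (proj1 aG)) phi (x b c : G) : implements (fg_set B) phi ->
  fg_set B b -> fg_set B c -> gsrc b = grng x -> gsrc c = gsrc x ->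
  gaut_fun phi x = gmul (gmul b x) (ginv c).
Proof.
move=> h Bb Bc sb sc; have : [set gaut_fun phi x] (gmul (gmul b x) (ginv c)); last by move=> /= ->.
rewrite -h; exists (gmul b x), (ginv c); split=> //; last by rewrite grng_inv gsrc_mul.
  by exists b, x.
by exists c.
Qed.

(** * Effective groupoids with compact non-empty unit space *)

Section Unital.
Hypotheses (eff : effective G) (cU : compact (@units G)) (U0 : @units G !=set0).
Local Notation FG := (full_group (proj1 aG)).
Local Notation e1 := (one_ (@units G)).

Lemma cou_units : cou (@units G).
Proof. by split=> //; apply: units_open; case: aG. Qed.

Lemma e1_mul : left_id e1 (@ba_mul _ A).
Proof.
move=> a; apply: jf_inj; apply/funext => x; rewrite (oneL _ _ cou_units) indic1 ?mul1r//.
exact: grng_unit.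
Qed.

Lemma e1_mulr : right_id e1 (@ba_mul _ A).
Proof.
move=> a; apply: jf_inj; apply/funext => x; rewrite (oneR _ _ cou_units) indic1 ?mulr1//.
exact: gsrc_unit.
Qed.

Lemma nrm1_of a x : nrm a <= 1 -> md (jf a x) = 1 -> `|a| = 1 :> C.
Proof.
move=> a1 ax; rewrite nrmE -(rmorph1 (real_complex R)); congr (real_complex R _).
by apply/eqP; rewrite eq_le a1 -ax jf_le.
Qed.

Lemma e1_norm : `|e1| = 1 :> C.
Proof.
have [u uu] := U0; apply: (@nrm1_of _ u).
  by apply: nrm_one; exact: (cou_cobis cou_units).
by rewrite jone ?indic1 ?mod1//; exact: (cou_cobis cou_units).
Qed.

Definition Uni : unital A := Unital e1_mul e1_mulr e1_norm.

Lemma nrm_of1 a : `|a| = 1 :> C -> nrm a = 1.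
Proof. by move=> h; rewrite /nrm h. Qed.

Lemma unitary_ipair u v : is_unitary_pair Uni u v -> ipair u v (@units G) (@units G).
Proof.
move=> [uv vu nu nv]; split; rewrite ?(nrm_of1 nu) ?(nrm_of1 nv)//; try exact: cou_units;
  by rewrite ?e1_mul ?e1_mulr.
Qed.

(** [ipair_supp] gives all sources but only an inclusion for ranges. From u^* u = 1 the inverse v is
    u^*, and u u^* = 1 then says that every unit is a range. *)
Lemma unitary_supp u v : is_unitary_pair Uni u v ->
  [/\ tbis u, gsrc @` supp (jf u) = @units G, grng @` supp (jf u) = @units G &
      v = iota (star (jf u))].
Proof.
move=> huv; have [uv vu _ _] := huv.
have [hu m1 sS _] := ipair_supp (unitary_ipair huv).
have tu : tbis u by [].
have ip := tbis_star tu.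
have ve : v = iota (star (jf u)).
  have := ip_wv ip; rewrite sS => h.
  by rewrite -[RHS]e1_mulr -[e1]uv ba_mulA h e1_mul.
split=> //; have h : one_ (grng @` supp (jf u)) = e1 by rewrite -(ip_vw ip) -ve uv.
have := congr1 jf h; rewrite (jone (cou_cobis (ip_K ip))) (jone (cou_cobis cou_units)).
by move=> /(congr1 (@supp R G)); rewrite !supp_indic.
Qed.

Lemma supp_unitary u : tbis u -> gsrc @` supp (jf u) = @units G ->
  grng @` supp (jf u) = @units G -> is_unitary_pair Uni u (iota (star (jf u))).
Proof.
move=> tu sS rS; have ip := tbis_star tu; have [u0 uu] := U0.
have [x ux _] : (gsrc @` supp (jf u)) u0 by rewrite sS.
have cu := supp_Cc tu.1.
split.
- by rewrite (ip_vw ip) rS.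
- by rewrite (ip_wv ip) sS.
- by apply: (@nrm1_of _ x); [exact: ip_v1 ip|exact: tu.2].
- apply: (@nrm1_of _ (ginv x)); first exact: ip_w1 ip.
  by rewrite jf_iota ?mod_star ?ginvK; [exact: tu.2|exact: Cc_star].
Qed.

Lemma ad_ex u v : is_unitary_pair Uni u v ->
  exists alpha : baut A, forall a, al alpha a = u ** a ** v.
Proof.
move=> [uv vu nu nv].
have K w z : w ** z = e1 -> z ** w = e1 -> cancel (fun a => w ** a ** z) (fun a => z ** a ** w).
  by move=> wz zw a; rewrite !ba_mulA zw e1_mul -ba_mulA zw e1_mulr.
have n1 w z a : nrm w = 1 -> nrm z = 1 -> nrm (w ** a ** z) <= nrm a.
  move=> w1 z1; apply: le_trans (nrmM _ _) _; rewrite z1 mulr1.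
  by apply: le_trans (nrmM _ _) _; rewrite w1 mul1r.
have uK := K u v uv vu; have vK := K v u vu uv.
have bs : baut_set (Sym uK vK).
  split=> [c a b|a b|a] /=.
  - by rewrite ba_mulDr ba_mulZr ba_mulDl ba_mulZl.
  - by rewrite -!ba_mulA; congr (_ ** (_ ** _)); rewrite ba_mulA vu e1_mul.
  - rewrite !nrmE; congr (real_complex R _); apply/eqP; rewrite eq_le.
    rewrite n1 ?(nrm_of1 nu) ?(nrm_of1 nv)//= -{1}(uK a) /=.
    by rewrite n1 ?(nrm_of1 nu) ?(nrm_of1 nv).
by exists (@Subg _ (baut_subgroup A) (Sym uK vK) bs).
Qed.

Lemma inn_al u v alpha : is_unitary_pair Uni u v -> (forall a, al alpha a = u ** a ** v) ->
  inn_set Uni alpha.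
Proof. by move=> huv h; exists u, v. Qed.

Lemma src_ex (B : set G) (x : G) : gsrc @` B = @units G -> exists b : G, B b /\ gsrc b = gsrc x.
Proof.
move=> sB; have [b Bb sb] : (gsrc @` B) (gsrc x) by rewrite sB; exact: gsrc_unit.
by exists b.
Qed.
Lemma rng_ex (B : set G) (x : G) : grng @` B = @units G -> exists b : G, B b /\ grng b = grng x.
Proof.
move=> sB; have [b Bb sb] : (grng @` B) (grng x) by rewrite sB; exact: grng_unit.
by exists b.
Qed.

(** For x in B and b, c in the support of u composable with x, the value of u 1_B u^* at bxc^-1 is
    u(b) times the conjugate of u(c), which is not zero; [om_uniq] identifies the point. *)
Lemma ad_implements u alpha : tbis u -> gsrc @` supp (jf u) = @units G ->
  (forall a, al alpha a = u ** a ** iota (star (jf u))) ->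
  implements (supp (jf u)) (Omega alpha).
Proof.
move=> tu sS h x.
have om_in (b c : G) : supp (jf u) b -> supp (jf u) c -> gsrc b = grng x -> gsrc c = gsrc x ->
    gmul (gmul b x) (ginv c) = om alpha x.
  move=> ub uc sb sc; apply: om_uniq => B hB Bx.
  have c1 : gsrc (gmul b x) = grng (ginv c) by rewrite gsrc_mul// grng_inv.
  have E : gmul (gmul (ginv b) (gmul (gmul b x) (ginv c))) c = x.
    rewrite gmulA ?gsrc_inv ?grng_mul// gmulKl// -gmulA ?grng_inv ?gsrc_inv//.
    by rewrite gmul_invl sc gmul_src.
  rewrite /supp /= h (ad_formula (b := b) (c := c) _ tu ub uc).
  - by rewrite E jone// indic1// mulr1 mulf_neq0// conjC_eq0.
  - by rewrite !grng_mul.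
  - by rewrite gsrc_mul// gsrc_inv.
apply/seteqP; split.
  move=> _ [_ [_ [[b [_ [ub -> bx ->]]] [c uc <-] bc ->]]] /=.
  by rewrite gsrc_mul// grng_inv in bc; apply: om_in.
move=> _ ->; rewrite OmegaE.
have [b [ub sb]] := @src_ex (supp (jf u)) (grng x) sS; rewrite gsrc_rng in sb.
have [c [uc sc]] := @src_ex (supp (jf u)) x sS.
rewrite -(om_in b c)//; exists (gmul b x), (ginv c); split=> //.
- by exists b, x.
- by exists c.
- by rewrite gsrc_mul// grng_inv.
Qed.

Lemma inn_full alpha : inn_set Uni alpha -> exists B : FG, implements (fg_set B) (Omega alpha).
Proof.
move=> [u [v [huv h]]]; have [tu sS rS ve] := unitary_supp huv.
have [[_ oS bS] _] := tu.
exists (@FullGroup _ (supp (jf u)) oS bS rS sS : FG); apply: ad_implements => //.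
by move=> a; rewrite -ve; exact: h.
Qed.

(** Compactness comes from the unit space, of which B is the image under the continuous section of
    r. *)
Lemma full_cobis (B : FG) : cobisection (fg_set B).
Proof.
split; [|exact: fg_open|exact: fg_bisection].
have -> : fg_set B = rsec (fg_set B) @` @units G.
  apply/seteqP; split=> [b Bb|_ [u uu <-]].
    have rr : (grng @` fg_set B) (grng (grng b)) by rewrite fg_rng grng_rng; exact: grng_unit.
    have [B' r'] := rsecP rr; exists (grng b); first exact: grng_unit.
    rewrite grng_rng in r'; have [ir _] := fg_bisection B.
    by apply: ir; rewrite ?inE.
  have rr : (grng @` fg_set B) (grng u) by rewrite fg_rng; exact: grng_unit.
  by have [] := rsecP rr.
apply: continuous_compact => //; apply: continuous_subspaceT => x.
apply: (rsec_continuous aG (fg_open B) (fg_bisection B)).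
by rewrite fg_rng; exact: grng_unit.
Qed.

Lemma supp_full (B : FG) : supp (jf (one_ (fg_set B))) = fg_set B.
Proof. by rewrite jone ?supp_indic//; exact: full_cobis. Qed.

Lemma full_unitary (B : FG) :
  is_unitary_pair Uni (one_ (fg_set B)) (iota (star (jf (one_ (fg_set B))))).
Proof.
apply: supp_unitary; first exact: tbis_one (full_cobis B).
  by rewrite supp_full fg_src.
by rewrite supp_full fg_rng.
Qed.

Definition Ad (B : FG) : baut A := projT1 (cid (ad_ex (full_unitary B))).

Lemma AdE (B : FG) a :
  al (Ad B) a = one_ (fg_set B) ** a ** iota (star (jf (one_ (fg_set B)))).
Proof. by rewrite /Ad; case: cid. Qed.

Lemma Ad_inn (B : FG) : inn_set Uni (Ad B).
Proof. exact: inn_al (full_unitary B) (AdE B). Qed.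

Lemma Ad_implements (B : FG) : implements (fg_set B) (Omega (Ad B)).
Proof.
rewrite -{1}(supp_full B); apply: ad_implements; last exact: AdE.
  exact: tbis_one (full_cobis B).
by rewrite supp_full fg_src.
Qed.

Lemma jf_full (B : FG) (b : G) : fg_set B b -> jf (one_ (fg_set B)) b = 1.
Proof. by move=> Bb; rewrite jone ?indic1//; exact: full_cobis. Qed.

(** The indicator is 1 on B, so conjugation leaves a(b^-1 x c), and b^-1 x c is the preimage of x
    under phi. Multiplicativity of [Ad] and the descent of [Sigma] to the quotients both follow from
    this. *)
Lemma Ad_Sigma (B : FG) phi : implements (fg_set B) phi -> Ad B = Sigma phi.
Proof.
move=> hB; apply: baut_ext => a x; rewrite AdE jf_Sigma.
have [b [Bb rb]] := @rng_ex (fg_set B) x (fg_rng B).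
have [c [Bc rc]] := @rng_ex (fg_set B) (gsrc x) (fg_rng B); rewrite grng_src in rc.
have b1 := jf_full Bb; have c1 := jf_full Bc.
have b0 : jf (one_ (fg_set B)) b != 0 by rewrite b1 oner_neq0.
have c0 : jf (one_ (fg_set B)) c != 0 by rewrite c1 oner_neq0.
rewrite (ad_formula _ (tbis_one (full_cobis B)) b0 c0 rb rc) b1 c1 mul1r rmorph1 mulr1.
congr (jf a _); apply: (@gaut_inj G phi); rewrite gaut_funK.
have s1 : gsrc (ginv b) = grng x by rewrite gsrc_inv.
have s2 : gsrc (gmul (ginv b) x) = grng c by rewrite gsrc_mul.
rewrite (implements_mem (b := b) (c := c) hB Bb Bc).
- rewrite gmulA ?grng_mul ?grng_inv// gmulA ?grng_inv// gmul_inv rb gmul_rng.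
  by rewrite gmulK.
- by rewrite !grng_mul// grng_inv.
- by rewrite gsrc_mul.
Qed.

Lemma AdM (B D : FG) : Ad (B * D)%g = (Ad B * Ad D)%g.
Proof.
rewrite (Ad_Sigma (Ad_implements B)) (Ad_Sigma (Ad_implements D)) -SigmaM.
by apply: Ad_Sigma; apply: implementsM; exact: Ad_implements.
Qed.

Lemma cob_inn xi : cob_set xi -> inn_set Uni (Gamma xi).
Proof.
(* The unitary is the conjugate of f on the units, since conj(f(r(x))) a(x) f(s(x)) is the
   coboundary times a. The unit space is clopen, so extension by zero is continuous. *)
move=> [f [cf nf xiE]]; pose d x : C := \1_(@units G) x * (f (gsrc x))^*.
have [_ oU _] := cou_units; have clU : closed (@units G) by exact: compact_closed.
have d_u u : units u -> d u = (f u)^* by move=> uu; rewrite /d indic1// mul1r uu.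
have d_0 u : ~ units u -> d u = 0 by move=> uu; rewrite /d indic0// mul0r.
have cd : is_Cc d.
  apply: (@Cc_intro _ _ hG _ (@units G)); [|exact: cU|]; last first.
    by move=> x; rewrite /supp /=; apply: contra_neqP => /d_0.
  apply: (cont_clopen oU clU); last exact: d_0.
  move=> x; rewrite inE => ux.
  rewrite /prop_for /continuous_at d_u//.
  have cfx : f y @[y --> x] --> f x.
    have := cf; rewrite continuous_open_subspace// => /(_ x).
    by rewrite inE; apply.
  have cfc : (f y)^* @[y --> x] --> (f x)^*.
    exact: (@continuous_comp _ _ _ f (fun z => z^*) x cfx (@conj_continuous R (f x))).
  apply: cvg_trans cfc; apply: near_eq_cvg.
  have nU : nbhs x (@units G) by exact: open_nbhs_nbhs.
  by apply: filterS nU => y /d_u.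
have jd : jf (iota d) = d by exact: jf_iota.
have d_mod u : units u -> md (d u) = 1.
  by move=> uu; rewrite d_u// mod_conj; apply/norm_mod1; exact: nf.
have sd : supp d = @units G.
  apply/seteqP; split=> x; rewrite /supp /=.
    by apply: contra_neqP => /d_0.
  by move=> ux; rewrite -mod_eq0 d_mod// oner_eq0.
have td : tbis (iota d).
  rewrite /tbis jd sd; split; first exact: (cou_cobis cou_units).
  move=> x dx; apply: d_mod; have : supp d x by []; by rewrite sd.
have ru : grng @` @units G = @units G.
  apply/seteqP; split=> [_ [x _ <-]|u uu]; first exact: grng_unit.
  by exists u => //; exact: unit_rng.
have su : gsrc @` @units G = @units G.
  by apply/seteqP; split=> [_ [x _ <-]|u uu]; [exact: gsrc_unit|exists u].
have hu : is_unitary_pair Uni (iota d) (iota (star (jf (iota d)))).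
  by apply: supp_unitary => //; rewrite jd sd.
apply: (inn_al hu) => a; apply: jf_inj; apply/funext => x; rewrite jf_Gamma.
have ur := grng_unit x; have us := gsrc_unit x.
have dr : jf (iota d) (grng x) != 0 by rewrite jd -mod_eq0 d_mod// oner_eq0.
have ds : jf (iota d) (gsrc x) != 0 by rewrite jd -mod_eq0 d_mod// oner_eq0.
rewrite (ad_formula a td dr ds) ?grng_rng ?grng_src//.
rewrite ginv_unit// gmul_rng gmul_src jd xiE !d_u// conjCK.
by rewrite mulrAC.
Qed.

(** [Gamma xi] induces the identity on G, so the support of the unitary u implements the identity;
    effectiveness makes it the unit space. Then the conjugate of u on the units has xi as
    coboundary. *)
Lemma inn_cob xi : inn_set Uni (Gamma xi) -> cob_set xi.
Proof.
move=> [u [v [huv h]]]; have [tu sS rS ve] := unitary_supp huv.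
have [[_ oS bS] _] := tu.
have imp : implements (supp (jf u)) (Omega (Gamma xi)).
  by apply: ad_implements => // a; rewrite -ve; exact: h.
pose B : FG := @FullGroup _ (supp (jf u)) oS bS rS sS.
have B1 : B = 1%g.
  apply: (implements_uniq eff (phi := 1%g)); last exact: implements1.
  by rewrite -(Omega_Gamma xi).
have Su : supp (jf u) = @units G by exact: (congr1 (@fg_set _) B1).
have u0 w : units w -> jf u w != 0 by move=> uw; have : supp (jf u) w by rewrite Su.
exists (fun x => (jf u x)^*); split.
- apply: continuous_subspaceT => x.
  apply: (@continuous_comp _ _ _ (jf u) (fun z => z^*)); first exact: jf_continuous.
  exact: conj_continuous.
- by move=> w uw; rewrite norm_conjC; apply/norm_mod1; apply: tu.2; exact: u0.
- move=> x; rewrite conjCK; have [D [hD Dx]] := cobis_exT aG x.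
  have := jf_Gamma xi (one_ D) x; rewrite jone// indic1// mulr1 => <-.
  have -> : al (Gamma xi) (one_ D) = u ** one_ D ** v by exact: h.
  rewrite ve (ad_formula (one_ D) tu (u0 _ (grng_unit x)) (u0 _ (gsrc_unit x))) ?grng_rng ?grng_src//.
  rewrite ginv_unit; last exact: grng_unit.
  by rewrite gmul_rng gmul_src jone// indic1// mulr1.
Qed.

Definition Gamma_hom : {multiplicative cocycle R G -> baut A} := multiplicative_of GammaM.
Definition Omega_hom : {multiplicative baut A -> gaut G} := multiplicative_of OmegaM.
Definition Sigma_hom : {multiplicative gaut G -> baut A} := multiplicative_of SigmaM.

Lemma split_exact_aut : split_exact Gamma_hom Omega_hom.
Proof.
split; first exact: Gamma_inj.
- exact: Omega_ker.
- by move=> phi; exists (Sigma phi); exact: Omega_Sigma.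
- by exists Sigma_hom; exact: Omega_Sigma.
Qed.

Lemma split_exact_inn :
  exists (Gam1 : {multiplicative subg (cob_subgroup R G) -> subg (inn_subgroup Uni)})
         (Om1 : {multiplicative subg (inn_subgroup Uni) -> FG}),
    [/\ forall xi, subg_val (Gam1 xi) = Gamma_hom (subg_val xi),
        forall alpha, implements (fg_set (Om1 alpha)) (Omega_hom (subg_val alpha))
      & split_exact Gam1 Om1].
Proof.
have [Gam1 G1E] := @subg_morph _ _ (cob_subgroup R G) (inn_subgroup Uni) Gamma_hom cob_inn.
(* A full bisection is merely chosen for each inner automorphism; multiplicativity of [Om1] and its
   value on each [Ad B] come from uniqueness of the implementing bisection. *)
have /choice[Om1 O1E] (alpha : subg (inn_subgroup Uni)) :
    exists B : FG, implements (fg_set B) (Omega (subg_val alpha)).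
  by apply: inn_full; exact: (subg_mem alpha).
have O1M alpha beta : Om1 (alpha * beta)%g = (Om1 alpha * Om1 beta)%g.
  apply: (implements_uniq eff (O1E _)).
  rewrite -[subg_val (alpha * beta)%g]/(subg_val alpha * subg_val beta)%g OmegaM.
  exact: implementsM.
pose Ad1 (B : FG) : subg (inn_subgroup Uni) := @Subg _ (inn_subgroup Uni) (Ad B) (Ad_inn B).
have Ad1M (B D : FG) : Ad1 (B * D)%g = (Ad1 B * Ad1 D)%g by apply: subg_inj; exact: AdM.
have OmAd (B : FG) : Om1 (Ad1 B) = B by apply: (implements_uniq eff (O1E _)); exact: Ad_implements.
exists Gam1, (multiplicative_of O1M); split=> //; split.
- move=> xi eta e; apply: subg_inj; apply: Gamma_inj.
  by have := congr1 (@subg_val _ _) e; rewrite !G1E.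
- move=> alpha; split=> [h|[xi <-]].
    have /Omega_ker[xi xiE] : Omega (subg_val alpha) = 1%g.
      apply: (implements_fun (O1E alpha)).
      have -> : Om1 alpha = 1%g by exact: h.
      exact: implements1.
    have cxi : cob_set xi by apply: inn_cob; rewrite xiE; exact: (subg_mem alpha).
    exists (@Subg _ (cob_subgroup R G) xi cxi); apply: subg_inj.
    by rewrite G1E.
  apply: (implements_uniq eff (O1E _)); rewrite G1E.
  by rewrite -[Gamma_hom _]/(Gamma _) Omega_Gamma; exact: implements1.
- by move=> B; exists (Ad1 B); exact: OmAd.
- by exists (multiplicative_of Ad1M); exact: OmAd.
Qed.

Lemma split_exact_out :
  exists (Gam2 : {multiplicative quot (cob_normal R G) -> quot (inn_normal Uni)})
         (Om2 : {multiplicative quot (inn_normal Uni) -> quot (fg_normal (proj1 aG))}),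
    [/\ forall xi, Gam2 (qpi _ xi) = qpi _ (Gamma_hom xi),
        forall alpha, Om2 (qpi _ alpha) = qpi _ (Omega_hom alpha)
      & split_exact Gam2 Om2].
Proof.
have [Gam2 G2E] := @quot_morph _ _ (cob_normal R G) (inn_normal Uni) Gamma_hom cob_inn.
have [Om2 O2E] := @quot_morph _ _ (inn_normal Uni) (fg_normal (proj1 aG)) Omega_hom inn_full.
have [|Sig2 S2E] := @quot_morph _ _ (fg_normal (proj1 aG)) (inn_normal Uni) Sigma_hom.
  by move=> phi [B hB]; rewrite -[Sigma_hom phi]/(Sigma phi) -(Ad_Sigma hB); exact: Ad_inn.
have SO q : Om2 (Sig2 q) = q.
  rewrite -(qreprK q) S2E O2E; congr qpi; exact: Omega_Sigma.
exists Gam2, Om2; split=> //; split.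
- move=> p q; rewrite -(qreprK p) -(qreprK q) !G2E => /qpiP h; apply/qpiP.
  apply: inn_cob; rewrite GammaM.
  suff -> : Gamma (qrepr p)^-1%g = (Gamma (qrepr p))^-1%g by exact: h.
  apply: (mulIg (Gamma (qrepr p))); rewrite -GammaM !mulVg.
  by apply: (mulIg (Gamma 1%g)); rewrite -GammaM !mul1g.
- move=> q; rewrite -(qreprK q); move: (qrepr q) => alpha; split.
    rewrite O2E => /esym/qpiP; rewrite invg1 mul1g => -[B hB].
    (* If [Omega alpha] is implemented by B, dividing alpha by the inner automorphism [Ad B] puts it
       in the kernel of [Omega], where it is given by a cocycle. *)
    have /Omega_ker[xi xiE] : Omega (alpha * (Ad B)^-1)%g = 1%g.
      have e : Omega alpha = Omega (Ad B) by apply: (implements_fun hB); exact: Ad_implements.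
      apply: (mulIg (Omega (Ad B))); rewrite -OmegaM mulgVK mul1g.
      exact: e.
    exists (qpi _ xi); rewrite G2E; apply/qpiP.
    rewrite -[Gamma_hom xi]/(Gamma xi) xiE invgM invgK mulgVK.
    exact: Ad_inn.
  move=> [p <-]; rewrite -(qreprK p) G2E O2E; congr qpi; exact: Omega_Gamma.
- by move=> q; exists (Sig2 q).
- by exists Sig2.
Qed.

End Unital.
End Algebra.

Theorem theoremB (R : realType) (G : groupoid)
    (hG : hausdorff_space G) (aG : ample G)
    (k : algebra_kind R) (hk : admissible k)
    (A : banachAlg (Cplx R)) (iota : (G -> Cplx R) -> A)
    (hA : is_completion k iota) :
  exists (j : A -> G -> Cplx R)
         (Gam : {multiplicative cocycle R G -> baut A})
         (Om : {multiplicative baut A -> gaut G}),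
    [/\ is_C0_inclusion iota j,
        is_Gamma iota Gam,
        is_Omega iota j Om,
        split_exact Gam Om
      & effective G -> compact (@units G) -> @units G !=set0 ->
        exists U : unital A,
          [/\ ba_one U = iota \1_(@units G),
              exists (Gam1 : {multiplicative subg (cob_subgroup R G) ->
                                             subg (inn_subgroup U)})
                     (Om1 : {multiplicative subg (inn_subgroup U) ->
                                            full_group (proj1 aG)}),
                [/\ forall xi, subg_val (Gam1 xi) = Gam (subg_val xi),
                    forall alpha,
                      implements (fg_set (Om1 alpha)) (Om (subg_val alpha))
                  & split_exact Gam1 Om1]
            & exists (Gam2 : {multiplicative quot (cob_normal R G) ->
                                             quot (inn_normal U)})
                     (Om2 : {multiplicative quot (inn_normal U) ->
                                            quot (fg_normal (proj1 aG))}),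
                [/\ forall xi, Gam2 (qpi _ xi) = qpi _ (Gam xi),
                    forall alpha, Om2 (qpi _ alpha) = qpi _ (Om alpha)
                  & split_exact Gam2 Om2] ] ].
Proof.
exists (jf iota), (Gamma_hom hG aG hk hA), (Omega_hom hG aG hk hA); split.
- exact: (jf_inclusion hG aG hk hA).
- exact: (Gamma_is_Gamma hG aG hk hA).
- exact: (Omega_is_Omega hG aG hk hA).
- exact: (split_exact_aut hG aG hk hA).
- move=> eff cU U0; exists (Uni hG aG hk hA cU U0); split=> //.
    exact: (split_exact_inn hG aG hk hA eff cU U0).
  exact: (split_exact_out hG aG hk hA eff cU U0).
Qed.
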